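(* Let $G$ be a Fuchsian group, let $A$ be a finitely generated abelian group with a finite action of $G$, and let $L$ be the geodesic language on $G$ with respect to a finite generating set $X$. Then every class in $H^2(G;A)$ is represented by an $L$-regular cocycle.
   Context: A Fuchsian group here means any finitely generated discrete subgroup of $\mathrm{Isom}(\mathbb H^2)$ (orientation-preserving or not). An action of $G$ on $A$ is finite if its image in $\mathrm{Aut}(A)$ is finite; it is written as a right action $a\mapsto a^g$. **Languages.** $X$ is a finite set with a map $X\to G$ whose image generates $G$ as a monoid and is symmetric ($\overline X=\overline X^{-1}$); the induced monoid homomorphism $X^*\to G$ is written $w\mapsto\overline w$. The geodesic language $L\subset X^*$ is the set of all words $w\in X^*$ that have minimal length among all words in $X^*$ with value $\overline w$ (for a Fuchsian group this is a biautomatic structure on $G$). A subset $S\subset G$ is $L$-rational if $\{w\in L:\overline w\in S\}$ is a regular language. **Cocycles.** A 2-cocycle on $G$ with coefficients in $A$ (written additively) is a map $\sigma:G\times G\to A$ with $\sigma(g_1,g_2)^{g_3}+\sigma(g_1g_2,g_3)=\sigma(g_1,g_2g_3)+\sigma(g_2,g_3)$; coboundaries are the maps $(g_1,g_2)\mapsto c(g_1)^{g_2}+c(g_2)-c(g_1g_2)$ for $c:G\to A$, and $H^2(G;A)$ is cocycles modulo coboundaries. A 2-cocycle $\sigma$ is $L$-regular if (1) the sets $\sigma(\overline X,G)$ and $\sigma(G,\overline X)$ are finite, and (2) for each $x\in X$ and $a\in A$ the set $\{g\in G:\sigma(g,\overline x)=a\}$ is $L$-rational. *)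

(* Defs.v *)
From HB Require Import structures.
From mathcomp Require Import all_boot all_order all_algebra.
From mathcomp Require Import all_classical all_reals all_analysis.

Set Implicit Arguments.
Unset Strict Implicit.
Unset Printing Implicit Defensive.

Import Order.TTheory GRing.Theory Num.Theory.
Import numFieldNormedType.Exports.

Local Open Scope classical_set_scope.
Local Open Scope ring_scope.

(* The upper half-plane model.  [hyp_plane R] and [isom_hyp_plane R] are the
   [set_type]s of the sets below, hence carry the subspace topology: of [R * R]
   for the former (this is also the topology of [hyp_dist]), of the compact-open
   topology for the latter. *)
Definition upper_half_plane (R : realType) : set (R * R)%type :=
  [set z | 0 < z.2].
Arguments upper_half_plane R _ : clear implicits.

Definition hyp_plane (R : realType) : Type := upper_half_plane R.
HB.instance Definition _ (R : realType) :=
  Topological.copy (hyp_plane R) (set_type (upper_half_plane R)).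

Definition arcosh (R : realType) (t : R) : R := ln (t + Num.sqrt (t ^+ 2 - 1)).

(* cosh d(z, w) = 1 + |z - w|^2 / (2 Im z Im w). *)
Definition hyp_dist (R : realType) (p q : hyp_plane R) : R :=
  let: (x1, y1) := set_val p in let: (x2, y2) := set_val q in
  arcosh (1 + ((x1 - x2) ^+ 2 + (y1 - y2) ^+ 2) / (2 * y1 * y2)).

Definition hyp_isometry (R : realType) :
    set {compact-open, hyp_plane R -> hyp_plane R} :=
  [set f | bijective f /\ forall p q, hyp_dist (f p) (f q) = hyp_dist p q].
Arguments hyp_isometry R _ : clear implicits.

Definition isom_hyp_plane (R : realType) : Type := hyp_isometry R.
HB.instance Definition _ (R : realType) :=
  Topological.copy (isom_hyp_plane R) (set_type (hyp_isometry R)).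

Section IsomGroup.
Variable R : realType.
Implicit Types f g h : isom_hyp_plane R.

Definition isom_fun f : hyp_plane R -> hyp_plane R := set_val f.

Lemma isom_funP f : hyp_isometry R (isom_fun f).
Proof. exact: set_valP. Qed.

Lemma isom_fun_inj : injective isom_fun.
Proof. exact: val_inj. Qed.

Lemma isom_inv_subproof f : exists k : hyp_plane R -> hyp_plane R,
  [/\ cancel (isom_fun f) k, cancel k (isom_fun f) & hyp_isometry R k].
Proof.
have [[k fk kf] iso] := isom_funP f; exists k; split=> //; split.
  by exists (isom_fun f).
by move=> p q; rewrite -iso !kf.
Qed.

Lemma isom_mul_subproof f g : hyp_isometry R (isom_fun f \o isom_fun g).
Proof.
have [bf iso_f] := isom_funP f; have [bg iso_g] := isom_funP g; split.
  exact: bij_comp.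
by move=> p q /=; rewrite iso_f iso_g.
Qed.

Lemma isom_one_subproof : hyp_isometry R (@id (hyp_plane R)).
Proof. by split=> //; exists id. Qed.

Definition isom_one : isom_hyp_plane R := SigSub (mem_set isom_one_subproof).
Definition isom_mul f g : isom_hyp_plane R :=
  SigSub (mem_set (isom_mul_subproof f g)).
Definition isom_inv f : isom_hyp_plane R :=
  let: exist k (And3 _ _ iso_k) := cid (isom_inv_subproof f) in
  SigSub (mem_set iso_k).

Fact isom_mulA : associative isom_mul.
Proof. by move=> f g h; apply: isom_fun_inj. Qed.

Fact isom_1mul : left_id isom_one isom_mul.
Proof. by move=> f; apply: isom_fun_inj. Qed.

Fact isom_mul1 : right_id isom_one isom_mul.
Proof. by move=> f; apply: isom_fun_inj. Qed.

Fact isom_Vmul : left_inverse isom_one isom_inv isom_mul.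
Proof.
move=> f; apply: isom_fun_inj; rewrite /isom_inv; case: cid => k [fk kf iso_k].
by apply/funext => p; exact: fk.
Qed.

Fact isom_mulV : right_inverse isom_one isom_inv isom_mul.
Proof.
move=> f; apply: isom_fun_inj; rewrite /isom_inv; case: cid => k [fk kf iso_k].
by apply/funext => p; exact: kf.
Qed.

End IsomGroup.

HB.instance Definition _ (R : realType) := isGroup.Build (isom_hyp_plane R)
  (@isom_mulA R) (@isom_1mul R) (@isom_mul1 R)
  (@isom_Vmul R) (@isom_mulV R).

Local Open Scope group_scope.

Definition finitely_generated_group (G : groupType) : Prop :=
  exists s : seq G, forall g : G, exists w : seq G,
    all (fun h => (h \in s) || (h^-1 \in s)) w /\ g = \prod_(h <- w) h.

(* G is isomorphic, via [rho], to a discrete subgroup of Isom(H^2); discreteness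
   says that every point of the subgroup is isolated in it. *)
Definition fuchsian (R : realType) (G : groupType) : Prop :=
  finitely_generated_group G /\
  exists rho : {multiplicative G -> isom_hyp_plane R},
    injective rho /\ isolated (range rho) = range rho.

Definition finitely_generated_abelian (A : zmodType) : Prop :=
  exists (n : nat) (s : n.-tuple A), forall a : A, inIntSpan s a.

(* [act a g] is a^g. *)
Definition right_action (G : groupType) (A : zmodType) (act : A -> G -> A) :
    Prop :=
  [/\ forall a, act a 1 = a,
      forall a g h, act a (g * h) = act (act a g) h &
      forall g a b, act (a + b)%R g = (act a g + act b g)%R].

Definition finite_action (G : groupType) (A : zmodType) (act : A -> G -> A) :
    Prop :=
  finite_set (range (fun (g : G) (a : A) => act a g)).

Section Languages.
Variables (G : groupType) (X : finType) (ev : X -> G).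

Definition word_value (w : seq X) : G := \prod_(x <- w) ev x.

Definition generates_as_monoid : Prop := forall g : G, exists w, word_value w = g.

Definition symmetric_image : Prop := range ev = [set g^-1 | g in range ev].

Definition geodesic_language : set (seq X) :=
  [set w | forall v, word_value v = word_value w -> (size w <= size v)%N].

Definition regular_language (K : set (seq X)) : Prop :=
  exists (Q : finType) (start : Q) (step : Q -> X -> Q) (final : pred Q),
    forall w, K w <-> final (foldl step start w).

Definition rational (L : set (seq X)) (S : set G) : Prop :=
  regular_language [set w | L w /\ S (word_value w)].

End Languages.

Section Cocycles.
Variables (G : groupType) (A : zmodType) (act : A -> G -> A).
Local Open Scope ring_scope.

Definition cocycle2 : set (G -> G -> A) :=
  [set sigma | forall g1 g2 g3,
     act (sigma g1 g2) g3 + sigma (g1 * g2)%g g3 =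
     sigma g1 (g2 * g3)%g + sigma g2 g3].

Definition coboundary2 : set (G -> G -> A) :=
  [set (fun g1 g2 => act (c g1) g2 + c g2 - c (g1 * g2)%g) | c in [set: G -> A]].

(* H^2(G; A) as the set of cosets of the coboundaries in the cocycles. *)
Definition H2 : set (set (G -> G -> A)) :=
  [set [set tau | cocycle2 tau /\
                  coboundary2 (fun g1 g2 => tau g1 g2 - sigma g1 g2)]
  | sigma in cocycle2].

Definition regular_cocycle (X : finType) (ev : X -> G) (L : set (seq X))
    (sigma : G -> G -> A) : Prop :=
  [/\ cocycle2 sigma,
      finite_set [set sigma h g | h in range ev & g in [set: G]],
      finite_set [set sigma g h | g in [set: G] & h in range ev] &
      forall (x : X) (a : A), rational ev L [set g | sigma g (ev x) = a]].

End Cocycles.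

(* Main.v *)
Require Import Defs.
From HB Require Import structures.
From mathcomp Require Import all_boot all_order all_algebra.
From mathcomp Require Import all_classical all_reals all_analysis.
From Stdlib Require Import Lia.
From mathcomp Require Import zify_ssreflect zify_algebra lra.

Set Implicit Arguments.
Unset Strict Implicit.
Unset Printing Implicit Defensive.

Import Order.TTheory GRing.Theory Num.Theory.
Import numFieldNormedType.Exports.
Import SsreflectZifyInstances.Exports AlgebraZifyInstances.Exports.

(* The group acts properly on the hyperbolic plane, possibly with parabolic
   elements and infinite covolume.  Filling loops by tiles of the binary tiling,
   and noting that tiles far from an orbit get multiplicity 0 because the holes
   of a neighbourhood of the orbit have bounded depth, one obtains a homological
   linear isoperimetric inequality for the Cayley graph, hence the stability of
   quasi-geodesics.

   Let [sigma] be a normalised cocycle, and identify the value of a word in the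
   extension [E] of [G] by [A] with a pair [(g, s)].
   - Let [Xi] be an integral functional on [A].  Maximising
     [Xi s - K * size w] over the words [w] with value [g] gives [opt g], finite
     by the isoperimetric inequality; the maximisers are quasi-geodesics.  The
     cocycle [Xi sigma + d opt] is nonpositive, and since every geodesic passes
     near a maximiser its values follow from those on a ball: along a geodesic
     word they are computed by a finite automaton.  With equivariant coordinates
     [Xi i] this makes [m sigma] regular up to a coboundary [d C].
   - Correcting [sigma] by the value in [E] of a canonical geodesic makes its
     reduction mod [m] regular: canonical geodesics from [1] to two nearby points
     of equal ball type have a common suffix.
   - Let [sigma1] be the corrected cocycle.  Writing [C = c0 + m (m b)] with [c0]
     in a fixed finite set of residues mod [m ^ 2], put [tau = sigma1 + d (m b)].
     Then [m tau] is [m sigma1 + d C] up to the finite-state [d c0], and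
     [tau = sigma1] mod [m]; these two pieces of data determine [tau]. *)

(** * Proper actions on the hyperbolic plane *)

(** The free part and the torsion of [A] call for different devices. Integers are ordered, so a
    functional can be maximised: the defect of superadditivity is nonpositive and vanishes where an
    optimal word is cut, so a value on a far element is a maximum over a ball, hence computable from
    finitely many data. Residues carry no order but are finite in number, and there a comparison of
    canonical words is enough. The penalty [K] is one more than the isoperimetric constant: the
    constant keeps the maximum finite, the extra 1 makes maximisers quasi-geodesic. The modulus is
    [m ^ 2] for two reasons: [sigma1] is known only mod [m], but enters the propagation of [C]
    multiplied by [m]; and the correction of [sigma1] has to be divisible by [m] in order to leave
    residues mod [m] unchanged. Hyperbolicity enters only through the isoperimetric inequality.
    Because it is stated for arbitrary integral 1-cochains, it can be tested on a form [f1 df2] to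
    obtain stability of quasi-geodesics, and applied to the cochain of [sigma] to bound loops in the
    extension. *)

Section Hyperbolic.
Variable R : realType.
Local Open Scope ring_scope.
Local Open Scope classical_set_scope.
Implicit Types q : hyp_plane R.

Definition hx q : R := (set_val q).1.
Definition hy q : R := (set_val q).2.

Lemma hy_gt0 q : 0 < hy q.
Proof. exact: (set_valP q). Qed.

Definition cosh_dist q1 q2 : R :=
  1 + ((hx q1 - hx q2) ^+ 2 + (hy q1 - hy q2) ^+ 2) / (2 * hy q1 * hy q2).

Lemma hyp_distE q1 q2 : hyp_dist q1 q2 = arcosh (cosh_dist q1 q2).
Proof.
rewrite /hyp_dist /cosh_dist /hx /hy.
by case: (set_val q1) (set_val q2) => [x1 y1] [x2 y2].
Qed.

Lemma cosh_den_gt0 q1 q2 : 0 < 2 * hy q1 * hy q2.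
Proof. by rewrite !mulr_gt0 ?hy_gt0. Qed.

Lemma cosh_dist_ge1 q1 q2 : 1 <= cosh_dist q1 q2.
Proof.
rewrite /cosh_dist lerDl divr_ge0 //; first by rewrite addr_ge0 // sqr_ge0.
exact/ltW/cosh_den_gt0.
Qed.

Lemma cosh_dist_ge0 q1 q2 : 0 <= cosh_dist q1 q2.
Proof. exact: le_trans ler01 (cosh_dist_ge1 _ _). Qed.

Lemma cosh_distC q1 q2 : cosh_dist q1 q2 = cosh_dist q2 q1.
Proof. by rewrite /cosh_dist; congr (1 + _ / _); lra. Qed.

Lemma cosh_distxx q : cosh_dist q q = 1.
Proof. by rewrite /cosh_dist !subrr expr0n /= addr0 mul0r addr0. Qed.

Lemma cosh_distM q1 q2 : cosh_dist q1 q2 * (2 * hy q1 * hy q2) =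
  (hx q1 - hx q2) ^+ 2 + hy q1 ^+ 2 + hy q2 ^+ 2.
Proof.
rewrite /cosh_dist mulrDl divfK ?gt_eqF ?cosh_den_gt0 //; lra.
Qed.

Lemma cosh_dist_le q1 q2 c : (cosh_dist q1 q2 <= c) =
  ((hx q1 - hx q2) ^+ 2 + hy q1 ^+ 2 + hy q2 ^+ 2 <= c * (2 * hy q1 * hy q2)).
Proof. by rewrite -cosh_distM ler_pM2r // cosh_den_gt0. Qed.

(* cosh (a + b) <= 2 cosh a cosh b; it replaces the triangle inequality. *)
Lemma cosh_dist_trans q2 q1 q3 :
  cosh_dist q1 q3 <= 2 * cosh_dist q1 q2 * cosh_dist q2 q3.
Proof.
have y2_gt0 := hy_gt0 q2.
have e_gt0 : 0 < 2 * hy q1 * hy q3 * (2 * hy q2 ^+ 2).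
  by rewrite !mulr_gt0 ?exprn_gt0 ?hy_gt0.
rewrite -(ler_pM2r e_gt0).
have -> : cosh_dist q1 q3 * (2 * hy q1 * hy q3 * (2 * hy q2 ^+ 2)) =
  cosh_dist q1 q3 * (2 * hy q1 * hy q3) * (2 * hy q2 ^+ 2) by lra.
have -> : 2 * cosh_dist q1 q2 * cosh_dist q2 q3 *
    (2 * hy q1 * hy q3 * (2 * hy q2 ^+ 2)) =
  2 * (cosh_dist q1 q2 * (2 * hy q1 * hy q2)) *
    (cosh_dist q2 q3 * (2 * hy q2 * hy q3)) by lra.
rewrite !cosh_distM; set x1 := hx q1; set x2 := hx q2; set x3 := hx q3.
move: (hy q1) (hy q2) (hy q3) => y1 y2 y3.
(* After clearing denominators the difference of the two sides is twice the sum of these four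
   squares. *)
have := sqr_ge0 ((x1 - x2) * (x2 - x3) - y2 ^+ 2).
have := sqr_ge0 ((x1 - x2) * y3).
have := sqr_ge0 ((x2 - x3) * y1).
have := sqr_ge0 (y1 * y3).
lra.
Qed.

Lemma cosh_dist_trans_le q2 q1 q3 a b :
  cosh_dist q1 q2 <= a -> cosh_dist q2 q3 <= b ->
  cosh_dist q1 q3 <= 2 * a * b.
Proof.
move=> ha hb; apply: le_trans (cosh_dist_trans q2 q1 q3) _.
by rewrite ler_pM ?mulr_ge0 ?cosh_dist_ge0 ?ler_pM2l.
Qed.

Lemma arcosh_inj : {in >= (1 : R) &, injective (@arcosh R)}.
Proof.
have mono (s t : R) : 1 <= s -> s < t ->
    s + Num.sqrt (s ^+ 2 - 1) < t + Num.sqrt (t ^+ 2 - 1).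
  move=> s1 st; rewrite ltr_leD // ler_wsqrtr // lerD2r.
  by rewrite lerXn2r // ?nnegrE ltW // (lt_le_trans ltr01) // (le_trans s1) ?ltW.
have pos (s : R) : 1 <= s -> s + Num.sqrt (s ^+ 2 - 1) \is Num.pos.
  by move=> s1; rewrite posrE ltr_pwDl ?sqrtr_ge0 // (lt_le_trans ltr01).
move=> s t; rewrite !unfold_in /= => s1 t1 /(ln_inj (pos s s1) (pos t t1)) e.
by case: (ltgtP s t) => // [/(mono _ _ s1)|/(mono _ _ t1)]; rewrite e ltxx.
Qed.

Lemma isometry_cosh_dist (f : hyp_plane R -> hyp_plane R) q1 q2 :
  hyp_isometry R f -> cosh_dist (f q1) (f q2) = cosh_dist q1 q2.
Proof.
move=> [_ /(_ q1 q2)]; rewrite !hyp_distE.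
by apply: arcosh_inj; exact: cosh_dist_ge1.
Qed.

Definition hpt (x y : R) (y_gt0 : 0 < y) : hyp_plane R :=
  SigSub (mem_set (y_gt0 : upper_half_plane R (x, y))).

Lemma hx_hpt x y (y_gt0 : 0 < y) : hx (hpt x y_gt0) = x. Proof. by []. Qed.
Lemma hy_hpt x y (y_gt0 : 0 < y) : hy (hpt x y_gt0) = y. Proof. by []. Qed.

End Hyperbolic.

(** * Discreteness in the compact-open topology, tested on three points *)

Section Discrete.
Variable R : realType.
Local Open Scope ring_scope.
Local Open Scope classical_set_scope.
Implicit Types q : hyp_plane R.

Lemma set_val_hyp_continuous : continuous (fun q : hyp_plane R => set_val q : R * R).
Proof. exact: initial_continuous. Qed.

Lemma hx_continuous : continuous (@hx R).
Proof.
by move=> q; apply: cvg_comp _ _ (@set_val_hyp_continuous q) _; exact: cvg_fst.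
Qed.

Lemma hy_continuous : continuous (@hy R).
Proof.
by move=> q; apply: cvg_comp _ _ (@set_val_hyp_continuous q) _; exact: cvg_snd.
Qed.

Lemma cvg_cosh_dist (T : Type) (F : set_system T) (FF : Filter F)
    (a b : T -> hyp_plane R) (a0 b0 : hyp_plane R) :
  a z @[z --> F] --> a0 -> b z @[z --> F] --> b0 ->
  cosh_dist (a z) (b z) @[z --> F] --> cosh_dist a0 b0.
Proof.
move=> ha hb.
have hxa : hx (a z) @[z --> F] --> hx a0 by apply: cvg_comp _ _ ha _; exact: hx_continuous.
have hya : hy (a z) @[z --> F] --> hy a0 by apply: cvg_comp _ _ ha _; exact: hy_continuous.
have hxb : hx (b z) @[z --> F] --> hx b0 by apply: cvg_comp _ _ hb _; exact: hx_continuous.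
have hyb : hy (b z) @[z --> F] --> hy b0 by apply: cvg_comp _ _ hb _; exact: hy_continuous.
apply: cvgD; first exact: cvg_cst.
apply: cvgM.
  have dx : hx (a z) - hx (b z) @[z --> F] --> hx a0 - hx b0 by exact: cvgB.
  have dy : hy (a z) - hy (b z) @[z --> F] --> hy a0 - hy b0 by exact: cvgB.
  apply: cvgD.
    exact: (cvg_comp _ ((@GRing.exp R)^~ 2%N) dx (@exprn_continuous R 2 _)).
  exact: (cvg_comp _ ((@GRing.exp R)^~ 2%N) dy (@exprn_continuous R 2 _)).
apply: cvgV; first by rewrite gt_eqF ?cosh_den_gt0.
by apply: cvgM => //; apply: cvgM => //; exact: cvg_cst.
Qed.

Definition tri0 : hyp_plane R := hpt 0 (ltr01 : 0 < 1 :> R).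
Definition tri1 : hyp_plane R := hpt 0 (ltr0Sn R 1 : 0 < 2%:R :> R).
Definition tri2 : hyp_plane R := hpt 1 (ltr01 : 0 < 1 :> R).

(* The coordinates of a point with hyperbolic cosines [c0], [c1], [c2] of the
   distances to [tri0], [tri1], [tri2]. *)
Definition tri_y (c0 c1 : R) : R := 3 / (4 * c1 - 2 * c0).
Definition tri_x (c0 c1 c2 : R) : R := 1 / 2 - tri_y c0 c1 * (c2 - c0).

Lemma tri_den q :
  hy q * (4 * cosh_dist tri1 q - 2 * cosh_dist tri0 q) = 3.
Proof.
have := cosh_distM tri0 q; have := cosh_distM tri1 q.
rewrite !hx_hpt !hy_hpt; lra.
Qed.

Lemma tri_den_neq0 q : 4 * cosh_dist tri1 q - 2 * cosh_dist tri0 q != 0.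
Proof.
apply/eqP => e; have := tri_den q; rewrite e mulr0 => /esym/eqP.
by rewrite pnatr_eq0.
Qed.

Lemma tri_yP q : tri_y (cosh_dist tri0 q) (cosh_dist tri1 q) = hy q.
Proof. by rewrite /tri_y -(tri_den q) mulfK // tri_den_neq0. Qed.

Lemma tri_xP q :
  tri_x (cosh_dist tri0 q) (cosh_dist tri1 q) (cosh_dist tri2 q) = hx q.
Proof.
rewrite /tri_x tri_yP.
have := cosh_distM tri0 q; have := cosh_distM tri2 q.
rewrite !hx_hpt !hy_hpt; lra.
Qed.

(** The coordinates of [k q] are continuous functions of its distances to the three reference
    points, and these equal the distances from [q] to [r]. Prescribing the preimages [r] of the
    reference points, and not their images, is what makes the formulas [tri_x] and [tri_y] apply to
    [k q]. *)
Lemma isometry_near (q0 : hyp_plane R) (O : set (hyp_plane R)) :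
  open O -> O q0 ->
  \forall q \near q0 & r \near (tri0, (tri1, tri2)),
    forall k : hyp_plane R -> hyp_plane R, hyp_isometry R k ->
      k r.1 = tri0 -> k r.2.1 = tri1 -> k r.2.2 = tri2 -> O (k q).
Proof.
move=> oO Oq0.
have [V oV VE] : exists2 V : set (R * R), open V &
    (fun q : hyp_plane R => set_val q) @^-1` V = O by case: oO => V ? ?; exists V.
pose F := nbhs (q0, (tri0, (tri1, tri2))).
have cq : z.1 @[z --> F] --> q0 by exact: cvg_fst.
have c0 : z.2.1 @[z --> F] --> tri0.
  by apply: cvg_comp; [exact: cvg_snd | exact: cvg_fst].
have c12 : z.2.2 @[z --> F] --> (tri1, tri2).
  by apply: cvg_comp; [exact: cvg_snd | exact: cvg_snd].
have c1 : z.2.2.1 @[z --> F] --> tri1.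
  by apply: cvg_comp _ _ c12 _; exact: cvg_fst.
have c2 : z.2.2.2 @[z --> F] --> tri2.
  by apply: cvg_comp _ _ c12 _; exact: cvg_snd.
have d0 := cvg_cosh_dist _ c0 cq; have d1 := cvg_cosh_dist _ c1 cq.
have d2 := cvg_cosh_dist _ c2 cq.
have ty : tri_y (cosh_dist z.2.1 z.1) (cosh_dist z.2.2.1 z.1) @[z --> F] -->
    hy q0.
  rewrite -[hy q0]tri_yP; apply: cvgM; first exact: cvg_cst.
  apply: cvgV; first exact: tri_den_neq0.
  by apply: cvgB; (apply: cvgM; first exact: cvg_cst); [exact: d1 | exact: d0].
have tx : tri_x (cosh_dist z.2.1 z.1) (cosh_dist z.2.2.1 z.1)
    (cosh_dist z.2.2.2 z.1) @[z --> F] --> hx q0.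
  rewrite -[hx q0]tri_xP; apply: cvgB; first exact: cvg_cst.
  apply: cvgM; first by rewrite tri_yP.
  by apply: cvgB; [exact: d2 | exact: d0].
have txy := cvg_pair tx ty.
have : nbhs (hx q0, hy q0) V.
  apply: open_nbhs_nbhs; split => //.
  by move: Oq0; rewrite -VE /= [set_val q0]surjective_pairing.
move=> /txy nV.
have {}nV : F [set z | V (tri_x (cosh_dist z.2.1 z.1) (cosh_dist z.2.2.1 z.1)
  (cosh_dist z.2.2.2 z.1), tri_y (cosh_dist z.2.1 z.1) (cosh_dist z.2.2.1 z.1))].
  exact: nV.
suff : F [set z | forall k : hyp_plane R -> hyp_plane R, hyp_isometry R k ->
    k z.2.1 = tri0 -> k z.2.2.1 = tri1 -> k z.2.2.2 = tri2 -> O (k z.1)] by [].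
apply: filterS nV => -[q [r0 [r1 r2]]] /= Vq k iso_k k0 k1 k2.
rewrite -VE /= [set_val (k q)]surjective_pairing.
rewrite -[X in V (X, _)]/(hx (k q)) -[X in V (_, X)]/(hy (k q)).
have e0 : cosh_dist tri0 (k q) = cosh_dist r0 q by rewrite -k0 isometry_cosh_dist.
have e1 : cosh_dist tri1 (k q) = cosh_dist r1 q by rewrite -k1 isometry_cosh_dist.
have e2 : cosh_dist tri2 (k q) = cosh_dist r2 q by rewrite -k2 isometry_cosh_dist.
by rewrite -tri_xP -tri_yP e0 e1 e2.
Qed.

(** The sets [D r], for [r] near the limit, generate a filter of maps. It converges to the identity
    because the near-covering form of compactness turns the pointwise condition into one that is
    uniform on compact sets. *)
Lemma compact_open_nbhs_id (T : topologicalType) (J : Type) (N : set_system J)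
    (D : J -> set (T -> T)) (W : set {compact-open, T -> T}) :
  Filter N ->
  (forall (q : T) O, open O -> O q ->
     \forall q' \near q & r \near N, forall k, D r k -> O (k q')) ->
  nbhs (@id T : {compact-open, T -> T}) W ->
  \forall r \near N, D r `<=` W.
Proof.
move=> NF DO; pose F : set_system {compact-open, T -> T} :=
  fun P => N [set r | D r `<=` P].
have FF : Filter F.
  split.
  - exact: (@filterS _ N NF _ _ (fun r _ k _ => I) (@filterT _ N NF)).
  - move=> P Q FP FQ.
    exact: (@filterS2 _ N NF _ _ _ (fun r DP DQ k Dk => conj (DP k Dk) (DQ k Dk)) FP FQ).
  - move=> P Q PQ FP.
    exact: (@filterS _ N NF _ _ (fun r DP k Dk => PQ k (DP k Dk)) FP).
suff cF : F --> (@id T : {compact-open, T -> T}) by exact: cF.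
apply/compact_open_cvgP => K O cK oO KO.
move/compact_near_coveringP : cK => ncK.
have H := ncK _ N (fun r (q : T) => forall k, D r k -> O (k q)) NF
  (fun (q : T) Kq => DO _ O oO (KO _ (ex_intro2 _ _ q Kq erefl))).
apply: (@filterS _ N NF _ _ _ H) => r Hr k Dk _ [q Kq <-].
exact: Hr Kq _ Dk.
Qed.

Lemma isometry_nbhs_id (W : set {compact-open, hyp_plane R -> hyp_plane R}) :
  nbhs (@id (hyp_plane R) : {compact-open, hyp_plane R -> hyp_plane R}) W ->
  \forall r \near (tri0, (tri1, tri2)),
    forall k : hyp_plane R -> hyp_plane R, hyp_isometry R k ->
      k r.1 = tri0 -> k r.2.1 = tri1 -> k r.2.2 = tri2 -> W k.
Proof.
move=> /(compact_open_nbhs_id (D := fun r k => [/\ hyp_isometry R k,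
  k r.1 = tri0, k r.2.1 = tri1 & k r.2.2 = tri2])
  (nbhs_filter (tri0, (tri1, tri2)))) H.
have {}H : \forall r \near (tri0, (tri1, tri2)),
  [set k | [/\ hyp_isometry R k, k r.1 = tri0, k r.2.1 = tri1 & k r.2.2 = tri2]]
    `<=` W.
  apply: H => q O oO Oq; apply: filterS (isometry_near oO Oq) => -[q' r] /= Hr k.
  by case; exact: Hr.
by apply: filterS H => r Hr k ? ? ? ?; apply: Hr; split.
Qed.

End Discrete.

(** * Proper discontinuity on the orbit of the base point *)

Section Proper.
Local Open Scope ring_scope.
Local Open Scope classical_set_scope.

Lemma finite_int_code (T : Type) (S : set T) (J : finType) (f : T -> J -> int)
    (B : nat) :
  (forall t, S t -> forall j, `|f t j| <= B%:Z) ->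
  (forall t u, S t -> S u -> (forall j, f t j = f u j) -> t = u) ->
  finite_set S.
Proof.
move=> fB finj.
pose F t : {ffun J -> 'I_(2 * B).+1} := [ffun j => inord (absz (f t j + B%:Z))].
have Finj : {in S &, injective F}.
  move=> t u /set_mem St /set_mem Su /ffunP eF; apply: finj => // j.
  have := eF j; rewrite !ffunE => /(congr1 val) /=.
  have ht := fB _ St j; have hu := fB _ Su j.
  rewrite !inordK ?ltnS; [lia | lia | lia].
by rewrite -(eq_finite_set (inj_card_eq Finj)); exact: finite_finset.
Qed.

Variable R : realType.
Implicit Types q : hyp_plane R.

Lemma hyp_nbhs_cosh_dist q (U : set (hyp_plane R)) : nbhs q U ->
  exists2 e : R, 0 < e & forall r, cosh_dist q r < 1 + e -> U r.
Proof.
rewrite nbhsE => -[_ [[V oV <-] Vq] VU].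
have /nbhs_ballP [d /= d_gt0 dV] : nbhs (set_val q) V by apply: open_nbhs_nbhs.
set b := hy q; have b_gt0 : 0 < b := hy_gt0 q.
(* The bound [e <= 1] forces [y <= 4 * b]; the squared Euclidean distance is then below
   [2 * e * b * y <= 8 * e * b ^ 2 <= d ^ 2]. *)
pose e := Num.min 1 (d ^+ 2 / (8 * b ^+ 2)).
have e_gt0 : 0 < e by rewrite lt_min ltr01 divr_gt0 ?mulr_gt0 ?exprn_gt0.
have e_le1 : e <= 1 by rewrite ge_min lexx.
have e_led : e * (8 * b ^+ 2) <= d ^+ 2.
  by rewrite -ler_pdivlMr ?mulr_gt0 ?exprn_gt0 // ge_min lexx orbT.
exists e => // r; rewrite -(ltr_pM2r (cosh_den_gt0 q r)) cosh_distM -/b => hr.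
apply: VU => /=; apply: dV.
have y_gt0 := hy_gt0 r; set x := hx r in hr *; set y := hy r in hr y_gt0 *.
have hr' : (hx q - x) ^+ 2 + (b - y) ^+ 2 < 2 * e * (b * y) by lra.
have y_le : y <= 4 * b.
  rewrite leNgt; apply/negP => y_gt.
  have : (3 / 4 * y) ^+ 2 <= (b - y) ^+ 2 by nra.
  have : e * (b * y) <= b * y by rewrite ger_pMl // mulr_gt0.
  have := sqr_ge0 (hx q - x); have : 4 * b * y < y * y by rewrite ltr_pM2r.
  nra.
have hd : (hx q - x) ^+ 2 + (b - y) ^+ 2 < d ^+ 2.
  apply: lt_le_trans hr' _; apply: le_trans e_led.
  have : e * (b * y) <= e * (b * (4 * b)) by rewrite !ler_pM2l.
  lra.
have sq (t : R) : t ^+ 2 < d ^+ 2 -> `|t| < d.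
  by rewrite -(real_normK (num_real t)) ltr_pXn2r // ?nnegrE ?normr_ge0 // ltW.
have := sqr_ge0 (hx q - x); have := sqr_ge0 (b - y) => h1 h2.
split; apply: sq.
  by change ((hx q - x) ^+ 2 < d ^+ 2); lra.
by change ((b - y) ^+ 2 < d ^+ 2); lra.
Qed.

Lemma floor_abs_le (t : R) (B : nat) : `|t| <= B%:R -> `|Num.floor t| <= B.+1%:Z.
Proof.
rewrite ler_norml => /andP[lo hi].
have l : - B%:Z <= Num.floor t by rewrite floor_ge_int rmorphN.
have u : Num.floor t <= B%:Z.
  by rewrite -(ler_int R); apply: le_trans (floor_le _) _.
by lia.
Qed.

Lemma floor_eq_dist (t u : R) : Num.floor t = Num.floor u -> `|t - u| <= 1.
Proof.
move=> e; have /andP[] := floor_itv t; have /andP[] := floor_itv u.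
rewrite e intrD => a b c d; rewrite ler_norml; lra.
Qed.

Lemma cosh_dist_box (K : R) q : cosh_dist (tri0 R) q <= K ->
  [/\ `|hx q| <= 2 * K, hy q <= 2 * K & 1 <= 2 * K * hy q].
Proof.
rewrite cosh_dist_le hx_hpt hy_hpt => h; have y_gt0 := hy_gt0 q.
move: (hx q) (hy q) h y_gt0 => x y h y_gt0.
have x2 := sqr_ge0 x.
have K_gt0 : 0 < K by rewrite ltNge; apply/negP => K_le0; nra.
split; last nra; last by rewrite -(ler_pM2r y_gt0); lra.
have hK := sqr_ge0 (y - K).
have K4 : 0 <= 2 * K by lra.
by rewrite ler_norml; apply/andP; split; rewrite leNgt; apply/negP => hx; nra.
Qed.

Variables (G : groupType) (rho : {multiplicative G -> isom_hyp_plane R}).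
Local Open Scope group_scope.
Hypothesis rho_inj : injective rho.
Hypothesis rho_isolated : isolated (range rho) = range rho.

Definition gact (g : G) q : hyp_plane R := isom_fun (rho g) q.

Lemma gact_isometry g : hyp_isometry R (gact g).
Proof. exact: isom_funP. Qed.

Lemma cosh_dist_gact g q1 q2 : cosh_dist (gact g q1) (gact g q2) = cosh_dist q1 q2.
Proof. exact/isometry_cosh_dist/gact_isometry. Qed.

Lemma gactM g h q : gact (g * h) q = gact g (gact h q).
Proof. by rewrite /gact gmulfM. Qed.

Lemma gact1 q : gact 1 q = q.
Proof.
have [[k fk _] _] := gact_isometry 1.
by apply: (can_inj fk); rewrite -gactM mulg1.
Qed.

Lemma gactK g q : gact g^-1 (gact g q) = q.
Proof. by rewrite -gactM mulVg gact1. Qed.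

Lemma gactVK g q : gact g (gact g^-1 q) = q.
Proof. by rewrite -gactM mulgV gact1. Qed.

(** Only isolation of the identity is used. The inverse of [g] carries the points [gact g (tri i)]
    back to the reference points, so it lies in a given neighbourhood of the identity as soon as
    these points are close to them. *)
Lemma gact_discrete : exists2 e : R, (0 < e)%R & forall g : G,
  (cosh_dist (tri0 R) (gact g (tri0 R)) < 1 + e)%R ->
  (cosh_dist (tri1 R) (gact g (tri1 R)) < 1 + e)%R ->
  (cosh_dist (tri2 R) (gact g (tri2 R)) < 1 + e)%R -> g = 1.
Proof.
have : isolated (range rho) (rho 1) by rewrite rho_isolated; exists 1.
move=> [_ [V + Vrho]]; rewrite nbhsE => -[_ [[W oW <-] W1] WV].
have rho1 : isom_fun (rho 1) = id by apply/funext => q; exact: gact1.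
have nW : nbhs (@id (hyp_plane R) : {compact-open, hyp_plane R -> hyp_plane R}) W.
  by rewrite -[id]rho1; apply: open_nbhs_nbhs.
have [[U0 U12] /= [nU0 [[U1 U2] /= [nU1 nU2] U12E]] UW] := isometry_nbhs_id nW.
have [e0 e0_gt0 He0] := hyp_nbhs_cosh_dist nU0.
have [e1 e1_gt0 He1] := hyp_nbhs_cosh_dist nU1.
have [e2 e2_gt0 He2] := hyp_nbhs_cosh_dist nU2.
exists (Num.min e0 (Num.min e1 e2)); first by rewrite !lt_min e0_gt0 e1_gt0.
move=> g; rewrite -!ltrBlDl !lt_min => /and3P[+ _ _] /and3P[_ + _] /and3P[_ _ +].
rewrite !ltrBlDl => /He0 H0 /He1 H1 /He2 H2.
have Wg : W (gact g^-1).
  have := UW (gact g (tri0 R), (gact g (tri1 R), gact g (tri2 R))); apply.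
  - by split => //; apply: U12E.
  - exact: gact_isometry.
  - by rewrite /= gactK.
  - by rewrite /= gactK.
  - by rewrite /= gactK.
have : (V `&` range rho) (rho g^-1) by split; [exact: WV | exists g^-1].
rewrite Vrho => h; have /(congr1 (fun g : G => g^-1)) := rho_inj h.
by rewrite invgK invg1.
Qed.

(** A pigeonhole argument: the images of the three reference points stay in a compact box, and
    recording their coordinates on a fine grid leaves finitely many codes. Two elements with the
    same code differ by an element that [gact_discrete] forces to be 1. *)
Theorem gact_proper (D : R) :
  finite_set [set g | cosh_dist (tri0 R) (gact g (tri0 R)) <= D]%R.
Proof.
have [e e_gt0 He] := gact_discrete.
pose tri (i : 'I_3) := nth (tri0 R) [:: tri0 R; tri1 R; tri2 R] i.
pose Cm : R := (\sum_(i < 3) cosh_dist (tri0 R) (tri i))%R.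
have CmP i : (cosh_dist (tri0 R) (tri i) <= Cm)%R.
  rewrite /Cm (bigD1 i) //= lerDl sumr_ge0 // => j _; exact: cosh_dist_ge0.
pose K : R := (2 * Num.max 1 D * Cm)%R.
have Cm_gt0 : (0 < Cm)%R.
  by apply: lt_le_trans ltr01 (le_trans (cosh_dist_ge1 _ _) (CmP ord0)).
have K_gt0 : (0 < K)%R by rewrite !mulr_gt0 // lt_max ltr01.
have triK g : (cosh_dist (tri0 R) (gact g (tri0 R)) <= D)%R ->
    forall i, (cosh_dist (tri0 R) (gact g (tri i)) <= K)%R.
  move=> gD i; apply: (@cosh_dist_trans_le _ (gact g (tri0 R))).
    by rewrite le_max gD orbT.
  by rewrite cosh_dist_gact.
(* In the box heights are at least [1 / (2 * K)]. A mesh of [1 / M] with [4 * K ^ 2 < M * e]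
   therefore makes points in the same cell closer than the threshold [1 + e]. *)
pose M := Num.bound (4 * K ^+ 2 / e)%R.
have M_gt : (4 * K ^+ 2 < M%:R * e)%R.
  rewrite -ltr_pdivrMr //; apply: le_lt_trans (archi_boundP _) => //.
  by apply: divr_ge0; [have := sqr_ge0 K; lra | exact: ltW].
have M_ge1 : (1 <= M%:R :> R)%R.
  rewrite ler1n lt0n; apply/eqP => M0; move: M_gt; rewrite M0 mul0r.
  by have := sqr_ge0 K; lra.
pose B := Num.bound (M%:R * (2 * K))%R.
have B_gt : (M%:R * (2 * K) <= B%:R)%R.
  by apply/ltW/archi_boundP/mulr_ge0; [exact: ler0n | lra].
pose code (g : G) (j : 'I_3 * bool) : int :=
  Num.floor (M%:R * (if j.2 then @hx R else @hy R) (gact g (tri j.1)))%R.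
apply: (@finite_int_code _ _ _ code B.+1).
  move=> g /triK gK [i b]; have [hX hY _] := cosh_dist_box (gK i).
  apply: floor_abs_le; rewrite normrM ger0_norm ?ler0n //.
  apply: le_trans B_gt; rewrite ler_wpM2l ?ler0n //.
  by case: b => //=; rewrite gtr0_norm ?hy_gt0.
move=> g h /triK gK /triK hK eqc.
have close i : (cosh_dist (tri i) (gact (g^-1 * h)%g (tri i)) < 1 + e)%R.
  rewrite gactM -(cosh_dist_gact g) gactVK.
  rewrite -(ltr_pM2r (cosh_den_gt0 (gact g (tri i)) (gact h (tri i)))) cosh_distM.
  have [_ _ yg] := cosh_dist_box (gK i); have [_ _ yh] := cosh_dist_box (hK i).
  have /floor_eq_dist := eqc (i, true); have /floor_eq_dist := eqc (i, false).
  rewrite /= -!mulrBr !normrM ger0_norm ?ler0n //.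
  have := hy_gt0 (gact g (tri i)); have := hy_gt0 (gact h (tri i)).
  move: (hx _) (hy _) (hx _) (hy _) yg yh => xg yg xh yh Kg Kh yh0 yg0 dy dx.
  have Mgt0 : (0 < M%:R :> R)%R := lt_le_trans ltr01 M_ge1.
  have sq (t : R) : (M%:R * `|t| <= 1 -> M%:R ^+ 2 * t ^+ 2 <= 1)%R.
    move=> ht; rewrite -exprMn -(real_normK (num_real _)) normrM.
    by rewrite ger0_norm ?ler0n // expr_le1 // mulr_ge0 ?ler0n.
  have {}dx := sq _ dx; have {}dy := sq _ dy.
  have KK : (1 <= (2 * K * yg) * (2 * K * yh))%R by nra.
  have M2 : (4 * K ^+ 2 < M%:R ^+ 2 * e)%R.
    apply: lt_le_trans M_gt _.
    have : (0 <= (M%:R - 1) * (M%:R * e))%R.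
      by apply: mulr_ge0; [lra | apply: mulr_ge0; lra].
    lra.
  suff : ((xg - xh) ^+ 2 + (yg - yh) ^+ 2 < e * (2 * yg * yh))%R by lra.
  rewrite -(ltr_pM2l (exprn_gt0 2 Mgt0)).
  have yy : (0 < yg * yh)%R by rewrite mulr_gt0.
  have : (4 * K ^+ 2 * (yg * yh) < M%:R ^+ 2 * e * (yg * yh))%R by rewrite ltr_pM2r.
  lra.
have gh1 : (g^-1 * h)%g = 1%g.
  apply: He; [exact: (close ord0) | exact: (close (@Ordinal 3 1 isT)) | exact: (close (@Ordinal 3 2 isT))].
by rewrite -[g]mulg1 -gh1 mulVKg.
Qed.

End Proper.

(** * Isoperimetry and quasi-geodesics *)

Section Words.
Variables (G : groupType) (X : finType) (ev : X -> G).
Local Open Scope group_scope.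
Implicit Types (g h : G) (x y : X) (w : seq X).

Local Notation wv := (word_value ev).

Lemma wv_nil : wv [::] = 1.
Proof. by rewrite /word_value big_nil. Qed.

Lemma wv_cons x w : wv (x :: w) = ev x * wv w.
Proof. by rewrite /word_value big_cons. Qed.

Lemma wv_cat w1 w2 : wv (w1 ++ w2) = wv w1 * wv w2.
Proof. by rewrite /word_value big_cat. Qed.

Lemma wv_rcons w x : wv (rcons w x) = wv w * ev x.
Proof. by rewrite -cats1 wv_cat wv_cons wv_nil mulg1. Qed.

Definition xinv x : X := xget x [set y | ev y = (ev x)^-1].
Definition invw w : seq X := rev (map xinv w).

Definition geo g : seq X :=
  xget [::] [set w | wv w = g /\ forall v, wv v = g -> (size w <= size v)%N].
Definition len g : nat := size (geo g).
Definition wdist g h : nat := len (g^-1 * h).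

Fixpoint pint (phi : G -> X -> int) g w : int :=
  if w is x :: w' then (phi g x + pint phi (g * ev x) w')%R else 0%R.

Lemma pint_cat phi g w1 w2 :
  pint phi g (w1 ++ w2) = (pint phi g w1 + pint phi (g * wv w1) w2)%R.
Proof.
elim: w1 g => [|x w1 IH] g /=; first by rewrite wv_nil mulg1 add0r.
by rewrite IH wv_cons mulgA addrA.
Qed.

(* A homological form of hyperbolicity: [phi] is a 1-cochain on the Cayley graph
   and the loops of length at most [r] play the role of the 2-cells. *)
Definition linear_isoperimetric : Prop :=
  exists r C : nat, forall (phi : G -> X -> int) (B : int),
    (forall g w, (size w <= r)%N -> wv w = 1 -> (`|pint phi g w| <= B)%R) ->
    forall g w, wv w = 1 -> (`|pint phi g w| <= C%:Z * B * (size w)%:Z)%R.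

Hypotheses (gen : generates_as_monoid ev) (sym : symmetric_image ev).

Lemma ev_xinv x : ev (xinv x) = (ev x)^-1.
Proof.
rewrite /xinv; case: xgetP => [y _ -> //|/= H].
have : range ev (ev x)^-1 by rewrite sym; exists (ev x) => //; exists x.
by move=> [y _ ey]; case: (H y).
Qed.

Lemma wv_invw w : wv (invw w) = (wv w)^-1.
Proof.
elim: w => [|x w IH]; first by rewrite wv_nil invg1.
by rewrite /invw /= rev_cons wv_rcons -/(invw w) IH ev_xinv wv_cons invgM.
Qed.

Lemma size_invw w : size (invw w) = size w.
Proof. by rewrite size_rev size_map. Qed.

Lemma geo_spec g : wv (geo g) = g /\ forall v, wv v = g -> (size (geo g) <= size v)%N.
Proof.
rewrite /geo; case: xgetP => [w _ //|/= H]; exfalso.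
have [v vg] := gen g.
have exm : exists m, `[< exists2 u, wv u = g & size u = m >].
  by exists (size v); apply/asboolP; exists v.
have [m /asboolP[u ug um] mmin] := ex_minnP exm.
by apply: (H u); split=> // u' u'g; rewrite um; apply: mmin; apply/asboolP; exists u'.
Qed.

Lemma wv_geo g : wv (geo g) = g. Proof. by case: (geo_spec g). Qed.

Lemma len_wv w : (len (wv w) <= size w)%N.
Proof. by case: (geo_spec (wv w)) => _; apply. Qed.

Lemma geodesicP w : geodesic_language ev w <-> size w = len (wv w).
Proof.
split=> [/= Lw|sw v vw /=]; last by rewrite sw -vw; exact: len_wv.
by apply/eqP; rewrite eqn_leq len_wv andbT Lw // wv_geo.
Qed.

Lemma len1 : len 1 = 0%N.
Proof. by apply/eqP; rewrite -leqn0 -wv_nil; exact: len_wv. Qed.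

Lemma len_eq0 g : len g = 0%N -> g = 1.
Proof. by move=> /size0nil e; rewrite -(wv_geo g) e wv_nil. Qed.

Lemma lenM g h : (len (g * h) <= len g + len h)%N.
Proof. by rewrite -size_cat -{1}[g]wv_geo -{1}[h]wv_geo -wv_cat len_wv. Qed.

Lemma lenV g : len g^-1 = len g.
Proof.
have le_inv h : (len h^-1 <= len h)%N.
  by rewrite -{1}[h]wv_geo -wv_invw /len -(size_invw (geo h)); exact: len_wv.
by apply/eqP; rewrite eqn_leq le_inv -{1}[g]invgK le_inv.
Qed.

Lemma len_ev x : (len (ev x) <= 1)%N.
Proof. by rewrite -[ev x]mulg1 -wv_nil -wv_cons len_wv. Qed.

Lemma wdistxx g : wdist g g = 0%N.
Proof. by rewrite /wdist mulVg len1. Qed.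

Lemma wdistC g h : wdist g h = wdist h g.
Proof. by rewrite /wdist -lenV invgM invgK. Qed.

Lemma wdist_triangle k g h : (wdist g h <= wdist g k + wdist k h)%N.
Proof. by rewrite /wdist -{1}(mulVKg k h) mulgA lenM. Qed.

Lemma wdist_wv g w : (wdist g (g * wv w) <= size w)%N.
Proof. by rewrite /wdist mulKg len_wv. Qed.

Lemma geodesic_cat w1 w2 : geodesic_language ev (w1 ++ w2) ->
  geodesic_language ev w1 /\ geodesic_language ev w2.
Proof.
rewrite !geodesicP size_cat wv_cat => e; have := lenM (wv w1) (wv w2).
by have := len_wv w1; have := len_wv w2; lia.
Qed.

Lemma wdist_geodesic c i j : geodesic_language ev c -> (i <= j <= size c)%N ->
  wdist (wv (take i c)) (wv (take j c)) = (j - i)%N.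
Proof.
move=> Lc /andP[ij jc].
have ej : take j c = take i c ++ drop i (take j c).
  by rewrite -{1}(cat_take_drop i (take j c)) take_takel.
have Lij : geodesic_language ev (drop i (take j c)).
  move: Lc; rewrite -{1}(cat_take_drop j c) => /geodesic_cat[+ _].
  by rewrite {1}ej => /geodesic_cat[_].
rewrite ej /wdist wv_cat mulKg -(iffLR (geodesicP _) Lij).
by rewrite size_drop size_takel.
Qed.

Fixpoint dmin (cap : nat) (s : seq G) g : nat :=
  if s is h :: s' then minn (wdist h g) (dmin cap s' g) else cap.

Lemma dmin_lipschitz cap s g x : (`|(dmin cap s (g * ev x))%:Z - (dmin cap s g)%:Z| <= 1)%R.
Proof.
elim: s => [|h s IH] /=; first by rewrite subrr.
have h1 : (wdist g (g * ev x) <= 1)%N by rewrite /wdist mulKg len_ev.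
have h2 := wdist_triangle g h (g * ev x).
have h3 := wdist_triangle (g * ev x) h g; rewrite (wdistC (g * ev x) g) in h3.
by move: IH; lia.
Qed.

Lemma dmin0 cap s g : g \in s -> dmin cap s g = 0%N.
Proof.
elim: s => // h s IH; rewrite inE => /predU1P[->|/IH] /=; first by rewrite wdistxx min0n.
by move=> ->; rewrite minn0.
Qed.

Lemma dmin_cap cap s g : (forall h, h \in s -> (cap <= wdist h g)%N) -> dmin cap s g = cap.
Proof.
elim: s => //= h s IH H; rewrite IH => [|h' h's]; last by apply: H; rewrite inE h's orbT.
by apply/minn_idPr/H; rewrite inE eqxx.
Qed.

Section Form.
Variables f1 f2 : G -> nat.
Definition form g x : int := ((f1 g)%:Z * ((f2 (g * ev x))%:Z - (f2 g)%:Z))%R.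

Lemma pint_form_const k g w :
  (forall i, (i < size w)%N -> f1 (g * wv (take i w)) = k) ->
  pint form g w = (k%:Z * ((f2 (g * wv w))%:Z - (f2 g)%:Z))%R.
Proof.
elim: w g => [|x w IH] g H /=; first by rewrite wv_nil mulg1 subrr mulr0.
rewrite IH => [|i iw].
  have := H 0%N isT; rewrite /= wv_nil mulg1 /form => ->.
  by rewrite wv_cons mulgA -mulrDr [X in (_ * X)%R]addrC addrA subrK.
by rewrite -mulgA -wv_cons -(H i.+1).
Qed.

Lemma pint_form_const2 k g w :
  (forall i, (i <= size w)%N -> f2 (g * wv (take i w)) = k) ->
  pint form g w = 0%R.
Proof.
elim: w g => [|x w IH] g H //=; rewrite IH => [|i iw].
  have := H 0%N isT; have := H 1%N isT; rewrite /= take0 !wv_cons wv_nil !mulg1 /form.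
  by move=> -> ->; rewrite subrr mulr0.
by rewrite -mulgA -wv_cons -(H i.+1).
Qed.

Hypothesis f1L : forall g x, (`|(f1 (g * ev x))%:Z - (f1 g)%:Z| <= 1)%R.
Hypothesis f2L : forall g x, (`|(f2 (g * ev x))%:Z - (f2 g)%:Z| <= 1)%R.

Lemma lipschitz_wv g w : (`|(f2 (g * wv w))%:Z - (f2 g)%:Z| <= (size w)%:Z)%R.
Proof.
elim: w g => [|x w IH] g; first by rewrite wv_nil mulg1 subrr.
rewrite wv_cons mulgA /=; have := IH (g * ev x); have := f2L g x.
by move: (f2 _) (f2 _) (f2 _) (size w); lia.
Qed.

(** Freezing [f1] at its initial value leaves an exact form. The error made is at most one unit per
    step times the remaining variation of [f2], hence quadratic in the length; on a closed word only
    this error survives. *)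
Lemma pint_form_small g w :
  (`|pint form g w - (f1 g)%:Z * ((f2 (g * wv w))%:Z - (f2 g)%:Z)|
     <= (size w * size w)%N%:Z)%R.
Proof.
elim: w g => [|x w IH] g /=; first by rewrite wv_nil mulg1 subrr mulr0 subrr.
have := IH (g * ev x); rewrite wv_cons mulgA /form.
have := lipschitz_wv (g * ev x) w; have := f1L g x.
move: (f1 _) (f1 _) (f2 _) (f2 _) (f2 _) (size w) (pint _ _ _).
move=> a1 a b1 b b0 n P ha hb hP.
have : (`|(a%:Z - a1%:Z) * (b0%:Z - b%:Z)| <= 1 * n%:Z)%R.
  by rewrite normrM; apply: ler_pM.
by move: hP; rewrite !PoszM -addn1 PoszD; lia.
Qed.

End Form.

Lemma wv_seg p a k : (a + k <= size p)%N ->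
  wv (take a p) * wv (take k (drop a p)) = wv (take (a + k) p).
Proof. by move=> akp; rewrite -wv_cat takeD. Qed.

Lemma path_segment p a b : (a <= size p)%N -> (b <= size p)%N ->
  exists w, [/\ wv (take a p) * wv w = wv (take b p),
    size w = (maxn a b - minn a b)%N &
    forall k, (k <= size w)%N -> exists2 j, (j <= size p)%N &
      wv (take a p) * wv (take k w) = wv (take j p)].
Proof.
have fwd c d : (c <= d)%N -> (d <= size p)%N ->
    wv (take c p) * wv (take (d - c) (drop c p)) = wv (take d p) /\
    size (take (d - c) (drop c p)) = (d - c)%N.
  move=> cd dp; rewrite wv_seg ?subnKC //; split=> //.
  by rewrite size_takel // size_drop leq_sub2r.
move=> ap bp; case: (leqP a b) => [ab|/ltnW ba].
  have [e s] := fwd a b ab bp; exists (take (b - a) (drop a p)); split=> //.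
  move=> k; rewrite s => kba; exists (a + k)%N; first by lia.
  by rewrite take_takel // wv_seg //; lia.
have [e s] := fwd b a ba ap; set u := take (a - b) (drop b p) in e s.
exists (invw u); split; first by rewrite wv_invw -e mulgK.
  by rewrite size_invw s.
move=> k; rewrite size_invw => ku; exists (a - k)%N; first by lia.
have -> : take k (invw u) = invw (drop (size u - k) u).
  by rewrite /invw take_rev size_map map_drop.
rewrite wv_invw -e -{1}(cat_take_drop (size u - k) u) wv_cat mulgA mulgK s.
have -> : take (a - b - k) u = take (a - b - k) (drop b p).
  by rewrite /u take_takel // leq_subr.
by rewrite wv_seg; [congr (wv (take _ p))|]; move: ku; rewrite s; lia.
Qed.

Lemma geo_vertex g h k :
  (wdist g (g * wv (take k (geo (g^-1 * h)))) <= wdist g h)%N.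
Proof.
apply: leq_trans (wdist_wv _ _) _; rewrite size_take_min.
exact: geq_minr.
Qed.

Definition quasi_geodesic la ka p := forall i j, (i <= j <= size p)%N ->
  (j - i <= la * wdist (wv (take i p)) (wv (take j p)) + ka)%N.

(* The quadrilateral argument.  [f1] is the distance to a segment of radius
   [q] around the vertex [i] of the geodesic [c], cut off at [q]; [f2] is the
   distance to the next segment, cut off at [2 q].  The form [f1 df2] is small
   on short loops but integrates to [2 q ^ 2] on a loop of length [O(q)] made
   of a piece of [c], a piece of [p] and two short connecting paths. *)
Lemma geodesic_near_quasi_geodesic la ka : linear_isoperimetric ->
  exists N, forall c p : seq X, geodesic_language ev c -> wv p = wv c ->
    quasi_geodesic la ka p ->
    forall i, (i <= size c)%N -> exists2 j, (j <= size p)%N &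
      (wdist (wv (take i c)) (wv (take j p)) <= N)%N.
Proof.
move=> [r [C LI]].
(* These collect the final bound as [2 * q ^ 2 <= M1 * q + M2], using a loop of length at most
   [6 * D * (1 + la) + ka] and [D <= 2 * q + 1]. The value of [N] then makes [q] exceed [M1 + M2],
   which contradicts the bound. *)
pose M1 := (C * (r * r) * (12 * (1 + la)))%N.
pose M2 := (C * (r * r) * (6 * (1 + la) + ka))%N.
exists (2 * (M1 + M2) + 2)%N => c p Lc epc qp i0 i0c.
set N := (2 * (M1 + M2) + 2)%N.
apply: contrapT => farN.
pose far m := `[< exists2 i, (i <= size c)%N & forall j, (j <= size p)%N ->
   (m <= wdist (wv (take i c)) (wv (take j p)))%N >].
have far_ex : exists m, far m.
  exists N.+1; apply/asboolP; exists i0 => // j jp; rewrite ltnNge.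
  by apply/negP => ?; apply: farN; exists j.
have far_bd m : far m -> (m <= size c)%N.
  move=> /asboolP[i ic /(_ 0%N isT)]; rewrite wdistC take0 wv_nil => h.
  apply: leq_trans h _; rewrite -[wv (take i c)]mul1g.
  by apply: leq_trans (wdist_wv _ _) _; rewrite size_takel.
have [D farD Dmax] := ex_maxnP far_ex far_bd.
have ND : (N < D)%N.
  apply: Dmax; apply/asboolP; exists i0 => // j jp; rewrite ltnNge.
  by apply/negP => ?; apply: farN; exists j.
have near i : (i <= size c)%N -> exists2 j, (j <= size p)%N &
    (wdist (wv (take i c)) (wv (take j p)) <= D)%N.
  move=> ic; apply: contrapT => nj.
  suff : (D < D)%N by rewrite ltnn.
  apply: Dmax; apply/asboolP; exists i => // j jp; rewrite ltnNge.
  by apply/negP => ?; apply: nj; exists j.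
have [i ic iD] : exists2 i, (i <= size c)%N & forall j, (j <= size p)%N ->
   (D <= wdist (wv (take i c)) (wv (take j p)))%N by exact/asboolP.
clear far far_ex far_bd farD Dmax farN i0 i0c.
have Gd a b : (a <= b <= size c)%N -> wdist (wv (take a c)) (wv (take b c)) = (b - a)%N.
  exact: wdist_geodesic.
have Di : (D <= i)%N.
  by have := iD 0%N isT; rewrite wdistC take0 -[[::]](take0 c) Gd ?ic // subn0.
have iDc : (i + D <= size c)%N.
  have := iD _ (leqnn _); rewrite take_size epc -[in wv c](take_size c) Gd ?ic ?leqnn //.
  by lia.
pose q := D./2; have qD : (q.*2 <= D <= q.*2.+1)%N.
  by have := odd_double_half D; rewrite /q; case: (odd D) => /=; lia.
(* Going [2 * D] along [c] leaves room for a connecting path of length at most [D] that stays at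
   distance [D] from vertex [i]. If [c] ends earlier, the cut is made at its end, which is also an
   end of [p], and the connecting path is empty. *)
pose a := (i - 2 * D)%N; pose b := minn (i + 2 * D) (size c).
have [ja [jap la_ia la_D]] : exists ja, [/\ (ja <= size p)%N,
    (wdist (wv (take a c)) (wv (take ja p)) + D <= i - a)%N &
    (wdist (wv (take a c)) (wv (take ja p)) <= D)%N].
  have [i2D|i2D] := leqP (2 * D) i.
    have [|ja jap h] := near a; first by rewrite /a; lia.
    have ai2 : (i - a = 2 * D)%N by rewrite /a; lia.
    by exists ja; split=> //; rewrite ai2; lia.
  exists 0%N; have -> : a = 0%N by rewrite /a; lia.
  by rewrite !take0 wdistxx; split=> //; lia.
have [jb [jbp lb_ib lb_D]] : exists jb, [/\ (jb <= size p)%N,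
    (wdist (wv (take b c)) (wv (take jb p)) + D <= b - i)%N &
    (wdist (wv (take b c)) (wv (take jb p)) <= D)%N].
  have [i2D|i2D] := leqP (i + 2 * D)%N (size c).
    have [|jb jbp h] := near b; first by rewrite /b; lia.
    have bi2 : (b - i = 2 * D)%N by rewrite /b; lia.
    by exists jb; split=> //; rewrite bi2; lia.
  exists (size p); have -> : b = size c by rewrite /b; lia.
  by rewrite !take_size epc wdistxx; split=> //; lia.
set Pa := wv (take ja p) in la_ia la_D; set Pb := wv (take jb p) in lb_ib lb_D.
set Ga := wv (take a c) in la_ia la_D; set Gb := wv (take b c) in lb_ib lb_D.
have [pw [pwE pw_size pw_on]] := path_segment jbp jap.
have pw_le : (size pw <= la * (6 * D) + ka)%N.
  have h1 : (wdist Pa Pb <= 6 * D)%N.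
    have := wdist_triangle Ga Pa Pb; have := wdist_triangle Gb Ga Pb.
    have -> : wdist Ga Gb = (b - a)%N by apply: Gd; rewrite /a /b; lia.
    by rewrite (wdistC Pa Ga); move: la_D lb_D; rewrite /a /b; lia.
  have h2 : (la * wdist Pa Pb <= la * (6 * D))%N by rewrite leq_mul2l h1 orbT.
  rewrite pw_size; case: (leqP jb ja) => [jba|/ltnW jab].
    by have := qp jb ja; rewrite jba jap -/Pa -/Pb wdistC => /(_ isT); lia.
  by have := qp ja jb; rewrite jab jbp -/Pa -/Pb => /(_ isT); lia.
pose s1 := [seq wv (take k c) | k <- iota (i - q) (q.*2.+1)].
pose s2 := [seq wv (take k c) | k <- iota (i + q) (D - q).+1].
pose f1 := dmin q s1; pose f2 := dmin q.*2 s2.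
have f1L g x : (`|(f1 (g * ev x)%g)%:Z - (f1 g)%:Z| <= 1)%R by exact: dmin_lipschitz.
have f2L g x : (`|(f2 (g * ev x)%g)%:Z - (f2 g)%:Z| <= 1)%R by exact: dmin_lipschitz.
pose phi := form f1 f2.
have small g w : (size w <= r)%N -> wv w = 1 -> (`|pint phi g w| <= (r * r)%N%:Z)%R.
  move=> wr w1; have := pint_form_small f1L f2L g w.
  rewrite w1 mulg1 subrr mulr0 subr0 => h; apply: le_trans h _.
  by rewrite lez_nat leq_mul.
pose seg m n := take (n - m) (drop m c).
have segP m n k : (m <= n)%N -> (n <= size c)%N -> (k <= size (seg m n))%N ->
    wv (take m c) * wv (take k (seg m n)) = wv (take (m + k) c) /\ (m + k <= n)%N.
  move=> mn nc; rewrite size_takel ?size_drop ?leq_sub2r // => kmn.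
  by rewrite take_takel // wv_seg; [split=> //; lia | lia].
have seg_end m n : (m <= n)%N -> (n <= size c)%N ->
    wv (take m c) * wv (seg m n) = wv (take n c).
  by move=> mn nc; rewrite wv_seg subnKC.
have seg_size m n : (m <= n)%N -> (n <= size c)%N -> size (seg m n) = (n - m)%N.
  by move=> mn nc; rewrite size_takel // size_drop leq_sub2r.
have f1_far u : (forall k, (i - q <= k <= i + q)%N -> (q <= wdist (wv (take k c)) u)%N) ->
    f1 u = q.
  move=> H; apply: dmin_cap => _ /mapP[k + ->]; rewrite mem_iota => ?.
  by apply: H; lia.
pose wb := geo (Gb^-1 * Pb); pose wa := geo (Pa^-1 * Ga).
pose W1 := seg (i + D)%N b; pose W5 := seg a (i - D)%N.
pose W6 := seg (i - D)%N (i - q)%N; pose W7 := seg (i - q)%N (i + q)%N.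
pose W8 := seg (i + q)%N (i + D)%N.
have ib : (i + D <= b)%N by rewrite /b; lia.
have bc : (b <= size c)%N by rewrite /b; lia.
have ai : (a <= i - D)%N by rewrite /a; lia.
have [l1 l2 l3 [l4 l5]] : [/\ (i - D <= i - q)%N, (i - q <= i + q)%N,
   (i + q <= i + D)%N & (i - D <= size c)%N /\ (i - q <= size c)%N] by split; lia.
have l6 : (i + q <= size c)%N by lia.
pose W := W1 ++ wb ++ pw ++ wa ++ W5 ++ W6 ++ W7 ++ W8.
have W_size : (size W <= 6 * D + la * (6 * D) + ka)%N.
  have sb : size wb = wdist Gb Pb by [].
  have sa : size wa = wdist Ga Pa by rewrite wdistC.
  have b_le : (b <= i + 2 * D)%N by exact: geq_minl.
  have a_ge : (i <= a + 2 * D)%N by rewrite /a; lia.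
  have arith t a' b' q' u v s : (s <= t + ka -> u <= D -> v <= D ->
      q'.*2 <= D <= q'.*2.+1 -> i + D <= b' -> a' <= i - D ->
      b' <= i + 2 * D -> i <= a' + 2 * D -> D <= i ->
      b' - (i + D) + (v + (s + (u + (i - D - a' + (i - q' - (i - D) +
        (i + q' - (i - q') + (i + D - (i + q')))))))) <= 6 * D + t + ka)%N.
    by clear; lia.
  by rewrite /W !size_cat sb sa !seg_size //; apply: arith.
have f1_geod k : (k <= i - D)%N || ((i + D <= k)%N && (k <= size c)%N) ->
    f1 (wv (take k c)) = q.
  move=> hk; apply: f1_far => l hl; case/orP: hk => hk.
    by rewrite wdistC Gd; lia.
  by rewrite Gd; lia.
have f1_p j : (j <= size p)%N -> f1 (wv (take j p)) = q.
  move=> jp; apply: f1_far => k hk; have := iD j jp.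
  have := wdist_triangle (wv (take k c)) (wv (take i c)) (wv (take j p)).
  case: (leqP k i) => ki.
    by rewrite (wdistC (wv (take i c)) (wv (take k c))) Gd; lia.
  by rewrite Gd; lia.
have f1_near_a u : (wdist Ga u <= wdist Ga Pa)%N -> f1 u = q.
  move=> hu; apply: f1_far => k hk.
  have := wdist_triangle u Ga (wv (take k c)); rewrite (wdistC u).
  have -> : wdist Ga (wv (take k c)) = (k - a)%N by apply: Gd; rewrite /a; lia.
  by lia.
have f1_near_b u : (wdist Gb u <= wdist Gb Pb)%N -> f1 u = q.
  move=> hu; apply: f1_far => k hk.
  have := wdist_triangle u Gb (wv (take k c)); rewrite (wdistC u) (wdistC Gb (wv _)).
  have -> : wdist (wv (take k c)) Gb = (b - k)%N by apply: Gd; rewrite /b; lia.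
  by lia.
(* On the first five pieces [f1] is constantly [q], so the form integrates exactly. On [W6] and [W8]
   the function [f2] is constant, and on [W7] the function [f1] vanishes, so these three contribute
   nothing. *)
have I1 : pint phi (wv (take (i + D) c)) W1 =
    (q%:Z * ((f2 Gb)%:Z - (f2 (wv (take (i + D) c)))%:Z))%R.
  rewrite /phi (@pint_form_const _ _ q) ?seg_end // => k kW.
  by have [-> ?] := segP _ _ k ib bc (ltnW kW); apply: f1_geod; lia.
have I2 : pint phi Gb wb = (q%:Z * ((f2 Pb)%:Z - (f2 Gb)%:Z))%R.
  rewrite /phi (@pint_form_const _ _ q) ?wv_geo ?mulVKg // => k kW.
  by apply: f1_near_b; exact: geo_vertex.
have I3 : pint phi Pb pw = (q%:Z * ((f2 Pa)%:Z - (f2 Pb)%:Z))%R.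
  rewrite /phi (@pint_form_const _ _ q) ?pwE // => k kW.
  by have [j jp ->] := pw_on k (ltnW kW); exact: f1_p.
have I4 : pint phi Pa wa = (q%:Z * ((f2 Ga)%:Z - (f2 Pa)%:Z))%R.
  rewrite /phi (@pint_form_const _ _ q) ?wv_geo ?mulVKg // => k kW.
  apply: f1_near_a.
  have sw : (k <= size wa)%N by exact: ltnW.
  have := wdist_wv (Pa * wv (take k wa)) (drop k wa).
  rewrite -mulgA -(wv_cat (take k wa)) cat_take_drop wv_geo mulVKg size_drop.
  by rewrite wdistC => h; apply: leq_trans h _; rewrite (wdistC Ga) leq_subr.
have I5 : pint phi Ga W5 = (q%:Z * ((f2 (wv (take (i - D) c)))%:Z - (f2 Ga)%:Z))%R.
  rewrite /phi (@pint_form_const _ _ q) ?seg_end // => k kW.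
  by have [-> ?] := segP _ _ k ai l4 (ltnW kW); apply: f1_geod; lia.
have I6 : pint phi (wv (take (i - D) c)) W6 = 0%R.
  apply: (@pint_form_const2 _ _ q.*2) => k kW.
  have [-> ?] := segP (i - D)%N (i - q)%N k l1 l5 kW.
  apply: dmin_cap => _ /mapP[l + ->]; rewrite mem_iota => ?.
  by rewrite wdistC Gd; lia.
have I7 : pint phi (wv (take (i - q) c)) W7 = 0%R.
  rewrite /phi (@pint_form_const _ _ 0%N) ?mul0r // => k kW.
  have [-> ?] := segP (i - q)%N (i + q)%N k l2 l6 (ltnW kW).
  by apply: dmin0; apply/mapP; exists (i - q + k)%N; rewrite // mem_iota; lia.
have I8 : pint phi (wv (take (i + q) c)) W8 = 0%R.
  apply: (@pint_form_const2 _ _ 0%N) => k kW.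
  have [-> ?] := segP (i + q)%N (i + D)%N k l3 iDc kW.
  by apply: dmin0; apply/mapP; exists (i + q + k)%N; rewrite // mem_iota; lia.
have E1 : wv (take (i + D) c) * wv W1 = Gb by exact: seg_end.
have E2 : Gb * wv wb = Pb by rewrite wv_geo mulVKg.
have E4 : Pa * wv wa = Ga by rewrite wv_geo mulVKg.
have E5 : Ga * wv W5 = wv (take (i - D) c) by exact: seg_end.
have E6 : wv (take (i - D) c) * wv W6 = wv (take (i - q) c) by exact: seg_end.
have E7 : wv (take (i - q) c) * wv W7 = wv (take (i + q) c) by exact: seg_end.
have E8 : wv (take (i + q) c) * wv W8 = wv (take (i + D) c) by exact: seg_end.
have WE : wv W = 1.
  apply: (mulgI (wv (take (i + D) c))); rewrite /W !wv_cat mulg1.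
  by rewrite !mulgA E1 E2 pwE E4 E5 E6 E7 E8.
have WI : pint phi (wv (take (i + D) c)) W =
    (q%:Z * ((f2 (wv (take (i - D) c)))%:Z - (f2 (wv (take (i + D) c)))%:Z))%R.
  rewrite /W !pint_cat E1 E2 pwE E4 E5 E6 E7 I1 I2 I3 I4 I5 I6 I7 I8.
  rewrite !addr0 -!mulrDr; congr (_ * _)%R.
  by move: (f2 _) (f2 _) (f2 _) (f2 _) (f2 _) (f2 _); lia.
have f2a : f2 (wv (take (i - D) c)) = q.*2.
  apply: dmin_cap => _ /mapP[l + ->]; rewrite mem_iota => ?.
  by rewrite wdistC Gd; lia.
have f2b : f2 (wv (take (i + D) c)) = 0%N.
  by apply: dmin0; apply/mapP; exists (i + D)%N; rewrite // mem_iota; lia.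
have := LI phi (Posz (r * r)) small (wv (take (i + D) c)) W WE.
rewrite WI f2a f2b subr0 -!PoszM ger0_norm ?lez_nat // => H.
have {H}H : (q * q.*2 <= C * (r * r) * (6 * (2 * q + 1) * (1 + la) + ka))%N.
  apply: leq_trans H _; rewrite leq_mul2l; apply/orP; right.
  apply: leq_trans W_size _.
  have : (D * (6 * (1 + la)) <= (2 * q + 1) * (6 * (1 + la)))%N.
    by rewrite leq_mul2r; apply/orP; right; lia.
  by lia.
have H2 : (C * (r * r) * (6 * (2 * q + 1) * (1 + la) + ka) = M1 * q + M2)%N.
  by rewrite /M1 /M2; lia.
rewrite {}H2 in H.
have qM : (M1 + M2 < q)%N by rewrite /N in ND; lia.
have : ((M1 + M2).+1 * q <= q * q)%N by rewrite leq_mul2r qM orbT.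
have : (M2 <= M2 * q)%N by apply: leq_pmulr; lia.
rewrite -muln2 mulnA in H; lia.
Qed.

End Words.

(** * Fillings in the binary tiling *)

Section Tiling.
Local Open Scope ring_scope.

(* The binary tiling of the hyperbolic plane: the vertex [(k, j)] lies at
   height [2 ^ j]; [h k j] is the value of a cochain on the horizontal edge
   from [(k, j)] to [(k + 1, j)], and [dn k j] its value on the vertical edge
   from [(k, j)] down to [(2 k, j - 1)]. *)
Implicit Types (h dn : int -> int -> int) (v : int * int).

Inductive move := MR | ML | MU | MD.

Definition step v m : int * int :=
  match m with
  | MR => (v.1 + 1, v.2)
  | ML => (v.1 - 1, v.2)
  | MU => ((v.1 %/ 2)%Z, v.2 + 1)
  | MD => (2 * v.1, v.2 - 1)
  end.

(** Odd vertices are midpoints of the bottom side of a tile and have no vertical edge above them. *)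
Definition ok v m : Prop := if m is MU then v.1 = 2 * (v.1 %/ 2)%Z else True.

Definition move_value h dn v m : int :=
  match m with
  | MR => h v.1 v.2
  | ML => - h (v.1 - 1) v.2
  | MU => - dn (v.1 %/ 2)%Z (v.2 + 1)
  | MD => dn v.1 v.2
  end.

Fixpoint run v (w : seq move) : int * int :=
  if w is m :: w' then run (step v m) w' else v.

Fixpoint okpath v (w : seq move) : Prop :=
  if w is m :: w' then ok v m /\ okpath (step v m) w' else True.

Fixpoint mint h dn v (w : seq move) : int :=
  if w is m :: w' then move_value h dn v m + mint h dn (step v m) w' else 0.

(** A tile is a pentagon: its bottom side consists of two horizontal edges of the row below. This is
    the integral around it, starting at the upper left corner and going down first. *)
Definition tile h dn v : int :=
  dn v.1 v.2 + h (2 * v.1) (v.2 - 1) + h (2 * v.1 + 1) (v.2 - 1)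
  - dn (v.1 + 1) v.2 - h v.1 v.2.

Definition tsum h dn (ts : seq (int * (int * int))) : int :=
  \sum_(t <- ts) t.1 * tile h dn t.2.

Lemma run_cat v w1 w2 : run v (w1 ++ w2) = run (run v w1) w2.
Proof. by elim: w1 v => /=. Qed.

Lemma okpath_cat v w1 w2 : okpath v w1 -> okpath (run v w1) w2 -> okpath v (w1 ++ w2).
Proof. by elim: w1 v => //= m w1 IH v [om ow1] ow2; split=> //; apply: IH. Qed.

Lemma mint_cat h dn v w1 w2 :
  mint h dn v (w1 ++ w2) = mint h dn v w1 + mint h dn (run v w1) w2.
Proof. by elim: w1 v => /= [|m w1 IH] v; rewrite ?add0r // IH addrA. Qed.

(** The discrete primitive of [f] that vanishes at 0. With it, horizontal integrals in either
    direction are differences and need no case distinction. *)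
Definition pot (f : int -> int) (k : int) : int :=
  match k with
  | Posz n => \sum_(i < n) f i%:Z
  | Negz n => - \sum_(i < n.+1) f (- (i%:Z + 1))
  end.

Lemma potS f k : pot f (k + 1) = pot f k + f k.
Proof.
case: k => [n|[|n]].
- by rewrite -PoszD addn1 /= big_ord_recr.
- have -> : Negz 0 + 1 = 0 by [].
  by rewrite /= big_ord0 big_ord1 NegzE addNr.
- have -> : Negz n.+1 + 1 = Negz n by lia.
  rewrite /= [X in _ = - X + _]big_ord_recr /= opprD -addrA.
  have -> : Negz n.+1 = - (n.+1%:Z + 1) by lia.
  by rewrite addNr addr0.
Qed.

Lemma int_const (F : int -> int) a b : (forall k, F (k + 1) = F k) -> F a = F b.
Proof.
move=> FS; have F0 (n : nat) k : F (k + n%:Z) = F k.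
  by elim: n => [|n IH]; rewrite ?addr0 // -addn1 PoszD addrA FS.
case: (leP a b) => ab; first by rewrite -(F0 (absz (b - a)) a); congr F; lia.
by rewrite -(F0 (absz (a - b)) b); congr F; lia.
Qed.

Definition strip (a b j : int) : seq (int * (int * int)) :=
  if a <= b then [seq (1, (a + i%:Z, j)) | i <- iota 0 (absz (b - a))]
  else [seq (-1, (b + i%:Z, j)) | i <- iota 0 (absz (a - b))].

Lemma size_strip a b j : size (strip a b j) = absz (b - a).
Proof. by rewrite /strip; case: ifP; rewrite size_map size_iota //; lia. Qed.

Definition unit_coef (ts : seq (int * (int * int))) : bool :=
  all (fun t => `|t.1| == 1) ts.

Lemma strip_unit a b j : unit_coef (strip a b j).
Proof. by rewrite /strip; case: ifP => _; apply/allP => _ /mapP[i _ ->]. Qed.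

Lemma sum_iota_pot (f : int -> int) a n :
  \sum_(i <- iota 0 n) f (a + i%:Z) = pot f (a + n%:Z) - pot f a.
Proof.
elim: n => [|n IH]; first by rewrite big_nil addr0 subrr.
by rewrite -addn1 iotaD big_cat big_seq1 /= IH add0n PoszD addrA potS addrAC.
Qed.

Lemma tsum_strip h dn a b j : tsum h dn (strip a b j) =
  pot (fun k => tile h dn (k, j)) b - pot (fun k => tile h dn (k, j)) a.
Proof.
rewrite /tsum /strip; case: leP => ab; rewrite big_map /=.
  under eq_bigr do rewrite mul1r.
  rewrite (sum_iota_pot (fun k => tile h dn (k, j))).
  by congr (pot _ _ - _); lia.
under eq_bigr do rewrite mulN1r.
rewrite sumrN (sum_iota_pot (fun k => tile h dn (k, j))) opprB.
by congr (_ - pot _ _); lia.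
Qed.

Lemma tsum_cat h dn ts1 ts2 : tsum h dn (ts1 ++ ts2) = tsum h dn ts1 + tsum h dn ts2.
Proof. by rewrite /tsum big_cat. Qed.

(** Neighbouring tiles of a row share a vertical edge, so the sum telescopes: the equation says that
    a function [F] of the column, invariant under [k + 1], agrees at [a] and [b]. *)
Lemma strip_boundary h dn a b j :
  dn a j + pot (h^~ (j - 1)) (2 * b) - pot (h^~ (j - 1)) (2 * a) =
  pot (h^~ j) b - pot (h^~ j) a + dn b j + tsum h dn (strip a b j).
Proof.
rewrite tsum_strip; set Q := pot (fun k => tile h dn (k, j)).
pose F k := Q k - pot (h^~ (j - 1)) (2 * k) + dn k j + pot (h^~ j) k.
have FS k : F (k + 1) = F k.
  have QS : Q (k + 1) = Q k + tile h dn (k, j) by exact: potS.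
  rewrite /F QS (_ : 2 * (k + 1) = (2 * k + 1) + 1); last by lia.
  rewrite !potS /tile /=.
  by move: (Q k) (pot _ _) (pot _ _) (h _ _) (h _ _) (h _ _) (dn _ _) (dn _ _); lia.
have := int_const a b FS; rewrite /F.
by move: (Q a) (Q b) (pot _ _) (pot _ _) (pot _ _) (pot _ _); lia.
Qed.

(* A stack [d_m; ...; d_1] encodes the path from a high vertex that repeatedly
   goes down and then [d_i] steps to the right. *)
Fixpoint pos (K : int) (s : seq int) : int :=
  if s is d :: s' then 2 * pos K s' + d else K.

Fixpoint descent h dn K (j : int) (s : seq int) : int :=
  if s is d :: s' then descent h dn K (j + 1) s' + dn (pos K s') (j + 1)
    + (pot (h^~ j) (2 * pos K s' + d) - pot (h^~ j) (2 * pos K s'))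
  else 0.

Definition weight (s : seq int) : nat := sumn (map absz s).

(** The path travelled so far is kept homologous to a descent from a fixed high vertex. Horizontal
    moves change the top digit and down moves push 0, both without tiles. An up move pops a digit
    [2 * c] and adds [c] to the next one, which sweeps [|c|] tiles; the drop of [weight] pays for
    them. As [size w < size s], the stack is never exhausted. *)
Lemma stack_run w K j s : (size w < size s)%N -> okpath (pos K s, j) w ->
  exists s' ts, [/\ run (pos K s, j) w = (pos K s', j + (size s)%:Z - (size s')%:Z),
    forall h dn, descent h dn K j s + mint h dn (pos K s, j) w =
      descent h dn K (j + (size s)%:Z - (size s')%:Z) s' + tsum h dn ts,
    (weight s' + size ts <= weight s + size w)%N & unit_coef ts].
Proof.
elim: w j s => [|m w IH] j s sw.
  move=> _; exists s, [::]; rewrite addrK; split=> // h dn.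
  by rewrite /= addr0 /tsum big_nil addr0.
case: s sw => // d s; rewrite /= ltnS => sw [om ow].
have horiz e : (forall h dn, move_value h dn (2 * pos K s + d, j) m =
      pot (h^~ j) (2 * pos K s + e) - pot (h^~ j) (2 * pos K s + d)) ->
    step (2 * pos K s + d, j) m = (2 * pos K s + e, j) ->
    (absz e <= (absz d).+1)%N ->
    exists s' ts, [/\ run (step (2 * pos K s + d, j) m) w =
       (pos K s', j + (size s).+1%:Z - (size s')%:Z),
    forall h dn, descent h dn K (j + 1) s + dn (pos K s) (j + 1) +
      (pot (h^~ j) (2 * pos K s + d) - pot (h^~ j) (2 * pos K s)) +
      (move_value h dn (2 * pos K s + d, j) m +
        mint h dn (step (2 * pos K s + d, j) m) w) =
      descent h dn K (j + (size s).+1%:Z - (size s')%:Z) s' + tsum h dn ts,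
    (weight s' + size ts <= weight (d :: s) + (size w).+1)%N & unit_coef ts].
  move=> mE stE ed; rewrite stE in ow *.
  have [|s' [ts [rE sE wE uE]]] := IH j (e :: s) _ ow; first by rewrite /=; lia.
  exists s', ts; split=> //; last by move: wE; rewrite /weight /=; lia.
  by move=> h dn; have := sE h dn; rewrite mE /=; lra.
case: m om ow horiz => [_|_|om|_] ow horiz.
- apply: (horiz (d + 1)) => [h dn||]; last by lia.
    by rewrite /= addrA potS; lra.
  by rewrite /= addrA.
- apply: (horiz (d - 1)) => [h dn||]; last by lia.
    by rewrite /= addrA -[in pot _ (2 * _ + d)](subrK 1 (2 * pos K s + d)) potS; lra.
  by rewrite /= addrA.
- case: s sw om ow {horiz} => [|e s] //= sw om ow.
  set p := pos K s in om ow *; pose c := ((2 * (2 * p + e) + d) %/ 2)%Z - (2 * p + e).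
  have cE : ((2 * (2 * p + e) + d) %/ 2)%Z = 2 * p + (e + c).
    by rewrite /c; move: (divz _ _) => t; lia.
  rewrite cE in om ow *; clearbody c.
  have dc : d = 2 * c by lia.
  have [|s' [ts [rE sE wE uE]]] := IH (j + 1) (e + c :: s) _ ow; first by rewrite /=; lia.
  have sj : j + 1 + (size (e + c :: s))%:Z = j + (size s).+2%:Z by rewrite /=; lia.
  rewrite sj in rE sE.
  exists s', (strip (2 * p + e) (2 * p + (e + c)) (j + 1) ++ ts); split=> //.
  + move=> h dn; have := sE h dn; rewrite tsum_cat /= -/p.
    have := strip_boundary h dn (2 * p + e) (2 * p + (e + c)) (j + 1).
    rewrite addrK dc.
    have -> : 2 * (2 * p + (e + c)) = 2 * (2 * p + e) + 2 * c by lia.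
    by lra.
  + by move: wE; rewrite size_cat size_strip /weight /=; lia.
  + by rewrite /unit_coef all_cat -!/(unit_coef _) strip_unit.
- have [||s' [ts [rE sE wE uE]]] := IH (j - 1) (0 :: d :: s).
  + by rewrite /=; lia.
  + by rewrite /= addr0.
  have sj : j - 1 + (size (0 :: d :: s))%:Z = j + (size s).+1%:Z by rewrite /=; lia.
  rewrite sj in rE sE; rewrite /= addr0 in rE sE.
  exists s', ts; split=> //.
    by move=> h dn; have := sE h dn; rewrite /= subrK subrr; lra.
  by move: wE; rewrite /weight /=; lia.
Qed.

(** The region between two descents from the same top is filled row by row. The gap at each level is
    half of the gap below up to the digits, so the widths add up to the bottom gap plus the two
    weights. *)
Lemma stack_diff K j s s' : size s = size s' ->
  exists ts, [/\ forall h dn, descent h dn K j s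
      + (pot (h^~ j) (pos K s') - pot (h^~ j) (pos K s)) =
      descent h dn K j s' + tsum h dn ts,
    (size ts <= absz (pos K s' - pos K s) + weight s + weight s')%N & unit_coef ts].
Proof.
elim: s s' j => [|d s IH] [|d' s'] j //= => [_|[ss']].
  by exists [::]; split=> // h dn; rewrite subrr /tsum big_nil.
have [ts [tsE ts_size uts]] := IH s' (j + 1) ss'.
exists (strip (pos K s) (pos K s') (j + 1) ++ ts); split.
- move=> h dn; have := tsE h dn; rewrite tsum_cat.
  have := strip_boundary h dn (pos K s) (pos K s') (j + 1).
  by rewrite addrK /=; lra.
- by rewrite size_cat size_strip /weight /=; move: ts_size; rewrite /weight; lia.
- by rewrite /unit_coef all_cat -!/(unit_coef _) strip_unit.
Qed.

Lemma stack_of m k : exists K s, [/\ size s = m, pos K s = k & (weight s <= m)%N].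
Proof.
elim: m k => [|m IH] k; first by exists k, [::].
have [K [s [ss pk ws]]] := IH (k %/ 2)%Z.
exists K, ((k %% 2)%Z :: s); rewrite /weight /= -/(weight s) ss pk.
by split=> //; lia.
Qed.

(** Starting from a stack of binary digits of height [size w + 2], the path leads to a second stack
    over the same vertex; the two descents are then compared by [stack_diff]. Both costs are linear
    in the length, whereas the tiles enclosed could a priori be many more. *)
Lemma closed_path_filling v w : okpath v w -> run v w = v ->
  exists ts, [/\ (size ts <= 5 * size w + 6)%N, unit_coef ts &
    forall h dn, mint h dn v w = tsum h dn ts].
Proof.
case: v => k j okw rw.
have [K [s [ss pk ws]]] := stack_of (size w).+2 k.
rewrite -pk in okw rw *.
have [|s' [ts [rE sE wE uE]]] := stack_run (s := s) _ okw; first by rewrite ss.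
move: rE; rewrite rw => -[pE jE].
have ss' : size s' = size s by lia.
rewrite -jE in sE.
have [ts' [tsE ts_size uts]] := stack_diff K j ss'.
exists (ts ++ ts'); split.
- by rewrite size_cat; move: ts_size; rewrite -pE subrr /=; lia.
- by rewrite /unit_coef all_cat -!/(unit_coef _) uE.
- move=> h dn; rewrite tsum_cat; have := sE h dn; have := tsE h dn.
  by rewrite pE subrr; lra.
Qed.

Fixpoint verts v (w : seq move) : seq (int * int) :=
  v :: (if w is m :: w' then verts (step v m) w' else [::]).

Lemma verts_head v w : v \in verts v w.
Proof. by case: w => [|m w]; rewrite inE eqxx. Qed.

Lemma mint_unvisited h dn v w : okpath v w ->
  (forall u, u \in verts v w -> h u.1 u.2 = 0 /\ dn u.1 u.2 = 0) ->
  mint h dn v w = 0.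
Proof.
elim: w v => //= m w IH v [om ow] H; rewrite IH // => [|u uw]; last first.
  by apply: H; rewrite inE uw orbT.
have [hv dv] := H v (mem_head _ _).
have [] := H (step v m).
  by rewrite inE verts_head orbT.
by case: m om {ow H} => /= _ hs ds; rewrite ?hv ?dv ?hs ?ds ?oppr0 addr0.
Qed.

Definition multiplicity (ts : seq (int * (int * int))) v : int :=
  \sum_(t <- ts) t.1 * (t.2 == v)%:Z.

Lemma tsum_multiplicity h dn ts : tsum h dn ts =
  \sum_(v <- undup (map snd ts)) multiplicity ts v * tile h dn v.
Proof.
rewrite /tsum /multiplicity.
under [RHS]eq_bigr do rewrite mulr_suml.
rewrite exchange_big /= big_seq [RHS]big_seq; apply: eq_bigr => t tts.
have tu : t.2 \in undup (map snd ts) by rewrite mem_undup map_f.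
rewrite (bigD1_seq t.2) ?undup_uniq //= eqxx mulr1 big1 ?addr0 // => v.
by rewrite eq_sym => /negPf ->; rewrite mulr0 mul0r.
Qed.

Lemma sum_multiplicity ts : unit_coef ts ->
  \sum_(v <- undup (map snd ts)) `|multiplicity ts v| <= (size ts)%:Z.
Proof.
move=> uts; apply: (@le_trans _ _ (\sum_(t <- ts) 1)); last first.
  by elim: ts {uts} => [|t ts IH]; rewrite ?big_nil // big_cons /= intS lerD2l.
have -> : \sum_(t <- ts) 1 =
    \sum_(v <- undup (map snd ts)) \sum_(t <- ts) (t.2 == v)%:Z.
  rewrite exchange_big /= big_seq [RHS]big_seq; apply: eq_bigr => t tts.
  have tu : t.2 \in undup (map snd ts) by rewrite mem_undup map_f.
  rewrite (bigD1_seq t.2) ?undup_uniq //= eqxx big1 ?addr0 // => v.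
  by rewrite eq_sym => /negPf ->.
apply: ler_sum => v _; rewrite /multiplicity.
apply: le_trans (ler_norm_sum _ _ _) _; rewrite !big_seq; apply: ler_sum => t tts.
by rewrite normrM (eqP (allP uts _ tts)) mul1r; case: eqP.
Qed.

(** The identity is tested on the indicator of a single edge at [u]. The path integral vanishes
    because the path avoids [u], and the tile sum is the difference of the multiplicities on the two
    sides of that edge. *)
Lemma multiplicity_unvisited v w ts u : okpath v w ->
  (forall h dn, mint h dn v w = tsum h dn ts) -> u \notin verts v w ->
  multiplicity ts u = multiplicity ts (u.1 - 1, u.2) /\
  multiplicity ts u = multiplicity ts ((u.1 %/ 2)%Z, u.2 + 1).
Proof.
move=> okw wE uw; pose ind a b : int := ((a, b) == u)%:Z.
have ind0 u' : u' \in verts v w -> ind u'.1 u'.2 = 0.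
  by move=> u'w; rewrite /ind; case: eqP => // e; move: uw; rewrite -e -surjective_pairing u'w.
have E h dn : (forall u', u' \in verts v w -> h u'.1 u'.2 = 0 /\ dn u'.1 u'.2 = 0) ->
    tsum h dn ts = 0.
  by move=> H; rewrite -wE mint_unvisited.
split; apply/eqP; rewrite -subr_eq0 /multiplicity -sumrB; apply/eqP.
  rewrite -[RHS](E (fun _ _ => 0) ind) => [|u' /ind0 ->] //.
  apply: eq_bigr => -[c [a b]] _ /=; rewrite -mulrBr /tile /ind /=.
  congr (c * _); case: u {uw ind ind0 E} => p q; rewrite !xpair_eqE.
  have -> : (a + 1 == p) = (a == p - 1) by apply/eqP/eqP; lia.
  by move: (_ && _) (_ && _) => s t; lia.
apply/eqP; rewrite -oppr_eq0 -sumrN.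
rewrite -[X in _ == X](E ind (fun _ _ => 0)) => [|u' /ind0 ->] //; apply/eqP.
apply: eq_bigr => -[c [a b]] _ /=; rewrite -mulrBr -mulrN /tile /ind /=.
congr (c * _); case: u {uw ind ind0 E} => p q; rewrite !xpair_eqE.
have -> : (b - 1 == q) = (b == q + 1) by apply/eqP/eqP; lia.
have e : nat_of_bool (a == (p %/ 2)%Z) = addn (2 * a == p) (2 * a + 1 == p).
  by case: (eqVneq a _); case: (eqVneq (2 * a) _); case: (eqVneq (2 * a + 1) _); lia.
case: (b == q + 1); rewrite ?andbT ?andbF ?e; last by lia.
by move: (2 * a == p) (2 * a + 1 == p) (_ && _) => s t r; lia.
Qed.

End Tiling.

(** * The tiling vertices inside the upper half-plane *)

Section TilingPoints.
Variable R : realType.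
Local Open Scope ring_scope.
Implicit Types (q : hyp_plane R) (u v : int * int).

Lemma two_exp_gt0 (j : int) : 0 < (2 : R) ^ j.
Proof. by rewrite exprz_gt0. Qed.

Lemma two_expS (j : int) : (2 : R) ^ (j + 1) = 2 * 2 ^ j.
Proof. by rewrite expfzDr // expr1z mulrC. Qed.

Definition pt v : hyp_plane R := hpt (v.1%:~R * 2 ^ v.2) (two_exp_gt0 v.2).

Definition parent v : int * int := ((v.1 %/ 2)%Z, v.2 + 1).

(** Unlike the moves, this also joins an odd vertex to its parent; such a step costs two moves in
    [tconn_moves]. *)
Definition tstep u v : Prop :=
  [\/ v = (u.1 + 1, u.2), u = (v.1 + 1, v.2), v = parent u | u = parent v].

Lemma tstepC u v : tstep u v -> tstep v u.
Proof. by case=> e; [apply: Or42 | apply: Or41 | apply: Or44 | apply: Or43]. Qed.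

Lemma cosh_dist_tstep u v : tstep u v -> cosh_dist (pt u) (pt v) <= 3 / 2.
Proof.
have right w : cosh_dist (pt w) (pt (w.1 + 1, w.2)) <= 3 / 2.
  rewrite cosh_dist_le !hx_hpt !hy_hpt /= intrD.
  by move: (w.1%:~R) (2 ^ w.2) => k t; lra.
have up w : cosh_dist (pt w) (pt (parent w)) <= 3 / 2.
  rewrite cosh_dist_le !hx_hpt !hy_hpt /= two_expS.
  have t_gt0 := two_exp_gt0 w.2; move: (2 ^ w.2) t_gt0 => t t_gt0.
  rewrite [X in X%:~R * t - _](divz_eq w.1 2) intrD intrM.
  have : ((w.1 %% 2)%Z == 0) || ((w.1 %% 2)%Z == 1) by lia.
  by case/orP => /eqP ->; move: ((w.1 %/ 2)%Z%:~R) => k /=; nra.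
case=> ->; first exact: right.
- by rewrite cosh_distC; exact: right.
- exact: up.
- by rewrite cosh_distC; exact: up.
Qed.

Fixpoint tconn n u v : Prop :=
  if n is n'.+1 then exists2 u', tstep u u' & tconn n' u' v else u = v.

Lemma tconn_trans m n u v w : tconn m u v -> tconn n v w -> tconn (m + n) u w.
Proof.
elim: m u => [|m IH] u /=; first by move=> ->.
by move=> [u' s c] d; exists u' => //; exact: IH.
Qed.

Lemma tconn1 u v : tstep u v -> tconn 1 u v.
Proof. by exists v. Qed.

Lemma tconn_sym n u v : tconn n u v -> tconn n v u.
Proof.
elim: n u => [|n IH] u; first by move=> /= ->.
case=> u' s c; rewrite -addn1; apply: tconn_trans (IH _ c) _.
exact/tconn1/tstepC.
Qed.

Lemma cosh_dist_tconn n u v : tconn n u v -> cosh_dist (pt u) (pt v) <= 3 ^+ n.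
Proof.
elim: n u => [|n IH] u /=; first by move=> ->; rewrite cosh_distxx.
move=> [u' s /IH c]; rewrite exprS.
have := cosh_dist_trans_le (cosh_dist_tstep s) c.
by move: (3 ^+ n) => t; lra.
Qed.

Lemma tconn_parents m u : exists k,
  tconn m u (k, u.2 + m%:Z) /\ 0 <= u.1 - k * 2 ^+ m < 2 ^+ m.
Proof.
elim: m => [|m [k [c b]]]; first by exists u.1; rewrite addr0 -surjective_pairing; split=> //; lia.
exists (k %/ 2)%Z; split.
  rewrite -addn1; apply: tconn_trans c _; apply: tconn1; apply: Or43.
  by rewrite /parent /= PoszD addrA.
rewrite exprS; have := divz_eq k 2; have : 0 <= (k %% 2)%Z < 2 by lia.
move: (k %/ 2)%Z (k %% 2)%Z (2 ^+ m) b => k' d t b dd kE; rewrite kE in b.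
have : (d == 0) || (d == 1) by lia.
by case/orP => /eqP dE; rewrite dE in b; lia.
Qed.

Lemma tconn_horizontal a b j : tconn (absz (b - a)) (a, j) (b, j).
Proof.
have main n c : tconn n (c, j) (c + n%:Z, j).
  elim: n c => [|n IH] c; first by rewrite addr0.
  exists (c + 1, j); first exact: Or41.
  by rewrite intS addrA; exact: IH.
have [ab|ab] := leP a b.
  by have := main (absz (b - a)) a; congr tconn; congr (_, _); lia.
apply: tconn_sym; have -> : absz (b - a) = absz (a - b) by lia.
by have := main (absz (a - b)) b; congr tconn; congr (_, _); lia.
Qed.

(** The lower vertex climbs through its ancestors to the height of the other one, and a horizontal
    path does the rest. The heights differ by a factor at most [2 * T], and at the upper level the
    horizontal gap is at most [2 * T + 1] columns. *)
Lemma tconn_close (T : R) : exists M : nat, forall u v,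
  cosh_dist (pt u) (pt v) <= T -> exists2 n, (n <= M)%N & tconn n u v.
Proof.
pose a := Num.bound (2 * T); pose b := (Num.bound (2 * T)).+1.
exists (a + b)%N.
have main u v : u.2 <= v.2 -> cosh_dist (pt u) (pt v) <= T ->
    exists2 n, (n <= a + b)%N & tconn n u v.
  case: u v => k j [k' j'] /= jj' h.
  pose m := absz (j' - j); have jm : j' = j + m%:Z by rewrite /m; lia.
  have T_ge1 : 1 <= T by apply: le_trans (cosh_dist_ge1 _ _) h.
  have aT : 2 * T < a%:R by apply: archi_boundP; lra.
  have [k2 [c kb]] := tconn_parents m (k, j).
  move: h; rewrite cosh_dist_le !hx_hpt !hy_hpt /= jm expfzDr // -exprnP.
  have t_gt0 := two_exp_gt0 j; move: (2 ^ j) t_gt0 => t t_gt0 h.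
  have s_ge1 : 1 <= (2 : R) ^+ m by apply: exprn_ege1; lra.
  have hm : (m <= a)%N.
    rewrite -(ler_nat R); apply: le_trans (ltW aT).
    have : (m%:R <= (2 : R) ^+ m).
      by rewrite -natrX ler_nat ltnW // ltn_expl.
    move=> h1; apply: le_trans h1 _; rewrite -(ler_pM2l t_gt0).
    set s := 2 ^+ m in h s_ge1 *.
    rewrite -(ler_pM2r (_ : 0 < t * s)); last by rewrite mulr_gt0 //; lra.
    have := sqr_ge0 (k%:~R * t - k'%:~R * (t * s)); have := sqr_ge0 t; lra.
  have hb : (absz (k' - k2) <= b)%N.
    rewrite /b -(ler_nat R) -addn1 natrD.
    have kbR : (0 : R) <= k%:~R - k2%:~R * 2 ^+ m < (2 : R) ^+ m.
      have -> : (2 : R) ^+ m = (2 ^+ m : int)%:~R by rewrite rmorphXn.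
      by rewrite -intrM -intrB ler0z ltr_int.
    have -> : (absz (k' - k2))%:R = `|k'%:~R - k2%:~R| :> R.
      by rewrite -intrB -intr_norm -abszE.
    apply: le_trans (_ : 2 * T + 1 <= _); last by rewrite lerD2r ltW.
    set s := 2 ^+ m in h s_ge1 kbR.
    have ts_gt0 : 0 < t * s by rewrite mulr_gt0 //; lra.
    have hd : (k%:~R * t - k'%:~R * (t * s)) ^+ 2 <= (2 * T * (t * s)) ^+ 2.
      have : t * (t * s) <= (t * s) * (t * s) by rewrite ler_pM2r // ler_peMr // ltW.
      have : 2 * T <= (2 * T) ^+ 2 by nra.
      have := sqr_ge0 t; have := sqr_ge0 (t * s).
      move: h; set D := (_ - _) ^+ 2; move: (t * s) ts_gt0 => ts ts_gt0 h h1 h2 h3 h4.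
      have : D <= 2 * T * (t * ts) by lra.
      have : 2 * T * (t * ts) <= 2 * T * (ts * ts) by rewrite ler_wpM2l //; lra.
      have : 2 * T * (ts * ts) <= (2 * T) ^+ 2 * (ts * ts).
        by rewrite ler_wpM2r // mulr_ge0 // ltW.
      by lra.
    have {}hd : `|k%:~R * t - k'%:~R * (t * s)| <= 2 * T * (t * s).
      have p0 : 0 <= 2 * T * (t * s) by rewrite mulr_ge0 ?ltW //; lra.
      by rewrite -(ler_pXn2r (ltn0Sn 1)) ?nnegrE ?normr_ge0 // real_normK ?num_real.
    suff : `|(k'%:~R - k2%:~R) * (t * s)| <= (2 * T + 1) * (t * s).
      by rewrite normrM (gtr0_norm ts_gt0) ler_pM2r.
    move: hd; rewrite !ler_norml => /andP[hd1 hd2]; case/andP: kbR => kb1 kb2.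
    have e1 : 0 <= (k%:~R - k2%:~R * s) * t by rewrite mulr_ge0 // ltW.
    have e2 : (k%:~R - k2%:~R * s) * t <= s * t by rewrite ler_pM2r // ltW.
    by apply/andP; split; lra.
  exists (m + absz (k' - k2))%N; first exact: leq_add.
  by apply: tconn_trans c _; exact: tconn_horizontal.
move=> u v h; have [uv|/ltW vu] := leP u.2 v.2; first exact: main.
by have [|n na c] := main v u vu; rewrite 1?cosh_distC //; exists n => //; exact: tconn_sym.
Qed.

Lemma dyadic_height (y : R) : 0 < y -> exists j : int, 2 ^ j <= y < 2 ^ (j + 1).
Proof.
move=> y_gt0; pose N := Num.bound y^-1.
have bound_exp (x : R) : 0 <= x -> x < 2 ^+ Num.bound x.
  move=> x0; apply: lt_le_trans (archi_boundP x0) _.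
  by rewrite -natrX ler_nat ltnW // ltn_expl.
have N1 : 1 <= y * 2 ^+ N.
  rewrite -ler_pdivrMl // mulr1; apply/ltW/bound_exp.
  by rewrite invr_ge0 ltW.
have yN_ge0 : 0 <= y * 2 ^+ N by lra.
have exn : exists n, y * 2 ^+ N < 2 ^+ n by exists (Num.bound (y * 2 ^+ N)); exact: bound_exp.
have [[|n] ny nmin] := ex_minnP exn; first by move: ny; rewrite expr0; lra.
have hn : 2 ^+ n <= y * 2 ^+ N by rewrite leNgt; apply/negP => /nmin; rewrite ltnn.
have P_gt0 : 0 < (2 : R) ^+ N by rewrite exprn_gt0.
exists (n%:Z - N%:Z); rewrite two_expS expfzDr // -exprnN -exprnP.
rewrite ler_pdivrMr // hn /= mulrA ltr_pdivlMr //.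
by move: ny; rewrite exprS.
Qed.

Lemma pt_dense q : exists v, cosh_dist q (pt v) <= 2.
Proof.
have [j /andP[j1 j2]] := dyadic_height (hy_gt0 q).
have t_gt0 := two_exp_gt0 j; rewrite two_expS in j2.
exists (Num.floor (hx q / 2 ^ j), j); rewrite cosh_dist_le !hx_hpt !hy_hpt /=.
have /andP[] := floor_itv (hx q / 2 ^ j); rewrite intrD.
rewrite ler_pdivlMr // ltr_pdivrMr // => f1 f2.
move: (hx q) (hy q) (2 ^ j) ((Num.floor _)%:~R) j1 j2 t_gt0 f1 f2 => x y t f j1 j2 t0 f1 f2.
have d2 : (x - f * t) ^+ 2 <= t ^+ 2 by nra.
have : (y - t) * (y - 2 * t) <= 0 by nra.
have : 0 <= y * t by nra.
by nra.
Qed.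

Lemma pt_box (T : R) : exists B : nat, forall v,
  cosh_dist (tri0 R) (pt v) <= T -> `|v.1| <= B%:Z /\ `|v.2| <= B%:Z.
Proof.
pose S := Num.max 1 T; have S1 : 1 <= S by rewrite le_max lexx.
pose B := Num.bound (4 * S ^+ 2); have BS : 4 * S ^+ 2 < B%:R.
  by apply: archi_boundP; have := sqr_ge0 S; lra.
exists B => -[k j] h.
have {h} : cosh_dist (tri0 R) (pt (k, j)) <= S by rewrite le_max h orbT.
move=> /cosh_dist_box[]; rewrite hx_hpt hy_hpt /=.
have t_gt0 := two_exp_gt0 j => hk hj1 hj2.
have SB : 2 * S <= B%:R by nra.
split.
  rewrite -(ler_int R) intr_norm; apply: le_trans (ltW BS).
  rewrite -(ler_pM2r t_gt0).
  have -> : `|k%:~R| * 2 ^ j = `|k%:~R * 2 ^ j| :> R by rewrite normrM (gtr0_norm t_gt0).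
  by apply: le_trans hk _; nra.
have small n : (2 : R) ^+ n <= 2 * S -> (n <= B)%N.
  move=> h; rewrite -(ler_nat R); apply: le_trans SB; apply: le_trans h.
  by rewrite -natrX ler_nat ltnW // ltn_expl.
case: j t_gt0 hk hj1 hj2 => n t_gt0 hk hj1 hj2; first by rewrite lez_nat; exact: small.
rewrite NegzE normrN lez_nat; apply: small.
move: hj2; rewrite NegzE -exprnN => hj2.
by rewrite -(ler_pM2r (_ : 0 < (2 ^+ n.+1)^-1)) ?invr_gt0 ?exprn_gt0 // mulfV ?gt_eqF ?exprn_gt0.
Qed.

End TilingPoints.

(** * The isoperimetric inequality for Fuchsian groups *)

Section Holes.
Variable R : realType.
Local Open Scope ring_scope.
Variables (G : groupType) (rho : {multiplicative G -> isom_hyp_plane R}).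
Local Notation H := (hyp_plane R).
Local Notation o := (tri0 R).
Implicit Types (q : H) (u v : int * int) (g : G).

(** Coarse connectedness inside [S]. The jump size 8 is [2 * 2 * 2]: by the inequality for
    [cosh_dist], two points of [S] close to the same tiling vertex in the sense of [pt_dense] are
    joined by one jump. *)
Inductive chain (S : H -> Prop) : H -> H -> Prop :=
| chain0 q : chain S q q
| chainS q1 q2 q3 : S q1 -> S q2 -> cosh_dist q1 q2 <= 8 ->
    chain S q2 q3 -> chain S q1 q3.

Lemma chain_trans S q1 q2 q3 : chain S q1 q2 -> chain S q2 q3 -> chain S q1 q3.
Proof. by elim=> // a b c Sa Sb ab _ IH /IH; exact: chainS. Qed.

Lemma chain_sym S q1 q2 : chain S q1 q2 -> chain S q2 q1.
Proof.
elim=> [q|a b c Sa Sb ab _ IH]; first exact: chain0.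
apply: chain_trans IH _; apply: chainS Sb Sa _ (chain0 _ _).
by rewrite cosh_distC.
Qed.

Lemma chain_tconn n u v : tconn n u v -> chain (fun=> True) (pt R u) (pt R v).
Proof.
elim: n u => [|n IH] u /=; first by move=> ->; exact: chain0.
move=> [u' s /IH]; apply: chainS => //.
by apply: le_trans (cosh_dist_tstep _ s) _; lra.
Qed.

Lemma chain_total q1 q2 : chain (fun=> True) q1 q2.
Proof.
have [u hu] := pt_dense q1; have [v hv] := pt_dense q2.
have [M hM] := tconn_close (cosh_dist (pt R u) (pt R v)).
have [n _ c] := hM u v (lexx _).
have s1 : chain (fun=> True) q1 (pt R u).
  by apply: chainS (chain0 _ _) => //; apply: le_trans hu _; lra.
have s2 : chain (fun=> True) (pt R v) q2.
  by apply: chainS (chain0 _ _) => //; rewrite cosh_distC; apply: le_trans hv _; lra.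
exact: chain_trans (chain_trans s1 (chain_tconn c)) s2.
Qed.

Definition near_orbit (r : R) q : Prop := exists g, cosh_dist q (gact rho g o) <= r.

Lemma near_orbit_gact r h q : near_orbit r q -> near_orbit r (gact rho h q).
Proof.
by move=> [g hg]; exists (h * g)%g; rewrite gactM cosh_dist_gact.
Qed.

Definition far r q := ~ near_orbit r q.

Lemma far_gact r h q : far r q -> far r (gact rho h q).
Proof. by move=> fq /(near_orbit_gact h^-1%g); rewrite gactK. Qed.

Lemma chain_gact r h q1 q2 : chain (far r) q1 q2 ->
  chain (far r) (gact rho h q1) (gact rho h q2).
Proof.
elim=> [q|a b c Sa Sb ab _ IH]; first exact: chain0.
by apply: chainS IH; [exact: far_gact | exact: far_gact | rewrite cosh_dist_gact].
Qed.

Definition bounded_component r q : Prop :=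
  exists M : nat, forall q', chain (far r) q q' -> cosh_dist o q' <= M%:R.

Lemma bounded_component_gact r h q :
  bounded_component r q -> bounded_component r (gact rho h q).
Proof.
move=> [M hM]; pose D := 2 * cosh_dist o (gact rho h o) * M%:R.
exists (Num.bound D) => q' /(chain_gact h^-1%g); rewrite gactK => /hM.
rewrite -(cosh_dist_gact rho h) gactVK => c.
apply: le_trans (cosh_dist_trans (gact rho h o) _ _) _.
have D0 : 0 <= D by rewrite !mulr_ge0 ?cosh_dist_ge0.
apply: le_trans (ltW (archi_boundP D0)); rewrite ler_wpM2l //.
by rewrite mulr_ge0 ?cosh_dist_ge0.
Qed.

Lemma chain_meets_orbit r q1 q2 : far r q1 -> near_orbit r q2 ->
  chain (fun=> True) q1 q2 -> exists q3, [/\ chain (far r) q1 q3, far r q3 &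
    exists2 q4, cosh_dist q3 q4 <= 8 & near_orbit r q4].
Proof.
move=> + + c; elim: c => [q fq nq|a b c _ _ ab _ IH fa nc]; first by case: fq.
have [nb|fb] := pselect (near_orbit r b).
  by exists a; split=> //; [exact: chain0 | exists b].
have [q3 [c3 f3 H3]] := IH fb nc.
by exists q3; split=> //; exact: chainS c3.
Qed.

Lemma box_uniform_bound (P : int * int -> nat -> Prop) (B : nat) :
  (forall v, exists m, P v m) -> (forall v m n, (m <= n)%N -> P v m -> P v n) ->
  exists m, forall v, `|v.1| <= B%:Z -> `|v.2| <= B%:Z -> P v m.
Proof.
move=> /boolp.choice[f Pf] Pmono.
pose vert (i : 'I_(2 * B).+1 * 'I_(2 * B).+1) : int * int :=
  (i.1%:Z - B%:Z, i.2%:Z - B%:Z).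
exists (\max_i f (vert i))%N => -[k j] /= hk hj.
apply: Pmono (Pf _).
have k_lt : (absz (k + B%:Z)%R < (2 * B).+1)%N by lia.
have j_lt : (absz (j + B%:Z)%R < (2 * B).+1)%N by lia.
have := leq_bigmax (F := fun i => f (vert i)) (Ordinal k_lt, Ordinal j_lt).
by congr (f _ <= _)%N; rewrite /vert /=; congr pair; lia.
Qed.

(* Up to the action of [G] only finitely many bounded components of the
   complement of a neighbourhood of the orbit meet the boundary of that
   neighbourhood, so their depth is bounded. *)
Lemma far_component_unbounded r : 1 <= r -> exists r', forall q,
  near_orbit r' q \/ far r q /\ ~ bounded_component r q.
Proof.
(* After translation by [G], the last far point before the neighbourhood of the orbit is one jump,
   of size 8, from a point within [r] of the base point; the final 2 passes to a tiling vertex. *)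
move=> r1; have [B hB] := pt_box (2 * (2 * 8 * r) * 2).
pose P v (m : nat) := forall q, far r q -> cosh_dist q (pt R v) <= 2 ->
  bounded_component r q -> forall q', chain (far r) q q' -> cosh_dist o q' <= m%:R.
have [|v m n mn Pm q fq qv bq q' c|M hM] := @box_uniform_bound P B.
- move=> v; have [[q0 [f0 qv0 [m b0]]]|none] :=
    pselect (exists q, [/\ far r q, cosh_dist q (pt R v) <= 2 & bounded_component r q]).
    exists m => q fq qv _ q' c; apply: b0; apply: chainS c => //.
    have := cosh_dist_trans_le qv0 (_ : cosh_dist (pt R v) q <= 2).
    by rewrite cosh_distC qv => /(_ isT); lra.
  by exists 0%N => q fq qv bq; case: none; exists q.
- by apply: le_trans (Pm q fq qv bq q' c) _; rewrite ler_nat.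
exists (Num.max r M%:R) => q.
have [[g gq]|fq] := pselect (near_orbit r q).
  by left; exists g; rewrite le_max gq.
have [bq|] := pselect (bounded_component r q); last by right.
left.
have no : near_orbit r o by exists 1%g; rewrite gact1 cosh_distxx.
have [q3 [c3 f3 [q4 d34 [g d4]]]] := chain_meets_orbit fq no (chain_total q o).
pose k := g^-1%g.
have d3 : cosh_dist o (gact rho k q3) <= 2 * 8 * r.
  rewrite -(cosh_dist_gact rho g) gactVK cosh_distC.
  exact: cosh_dist_trans_le d34 d4.
have [v hv] := pt_dense (gact rho k q3).
have [hv1 hv2] := hB v (cosh_dist_trans_le d3 hv).
exists g; rewrite -(cosh_dist_gact rho k) gactK cosh_distC le_max; apply/orP; right.
apply: (hM v hv1 hv2 (gact rho k q3)) => //.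
- exact: far_gact.
- apply: bounded_component_gact; have [m hm] := bq; exists m => q' c'.
  exact/hm/(chain_trans c3).
- exact/chain_gact/chain_sym.
Qed.

End Holes.

(** * Multiplicities of tiles away from the orbit *)

Section Enclosed.
Variable R : realType.
Local Open Scope ring_scope.
Variables (G : groupType) (rho : {multiplicative G -> isom_hyp_plane R}).
Local Notation H := (hyp_plane R).
Local Notation o := (tri0 R).
Implicit Types (q : H) (u v : int * int) (g : G).

Lemma multiplicity_notin ts u : u \notin map snd ts -> multiplicity ts u = 0.
Proof.
move=> uts; rewrite /multiplicity big1_seq // => t /andP[_ tts].
case: eqP => [e|_]; last by rewrite mulr0.
by move: uts; rewrite -e map_f.
Qed.

Lemma cosh_dist_max (ts : seq (int * (int * int))) : exists m : nat,
  forall u, u \in map snd ts -> cosh_dist o (pt R u) <= m%:R.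
Proof.
elim: ts => [|t ts [m hm]]; first by exists 0%N.
exists (maxn m (Num.bound (cosh_dist o (pt R t.2)))) => u.
rewrite inE => /predU1P[->|/hm h].
  apply: (le_trans (ltW (archi_boundP (cosh_dist_ge0 _ _)))).
  by rewrite ler_nat leq_maxr.
by apply: le_trans h _; rewrite ler_nat leq_maxl.
Qed.

(* The multiplicity function of a filling is constant off the path, and its
   support is finite: it vanishes on the unbounded regions. *)
Lemma multiplicity_near_orbit (r : R) : exists r', forall v w ts, okpath v w ->
  (forall h dn, mint h dn v w = tsum h dn ts) ->
  (forall u, u \in verts v w -> near_orbit rho r (pt R u)) ->
  forall u, multiplicity ts u != 0 -> near_orbit rho r' (pt R u).
Proof.
(* Vertices within 2 of consecutive points of a chain are within [2 * (2 * 2 * 8) * 2 = 128] of each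
   other. The radius [r0] keeps the [M] tiling steps joining them off the path. *)
have [M hM] := @tconn_close R 128.
pose r0 := Num.max 1 (2 * (2 * 3 ^+ M) * r).
have [|r' hr'] := @far_component_unbounded R G rho r0; first by rewrite le_max lexx.
exists r' => v w ts okw wE nw u.
have unvisited q u1 k : far rho r0 q -> (k <= M)%N ->
    cosh_dist q (pt R u1) <= 2 * 3 ^+ k -> u1 \notin verts v w.
  move=> fq kM c; apply/negP => /nw[g hg]; apply: fq; exists g.
  rewrite le_max; apply/orP; right.
  apply: le_trans (cosh_dist_trans_le c hg) _.
  have r_ge0 : 0 <= r by apply: le_trans hg; exact: cosh_dist_ge0.
  have : (3 : R) ^+ k <= 3 ^+ M by apply: ler_weXn2l => //; lra.
  by move=> h; rewrite ler_wpM2r //; lra.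
have inner q u2 n k u1 : far rho r0 q -> (n + k <= M)%N ->
    cosh_dist q (pt R u1) <= 2 * 3 ^+ k -> tconn n u1 u2 ->
    multiplicity ts u1 = multiplicity ts u2.
  move=> fq; elim: n k u1 => [|n IH] k u1 nk c1 /=; first by move=> ->.
  move=> [u3 s t].
  have c3 : cosh_dist q (pt R u3) <= 2 * 3 ^+ k.+1.
    by have := cosh_dist_trans_le c1 (cosh_dist_tstep R s); rewrite exprS; lra.
  rewrite -(IH k.+1 u3) //; last by rewrite addnS -addSn.
  have [|e1 e2] := multiplicity_unvisited okw wE (unvisited q u1 k fq _ c1); first by lia.
  have [|e3 e4] := multiplicity_unvisited okw wE (unvisited q u3 k.+1 fq _ c3); first by lia.
  case: s => e.
  - by rewrite e3 e /= addrK -surjective_pairing.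
  - by rewrite e1 e /= addrK -surjective_pairing.
  - by rewrite e2 e.
  - by rewrite e4 e.
have close q u1 u2 : far rho r0 q -> cosh_dist q (pt R u1) <= 2 ->
    cosh_dist (pt R u1) (pt R u2) <= 128 -> multiplicity ts u1 = multiplicity ts u2.
  move=> fq c1 /hM[n nM t]; apply: (inner q u2 n 0%N) => //; first by rewrite addn0.
  by rewrite expr0 mulr1.
have along q q' : chain (far rho r0) q q' -> far rho r0 q -> forall u1 u2,
    cosh_dist q (pt R u1) <= 2 -> cosh_dist q' (pt R u2) <= 2 ->
    multiplicity ts u1 = multiplicity ts u2.
  elim=> [a fa u1 u2 c1 c2|a b c _ fb ab _ IH fa u1 u2 c1 c2].
    apply: (close a) => //.
    by have := cosh_dist_trans_le (_ : cosh_dist (pt R u1) a <= 2) c2;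
      rewrite cosh_distC c1 => /(_ isT); lra.
  have [u3 c3] := pt_dense b.
  rewrite -(IH fb u3 u2 c3 c2); apply: (close a) => //.
  have c4 : cosh_dist (pt R u1) b <= 2 * 2 * 8.
    by apply: cosh_dist_trans_le ab; rewrite cosh_distC.
  by have := cosh_dist_trans_le c4 c3; lra.
case: (hr' (pt R u)) => // -[fu nb] /eqP mu; exfalso; apply: nb.
have [m hm] := cosh_dist_max ts.
exists (4 * m)%N => q' c; have [u' c'] := pt_dense q'.
have c0 : cosh_dist (pt R u) (pt R u) <= 2 by rewrite cosh_distxx; lra.
have eu := along _ _ c fu u u' c0 c'.
have u'ts : u' \in map snd ts.
  by apply: contraT => /multiplicity_notin e; case: mu; rewrite eu.
rewrite natrM; have := cosh_dist_trans_le (hm _ u'ts) (_ : cosh_dist (pt R u') q' <= 2).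
by rewrite cosh_distC c' => /(_ isT); lra.
Qed.

End Enclosed.

(** * Pulling a cochain back from the Cayley graph to the tiling *)

Section CayleyToTiling.
Variables (G : groupType) (X : finType) (ev : X -> G).
Hypotheses (gen : generates_as_monoid ev) (sym : symmetric_image ev).
Local Open Scope ring_scope.
Variables (phi : G -> X -> int) (B : int) (rT : nat).
Implicit Types (g : G) (u v : int * int).

Definition geo_int (g h : G) : int := pint ev phi g (geo ev (g^-1 * h)%g).

Definition wclose (g h : G) : Prop := (wdist ev g h <= rT)%N.

Lemma wcloseC g h : wclose g h -> wclose h g.
Proof. by rewrite /wclose wdistC. Qed.

Hypothesis small : forall g w, (size w <= 5 * rT + 1)%N ->
  word_value ev w = 1%g -> `|pint ev phi g w| <= B.

Lemma B_ge0 : 0 <= B.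
Proof. by have := @small 1%g [::] isT (wv_nil ev); rewrite normr0. Qed.

Fixpoint geo_cycle g (s : seq G) : seq X :=
  if s is h :: s' then geo ev (g^-1 * h)%g ++ geo_cycle h s' else [::].

Fixpoint cycle_int g (s : seq G) : int :=
  if s is h :: s' then geo_int g h + cycle_int h s' else 0.

Lemma geo_cycle_wv g s : (g * word_value ev (geo_cycle g s))%g = last g s.
Proof.
elim: s g => [|h s IH] g /=; first by rewrite wv_nil mulg1.
by rewrite wv_cat (wv_geo gen) mulgA mulVKg IH.
Qed.

Lemma geo_cycle_int g s : pint ev phi g (geo_cycle g s) = cycle_int g s.
Proof. by elim: s g => //= h s IH g; rewrite pint_cat (wv_geo gen) mulVKg IH. Qed.

Fixpoint wclose_path g (s : seq G) : Prop :=
  if s is h :: s' then wclose g h /\ wclose_path h s' else True.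

Lemma size_geo_cycle g s : wclose_path g s -> (size (geo_cycle g s) <= size s * rT)%N.
Proof.
elim: s g => //= h s IH g [c /IH]; rewrite size_cat mulSn.
by move=> h1; apply: leq_add.
Qed.

Lemma cycle_small g s : wclose_path g s -> last g s = g -> (size s <= 5)%N ->
  `|cycle_int g s| <= B.
Proof.
move=> c l s5; rewrite -geo_cycle_int; apply: small.
  apply: leq_trans (size_geo_cycle c) _; apply: leq_trans (leq_addr 1 _).
  by rewrite leq_mul2r s5 orbT.
by apply: (mulgI g); rewrite geo_cycle_wv l mulg1.
Qed.

Lemma geo_intC g h : wclose g h -> `|geo_int g h + geo_int h g| <= B.
Proof.
move=> c; have := @cycle_small g [:: h; g]; rewrite /= addr0; apply => //.
by split=> //; split=> //; exact: wcloseC.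
Qed.

Lemma geo_int_triangle g h k : wclose g h -> wclose h k -> wclose k g ->
  `|geo_int g h + geo_int h k + geo_int k g| <= B.
Proof.
by move=> c1 c2 c3; have := @cycle_small g [:: h; k; g]; rewrite /= addr0 addrA; apply.
Qed.

Lemma geo_int_edge g x h : wclose (g * ev x)%g h -> wclose h g ->
  `|phi g x + geo_int (g * ev x)%g h + geo_int h g| <= B.
Proof.
move=> c1 c2; set s := geo_cycle (g * ev x)%g [:: h; g].
have -> : phi g x + geo_int (g * ev x)%g h + geo_int h g = pint ev phi g (x :: s).
  by rewrite [RHS]/= geo_cycle_int /= addr0 addrA.
apply: small.
  have h1 : (size s <= 2 * rT)%N by apply: size_geo_cycle; split.
  by rewrite /=; lia.
apply: (mulgI g); rewrite wv_cons mulgA.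
by have := geo_cycle_wv (g * ev x)%g [:: h; g]; rewrite -/s /= mulg1.
Qed.

Variable eta : int * int -> G.
Definition eh (k j : int) : int := geo_int (eta (k, j)) (eta (k + 1, j)).
Definition ed (k j : int) : int := geo_int (eta (k, j)) (eta (2 * k, j - 1)).

Lemma tile_small (k j : int) : let a := eta (k, j) in
  let b := eta (2 * k, j - 1) in let c := eta (2 * k + 1, j - 1) in
  let d := eta (2 * k + 1 + 1, j - 1) in let e := eta (k + 1, j) in
  wclose a b -> wclose b c -> wclose c d -> wclose d e -> wclose e a ->
  `|tile eh ed (k, j)| <= 3 * B.
Proof.
move=> a b c d e ab bc cd de ea.
have : `|cycle_int a [:: b; c; d; e; a]| <= B by apply: cycle_small; do ?split.
rewrite /= addr0.
have := geo_intC de; have := geo_intC ea.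
rewrite /tile /eh /ed /=.
have -> : 2 * (k + 1) = 2 * k + 1 + 1 by lia.
rewrite -/a -/b -/c -/d -/e.
move: (geo_int _ _) (geo_int _ _) (geo_int _ _) (geo_int _ _) (geo_int _ _) (geo_int _ _) (geo_int _ _); lia.
Qed.

(** The path is coned off from [g]. Each move costs [B] for its triangle and [B] for reversing a
    side at [g]. *)
Lemma path_int g v w : okpath v w ->
  (forall u, u \in verts v w -> wclose g (eta u)) ->
  (forall u m, u \in verts v w -> step u m \in verts v w -> ok u m ->
     wclose (eta u) (eta (step u m))) ->
  `|geo_int g (eta v) + mint eh ed v w - geo_int g (eta (run v w))| <= 2 * B * (size w)%:Z.
Proof.
elim: w v => [|m w IH] v /=; first by rewrite addr0 subrr normr0 mulr0.
move=> [om ow] cg cm.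
have hv : v \in v :: verts (step v m) w by rewrite mem_head.
have hv' : step v m \in v :: verts (step v m) w by rewrite inE verts_head orbT.
have sub u : u \in verts (step v m) w -> u \in v :: verts (step v m) w.
  by rewrite inE => ->; rewrite orbT.
have {IH} := IH _ ow (fun u h => cg u (sub u h))
  (fun u m' h h' => cm u m' (sub u h) (sub _ h')).
have c1 := cg _ hv; have c2 := cg _ hv'; have c3 := cm _ _ hv hv' om.
have t1 := geo_intC c1; have t2 := geo_intC c2.
have t3 := geo_int_triangle c1 c3 (wcloseC c2).
have t4 := geo_int_triangle c2 (wcloseC c3) (wcloseC c1).
have mE : move_value eh ed v m = geo_int (eta v) (eta (step v m)) \/
    move_value eh ed v m = - geo_int (eta (step v m)) (eta v).
  case: v om {ow cg cm hv hv' sub c1 c2 c3 t1 t2 t3 t4} => k j.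
  case: m => /= om; [left | right | right | left] => //.
    by rewrite /eh subrK.
  by rewrite /ed addrK -om.
rewrite intS; case: mE => ->; move: t1 t2 t3 t4;
  move: (geo_int _ _) (geo_int _ _) (geo_int _ _) (geo_int _ _) (geo_int _ _)
     (geo_int _ _) (geo_int _ _) (mint _ _ _ _) => *; lia.
Qed.

End CayleyToTiling.

Lemma abs_chain (a m1 m2 f f' e c P t ph x B : int) :
  (`|a + m1 - f| <= x -> `|ph + e + f'| <= B -> `|f + f'| <= B ->
  `|P + c - e - m2| <= t -> `|ph + P + c - a - (m1 + m2)| <= x + B + B + t)%R.
Proof. lia. Qed.

Lemma chain_budget (M : nat) (B s : int) :
  (2 * B * (2 * M%:Z) + B + B + (4 * M + 2)%N%:Z * B * s =
   (4 * M + 2)%N%:Z * B * (1 + s))%R.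
Proof. by rewrite PoszD PoszM; lra. Qed.

Lemma total_budget (M n : nat) (B p m : int) : (0 <= B -> 1 <= n%:Z ->
  `|p - m| <= (4 * M + 2)%N%:Z * B * n%:Z ->
  `|m| <= (5 * (2 * M * n) + 6)%N%:Z * (3 * B) ->
  `|p| <= (34 * M + 20)%N%:Z * B * n%:Z)%R.
Proof.
move=> B0 n1; have : (B <= B * n%:Z)%R by rewrite ler_peMr.
by rewrite !PoszD !PoszM; lia.
Qed.

Section MovePaths.
Implicit Types (u v : int * int).
Local Open Scope ring_scope.

Lemma step_tstep v m : ok v m -> tstep v (step v m).
Proof.
case: v => k j; case: m => /= om.
- exact: Or41.
- by apply: Or42; rewrite /= subrK.
- exact: Or43.
- by apply: Or44; rewrite /parent /= subrK; congr pair; lia.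
Qed.

Lemma verts_tconn v w u : okpath v w -> u \in verts v w ->
  exists2 n, (n <= size w)%N & tconn n v u.
Proof.
elim: w v => [|m w IH] v /=; first by rewrite inE => _ /eqP ->; exists 0%N.
move=> [om ow]; rewrite inE => /predU1P[->|/(IH _ ow)[n nw c]]; first by exists 0%N.
by exists n.+1 => //; exists (step v m) => //; exact: step_tstep.
Qed.

Lemma tconn_moves n u v : tconn n u v ->
  exists w, [/\ okpath u w, run u w = v & (size w <= 2 * n)%N].
Proof.
elim: n u => [|n IH] u /=; first by move=> ->; exists [::].
move=> [u' s /IH[w [okw rw sw]]].
suff [w1 [ok1 r1 s1]] : exists w, [/\ okpath u w, run u w = u' & (size w <= 2)%N].
  exists (w1 ++ w); rewrite run_cat r1 rw size_cat; split=> //; last by lia.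
  by apply: okpath_cat => //; rewrite r1.
case: u u' s {IH okw rw} => k j [k' j'] [] /=.
- by move=> [-> ->]; exists [:: MR].
- by move=> [-> ->]; exists [:: ML]; rewrite /= addrK.
- rewrite /parent /= => -[-> ->].
  have [e|e] : k = 2 * (k %/ 2)%Z \/ k - 1 = 2 * (k %/ 2)%Z by lia.
    by exists [:: MU].
  have e' : ((k - 1) %/ 2)%Z = (k %/ 2)%Z by lia.
  by exists [:: ML; MU]; rewrite /= e'.
- rewrite /parent /= => -[-> ->].
  have [e|e] : k' = 2 * (k' %/ 2)%Z \/ k' = 2 * (k' %/ 2)%Z + 1 by lia.
    by exists [:: MD]; rewrite /= addrK -e.
  by exists [:: MD; MR]; rewrite /= addrK -e.
Qed.

End MovePaths.

Section Isoperimetric.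
Variable R : realType.
Variables (G : groupType) (rho : {multiplicative G -> isom_hyp_plane R}).
Hypotheses (rho_inj : injective rho) (rho_iso : isolated (range rho) = range rho).
Variables (X : finType) (ev : X -> G).
Hypotheses (gen : generates_as_monoid ev) (sym : symmetric_image ev).
Local Open Scope ring_scope.
Local Notation o := (tri0 R).
Local Notation orb g := (gact rho g (tri0 R)).

Lemma orbit_close (T : R) : exists r : nat, forall g h : G,
  cosh_dist (orb g) (orb h) <= T -> (wdist ev g h <= r)%N.
Proof.
have [s sE] := (iffLR (finite_seqP _) (gact_proper rho_inj rho_iso T)).
exists (\max_(g <- s) len ev g)%N => g h c.
have : (g^-1 * h)%g \in s.
  have : [set` s]%classic (g^-1 * h)%g.
    by rewrite -sE /= -(cosh_dist_gact rho g) -gactM mulVKg.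
  by [].
by rewrite /wdist => ghs; apply: (leq_bigmax_seq (F := len ev)).
Qed.

(** A word is shadowed by a path in the tiling near the orbit, which is then filled. The map [eta]
    sends tiling vertices to nearby group elements and is meaningful only near the orbit; elsewhere
    the pulled back cochain is uncontrolled. This does no harm, since tiles of nonzero multiplicity
    lie near the orbit. *)
Theorem fuchsian_linear_isoperimetric : linear_isoperimetric ev.
Proof.
have [V VP] := boolp.choice (@pt_dense R); pose vtx g := V (orb g).
pose cX : R := \sum_x cosh_dist o (orb (ev x)).
have cXP x : cosh_dist o (orb (ev x)) <= cX.
  by rewrite /cX (bigD1 x) //= lerDl sumr_ge0 // => y _; exact: cosh_dist_ge0.
have [M hM] := @tconn_close R (16 * cX).
have vtxP g : cosh_dist (orb g) (pt R (vtx g)) <= 2 by exact: VP.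
have edge g x : exists w, [/\ okpath (vtx g) w, run (vtx g) w = vtx (g * ev x)%g &
    (size w <= 2 * M)%N].
  have c : cosh_dist (orb g) (orb (g * ev x)%g) <= cX.
    by rewrite gactM cosh_dist_gact.
  have c1 : cosh_dist (pt R (vtx g)) (orb (g * ev x)%g) <= 2 * 2 * cX.
    by apply: cosh_dist_trans_le c; rewrite cosh_distC.
  have c2 := cosh_dist_trans_le c1 (vtxP _).
  have [|n nM /tconn_moves[w [okw rw sw]]] := hM (vtx g) (vtx (g * ev x)%g); first by lra.
  by exists w; split=> //; lia.
pose rG : R := 2 * 2 * 3 ^+ (2 * M).
have rG_ge2 : 2 <= rG.
  have : (1 : R) <= 3 ^+ (2 * M) by apply: exprn_ege1; lra.
  by rewrite /rG; lra.
have path_near g w u : okpath (vtx g) w -> (size w <= 2 * M)%N ->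
    u \in verts (vtx g) w -> cosh_dist (orb g) (pt R u) <= rG.
  move=> okw sw /(verts_tconn okw)[n nw /(cosh_dist_tconn R) c].
  apply: cosh_dist_trans_le (vtxP g) _; apply: le_trans c _.
  by apply: ler_weXn2l; [lra | exact: leq_trans nw sw].
have [r' hr'] := multiplicity_near_orbit rho rG.
(* A corner of a tile is at most three steps from its base vertex, hence within [27 / 2] of it by
   repeated use of [cosh_dist_trans]; the factor [27 = 2 * 27 / 2] carries this over to the
   orbit. *)
pose R2 : R := Num.max rG (27 * r').
have R2_ge : rG <= R2 by rewrite le_max lexx.
have R2_ge' : 27 * r' <= R2 by rewrite le_max lexx orbT.
have /boolp.choice[eta etaP] : forall u : int * int, exists g,
    near_orbit rho R2 (pt R u) -> cosh_dist (pt R u) (orb g) <= R2.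
  move=> u; have [[g hg]|n] := pselect (near_orbit rho R2 (pt R u)).
    by exists g.
  by exists 1%g.
pose TG := Num.max (2 * rG * R2) (6 * R2 ^+ 2).
have [rT hrT] := orbit_close TG.
have close1 g u : cosh_dist (orb g) (pt R u) <= rG -> wclose ev rT g (eta u).
  move=> c; apply: hrT; rewrite le_max; apply/orP; left.
  apply: (cosh_dist_trans_le c (etaP u _)).
  by exists g; rewrite cosh_distC (le_trans c).
have close2 u u' : near_orbit rho R2 (pt R u) -> near_orbit rho R2 (pt R u') ->
    tstep u u' -> wclose ev rT (eta u) (eta u').
  move=> /etaP c1 /etaP c2 /(cosh_dist_tstep R) c; apply: hrT.
  rewrite le_max; apply/orP; right; rewrite cosh_distC in c1.
  by have := cosh_dist_trans_le (cosh_dist_trans_le c1 c) c2; lra.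
exists (5 * rT + 1)%N, (34 * M + 20)%N => phi B small.
have B0 := B_ge0 small.
pose h := eh ev phi eta; pose dn := ed ev phi eta.
pose E g := geo_int ev phi g (eta (vtx g)).
(* [E] accounts for the geodesic from a group element to the label of its tiling vertex, so the
   error is additive along the word: each letter is shadowed by at most [2 * M] moves at [2 * B]
   each, plus [2 * B] to close up. *)
have main : forall w g, exists Gm, [/\ okpath (vtx g) Gm,
    run (vtx g) Gm = vtx (g * word_value ev w)%g, (size Gm <= 2 * M * size w)%N,
    forall u, u \in verts (vtx g) Gm -> near_orbit rho rG (pt R u) &
    `|pint ev phi g w + E (g * word_value ev w)%g - E g - mint h dn (vtx g) Gm|
      <= (4 * M + 2)%N%:Z * B * (size w)%:Z].
  elim=> [|x w IH] g.
    exists [::]; rewrite wv_nil mulg1 /= add0r subrr subr0 normr0 mulr0.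
    split=> // u; rewrite inE => /eqP ->; exists g.
    by rewrite cosh_distC (le_trans (vtxP g)).
  have [G1 [ok1 run1 s1]] := edge g x.
  have [G2 [ok2 run2 s2 n2 i2]] := IH (g * ev x)%g.
  have near1 u : u \in verts (vtx g) G1 -> cosh_dist (orb g) (pt R u) <= rG.
    exact: path_near.
  have vx : vtx (g * ev x)%g \in verts (vtx g) G1.
    rewrite -run1; elim: {ok1 run1 s1 near1} G1 (vtx g) => [|m G1 IH1] v /=.
      by rewrite mem_head.
    by rewrite inE IH1 orbT.
  have near1' u : u \in verts (vtx g) G1 -> near_orbit rho R2 (pt R u).
    by move=> /near1 c; exists g; rewrite cosh_distC (le_trans c).
  exists (G1 ++ G2); rewrite wv_cons mulgA; split.
  - by apply: okpath_cat => //; rewrite run1.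
  - by rewrite run_cat run1.
  - by rewrite size_cat /=; lia.
  - move=> u; have : u \in verts (vtx g) (G1 ++ G2) ->
        u \in verts (vtx g) G1 \/ u \in verts (run (vtx g) G1) G2.
      elim: {ok1 run1 s1 near1 vx near1'} G1 (vtx g) => [|m G1 IH1] v /=; first by right.
      rewrite !inE => /predU1P[->|/IH1[-> | ->]]; [left|left|right] => //.
        by rewrite eqxx.
      by rewrite orbT.
    move=> /[apply] -[/near1 c|]; first by exists g; rewrite cosh_distC.
    by rewrite run1; exact: n2.
  have p1 : `|E g + mint h dn (vtx g) G1 - geo_int ev phi g (eta (vtx (g * ev x)%g))|
      <= 2 * B * (size G1)%:Z.
    rewrite -run1; apply: (path_int gen sym small) => // [u /near1|u m uG uG' om].
      exact: close1.
    by apply: close2; [exact: near1' | exact: near1' | exact: step_tstep].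
  have c1 : wclose ev rT (g * ev x)%g (eta (vtx (g * ev x)%g)).
    by apply: close1; apply: le_trans (vtxP _) _.
  have c2 : wclose ev rT g (eta (vtx (g * ev x)%g)) by apply/close1/near1.
  have p2 := geo_int_edge gen small c1 (wcloseC gen sym c2).
  have p3 := geo_intC gen sym small c2.
  have p4 : 2 * B * (size G1)%:Z <= 2 * B * (2 * M%:Z).
    by apply: ler_wpM2l; [lia | move: s1; lia].
  have p5 := le_trans p1 p4.
  rewrite mint_cat run1 /= intS; apply: le_trans (abs_chain p5 p2 p3 i2) _.
  by rewrite chain_budget.
move=> g w w1; have [Gm [okG runG sG nG iG]] := main w g.
rewrite w1 mulg1 in runG iG; rewrite addrK in iG.
have [ts [ts_size uts tsE]] := closed_path_filling okG runG.
have tile_le u : u \in undup (map snd ts) ->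
    `|multiplicity ts u * tile h dn u| <= `|multiplicity ts u| * (3 * B).
  move=> _; rewrite normrM; have [->|mu] := eqVneq (multiplicity ts u) 0.
    by rewrite normr0 !mul0r.
  apply: ler_wpM2l => //; have [g0 c0] := hr' _ _ _ okG tsE nG u mu.
  have near u1 : cosh_dist (pt R u1) (pt R u) <= 27 / 2 -> near_orbit rho R2 (pt R u1).
    move=> c; exists g0; apply: le_trans R2_ge'.
    by have := cosh_dist_trans_le c c0; lra.
  case: u {mu} c0 near => k j c0 near.
  have sa : tstep (k, j) (2 * k, j - 1).
    by apply: Or44; rewrite /parent /= subrK; congr pair; lia.
  have sb : tstep (2 * k, j - 1) (2 * k + 1, j - 1) by exact: Or41.
  have sc : tstep (2 * k + 1, j - 1) (2 * k + 1 + 1, j - 1) by exact: Or41.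
  have sd : tstep (2 * k + 1 + 1, j - 1) (k + 1, j).
    by apply: Or43; rewrite /parent /= subrK; congr pair; lia.
  have se : tstep (k + 1, j) (k, j) by exact: Or42.
  have ca := cosh_dist_tstep R (tstepC sa); have cb := cosh_dist_tstep R (tstepC sb).
  have cc := cosh_dist_tstep R (tstepC sc); have ce := cosh_dist_tstep R se.
  have cba := cosh_dist_trans_le cb ca.
  have ccba := cosh_dist_trans_le cc cba.
  have na : near_orbit rho R2 (pt R (k, j)) by apply: near; rewrite cosh_distxx; lra.
  have nb : near_orbit rho R2 (pt R (2 * k, j - 1)) by apply: near; lra.
  have nc : near_orbit rho R2 (pt R (2 * k + 1, j - 1)) by apply: near; lra.
  have nd : near_orbit rho R2 (pt R (2 * k + 1 + 1, j - 1)) by apply: near; lra.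
  have ne : near_orbit rho R2 (pt R (k + 1, j)) by apply: near; lra.
  apply: (tile_small gen sym small); exact: close2.
have mint_le : `|mint h dn (vtx g) Gm| <= (5 * (2 * M * size w) + 6)%N%:Z * (3 * B).
  rewrite tsE tsum_multiplicity; apply: le_trans (ler_norm_sum _ _ _) _.
  apply: (@le_trans _ _ (\sum_(u <- undup (map snd ts)) `|multiplicity ts u| * (3 * B))).
    by rewrite !big_seq; apply: ler_sum => u; exact: tile_le.
  rewrite -mulr_suml; apply: ler_wpM2r; first by lia.
  by apply: le_trans (sum_multiplicity uts) _; rewrite lez_nat; lia.
case: w w1 sG iG mint_le => [|x w] w1 sG iG mint_le; first by rewrite /= normr0 mulr0.
have s1 : 1 <= (size (x :: w))%:Z by [].
exact: (total_budget B0 s1 iG mint_le).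
Qed.

End Isoperimetric.

(** * Functions computed by finite automata along geodesics *)

Section FiniteState.
Variables (G : groupType) (X : finType) (ev : X -> G).
Local Open Scope group_scope.
Local Notation wv := (word_value ev).
Local Notation L := (geodesic_language ev).

(** A Myhill-Nerode criterion. The map [ty] need not be compatible with appending letters: the
    automaton replaces the word read so far by a chosen representative of its type before every
    letter. *)
Lemma regular_of_types (K : set (seq X)) (Q : finType) (ty : seq X -> Q) :
  (forall w1 w2, ty w1 = ty w2 -> forall v, K (w1 ++ v) -> K (w2 ++ v)) ->
  regular_language K.
Proof.
move=> H; pose rep q := xget [::] [set w | ty w = q].
have repP w : ty (rep (ty w)) = ty w.
  by rewrite /rep; case: xgetP => [u _ //|/(_ w)]; case.
exists Q, (ty [::]), (fun q x => ty (rcons (rep q) x)), (fun q => `[< K (rep q) >]) => w.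
suff inv v : K (w ++ v) <-> K (rep (foldl (fun q x => ty (rcons (rep q) x)) (ty [::]) w) ++ v).
  by have := inv [::]; rewrite !cats0 => ->; split=> /asboolP.
elim/last_ind: w v => [|w x IH] v.
  by split; apply: (H [::]) || apply: (H (rep (ty [::])) [::]); rewrite repP.
rewrite -cats1 foldl_cat /= -catA /= IH; set q := foldl _ _ _.
rewrite -cat_rcons.
by split; apply: H; rewrite repP.
Qed.

(** A right-congruence form of being computed by an automaton along geodesics. As no transition map
    is demanded, types can be combined by products. *)
Definition finite_state (V : Type) (f : G -> V) : Prop :=
  exists (Q : finType) (ty : seq X -> Q), forall w1 w2, ty w1 = ty w2 ->
    forall v, L (w1 ++ v) -> L (w2 ++ v) /\ f (wv (w1 ++ v)) = f (wv (w2 ++ v)).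

Lemma finite_state_rational (V : Type) (f : G -> V) a :
  finite_state f -> Defs.rational ev L [set g | f g = a].
Proof.
move=> [Q [ty H]]; apply: (regular_of_types (ty := ty)) => w1 w2 e v [Lw /= fa].
by have [L2 <-] := H _ _ e v Lw.
Qed.

Lemma finite_state_comp (V W : Type) (F : V -> W) (f : G -> V) :
  finite_state f -> finite_state (fun g => F (f g)).
Proof.
move=> [Q [ty H]]; exists Q, ty => w1 w2 e v Lw.
by have [L2 ->] := H _ _ e v Lw.
Qed.

Lemma finite_state_pair (V W : Type) (f : G -> V) (f' : G -> W) :
  finite_state f -> finite_state f' -> finite_state (fun g => (f g, f' g)).
Proof.
move=> [Q [ty H]] [Q' [ty' H']]; exists (Q * Q')%type, (fun w => (ty w, ty' w)).
move=> w1 w2 [e e'] v Lw.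
by have [L2 ->] := H _ _ e v Lw; have [_ ->] := H' _ _ e' v Lw.
Qed.

Lemma finite_state_family (I : finType) (V : Type) (f : I -> G -> V) :
  finite_state (fun=> tt) -> (forall i, finite_state (f i)) ->
  finite_state (fun g i => f i g).
Proof.
move=> [Q0 [ty0 H0]] Hf.
have /boolp.choice[Q HQ] : forall i, exists Q : finType, exists ty : seq X -> Q,
  forall w1 w2, ty w1 = ty w2 ->
    forall v, L (w1 ++ v) -> L (w2 ++ v) /\ f i (wv (w1 ++ v)) = f i (wv (w2 ++ v)).
  exact: Hf.
pose ty i := projT1 (cid (HQ i)); have tyP i := projT2 (cid (HQ i)).
exists (Q0 * {dffun forall i, Q i})%type, (fun w => (ty0 w, [ffun i => ty i w])).
move=> w1 w2 [e0 /ffunP e] v Lw; have [L2 _] := H0 _ _ e0 v Lw; split=> //.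
apply/funext => i; have ei : ty i w1 = ty i w2 by have := e i; rewrite !ffunE.
by have [_ ->] := tyP i _ _ ei v Lw.
Qed.

Lemma table_code (T : Type) (J : finType) (V : eqType) (t : T -> J -> V) (s : seq V) :
  (forall a j, t a j \in s) ->
  exists (Q : finType) (c : T -> Q), forall a b, c a = c b -> forall j, t a j = t b j.
Proof.
move=> ts; exists {ffun J -> 'I_(size s).+1}.
exists (fun a => [ffun j => inord (index (t a j) s)]) => a b /ffunP e j.
have := congr1 val (e j); rewrite !ffunE /= !inordK ?ltnS ?index_size // => ei.
by rewrite -(nth_index (t a j) (ts a j)) ei nth_index.
Qed.

Lemma table_code_int (T : Type) (J : finType) (t : T -> J -> int) (B : nat) :
  (forall a j, (`|t a j| <= B%:Z)%R) ->
  exists (Q : finType) (c : T -> Q), forall a b, c a = c b -> forall j, t a j = t b j.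
Proof.
move=> tB; apply: (@table_code _ _ _ t [seq (i%:Z - B%:Z)%R | i <- iota 0 (2 * B).+1]).
move=> a j; apply/mapP; exists (absz (t a j + B%:Z)%R).
  by rewrite mem_iota; have := tB a j; lia.
by have := tB a j; lia.
Qed.

End FiniteState.

(** * Cone types and the types of a nonpositive cocycle *)

Section Types.
Variables (G : groupType) (X : finType) (ev : X -> G).
Hypotheses (gen : generates_as_monoid ev) (sym : symmetric_image ev).
Hypothesis LI : linear_isoperimetric ev.
Local Open Scope group_scope.
Local Notation wv := (word_value ev).
Local Notation L := (geodesic_language ev).
Local Notation len := (len ev).

Definition hits (N : nat) (g : G) (p : seq X) : Prop :=
  exists2 k, (k <= size p)%N & (len (g^-1 * wv (take k p)) <= N)%N.

(** The endpoint may be off by one letter [b], which is later needed to evaluate a cocycle on a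
    generator. Appending the inverse of [b] restores the endpoint at the price of the constants
    [la + 1] and [N.+1]. *)
Lemma quasi_geodesic_hits la : exists N, forall w v b p, L (w ++ v) ->
  (size b <= 1)%N -> wv p = wv w * wv v * wv b -> quasi_geodesic ev la 0 p ->
  hits N (wv w) p.
Proof.
have [N HN] := geodesic_near_quasi_geodesic gen sym la (la + 1) LI.
exists N.+1 => w v b p Lwv sb pE qp.
pose p' := p ++ invw ev b.
have p'E : wv p' = wv (w ++ v) by rewrite /p' !wv_cat (wv_invw sym) pE mulgK.
have sp' : size p' = (size p + size b)%N by rewrite size_cat size_invw.
have tk i : (i <= size p)%N -> take i p' = take i p.
  by move=> ip; rewrite takel_cat.
have last_close : (wdist ev (wv p) (wv p') <= 1)%N.
  by rewrite /p' wv_cat; apply: leq_trans (wdist_wv gen _ _) _; rewrite size_invw.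
have qp' : quasi_geodesic ev la (la + 1) p'.
  move=> i j /andP[ij]; rewrite sp' => jp.
  have [jp1|jp1] := leqP j (size p).
    have := qp i j; rewrite ij jp1 addn0 => /(_ isT).
    by rewrite !tk //; lia.
  have je : j = size p' by rewrite sp'; lia.
  have [ip1|ip1] := leqP i (size p); last by lia.
  have := qp i (size p); rewrite ip1 leqnn addn0 take_size => /(_ isT) h.
  rewrite je take_size tk //.
  have tr := wdist_triangle gen (wv p') (wv (take i p)) (wv p).
  rewrite (wdistC gen sym (wv p') (wv p)) in tr.
  set D := wdist ev (wv (take i p)) (wv p') in tr *.
  have : (la * wdist ev (wv (take i p)) (wv p) <= la * (D + 1))%N.
    by rewrite leq_mul2l; apply/orP; right; lia.
  by move: h sp'; rewrite mulnDr muln1; lia.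
have [|j jp' dj] := HN (w ++ v) p' Lwv p'E qp' (size w); first by rewrite size_cat leq_addr.
rewrite take_size_cat // in dj.
have [jp1|jp1] := leqP j (size p); first by exists j => //; move: dj; rewrite tk //; exact: leqW.
exists (size p) => //; rewrite take_size.
have je : j = size p' by move: jp'; rewrite sp'; lia.
rewrite je take_size in dj.
have := wdist_triangle gen (wv p') (wv w) (wv p); rewrite (wdistC gen sym (wv p') (wv p)).
by rewrite {1}/wdist; lia.
Qed.

Lemma geodesic_quasi_geodesic w : L w -> quasi_geodesic ev 1 0 w.
Proof. by move=> Lw i j ij; rewrite (wdist_geodesic gen Lw ij) mul1n addn0. Qed.

Lemma geo_geodesic g : L (geo ev g).
Proof. by apply/(geodesicP gen); rewrite (wv_geo gen). Qed.

(** This is minus twice the Gromov product of [g^-1] and [h] at 1. It is a coboundary, nonpositive,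
    and vanishes exactly when lengths add up. *)
Definition len_tau (g h : G) : int := ((len (g * h))%:Z - (len g)%:Z - (len h)%:Z)%R.

Section OptimalFamily.
Variables (I : finType) (dot : I -> G -> I) (tau : I -> G -> G -> int).

(* The abstract situation for the defect [tau] of a superadditive family of
   functions on [G]. *)
Hypothesis tau_le0 : forall i g h, (tau i g h <= 0)%R.
Hypothesis tauM : forall i g h k,
  (tau (dot i k) g h + tau i (g * h)%g k = tau i g (h * k)%g + tau i h k)%R.
Hypothesis tau_bounded : forall h, exists m : nat, forall i g, (- m%:Z <= tau i g h)%R.
Variable N : nat.
Hypothesis tau_hit : forall w v b i, L (w ++ v) -> (size b <= 1)%N ->
  exists2 u, (len u <= N)%N & tau i (wv w * u) (u^-1 * (wv v * wv b)) = 0%R.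

(** By the cocycle identity [tau i g h] equals a value on the ball plus [tau i (g * u) (u^-1 * h)],
    up to the term [tau i u (u^-1 * h)], which does not involve [g]. The middle term is 0 for [g1]
    and at most 0 for [g2]. *)
Lemma tau_type_le i g1 g2 h :
  (forall i u, (len u <= N)%N -> tau i g1 u = tau i g2 u) ->
  (exists2 u, (len u <= N)%N & tau i (g1 * u) (u^-1 * h) = 0%R) ->
  (tau i g2 h <= tau i g1 h)%R.
Proof.
move=> e [u uN t0].
have E1 := tauM i g1 u (u^-1 * h); have E2 := tauM i g2 u (u^-1 * h).
rewrite mulVKg in E1 E2; rewrite t0 (e _ u uN) in E1.
by have := tau_le0 i (g2 * u) (u^-1 * h); lia.
Qed.

Lemma tau_type_eq w1 w2 v b i :
  (forall i u, (len u <= N)%N -> tau i (wv w1) u = tau i (wv w2) u) ->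
  L (w1 ++ v) -> L (w2 ++ v) -> (size b <= 1)%N ->
  tau i (wv w1) (wv v * wv b) = tau i (wv w2) (wv v * wv b).
Proof.
move=> e L1 L2 sb; apply/eqP; rewrite eq_le; apply/andP; split.
  apply: tau_type_le => [j u uN|]; first by rewrite e.
  exact: tau_hit.
by apply: tau_type_le => //; exact: tau_hit.
Qed.

Lemma tau_code : exists (Q : finType) (c : seq X -> Q), forall w1 w2, c w1 = c w2 ->
  forall i u, (len u <= N)%N -> tau i (wv w1) u = tau i (wv w2) u.
Proof.
have /boolp.choice[m mP] := tau_bounded.
pose t (w : seq X) (j : I * {bseq N of X}) := tau j.1 (wv w) (wv j.2).
pose B := (\max_(u : {bseq N of X}) m (wv u))%N.
have [|Q [c cP]] := @table_code_int _ _ t B.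
  move=> w [i u]; rewrite /t /=.
  have := mP (wv u) i (wv w); have := tau_le0 i (wv w) (wv u).
  have := leq_bigmax (F := fun u : {bseq N of X} => m (wv u)) u; rewrite -/B.
  by move: (m _) B => *; lia.
exists Q, c => w1 w2 e i u uN.
have := cP _ _ e (i, Bseq (uN : (size (geo ev u) <= N)%N)).
by rewrite /t /= (wv_geo gen).
Qed.

End OptimalFamily.

Lemma len_tau_le0 g h : (len_tau g h <= 0)%R.
Proof. by have := lenM gen g h; rewrite /len_tau; lia. Qed.

Lemma len_tauM g h k :
  (len_tau g h + len_tau (g * h)%g k = len_tau g (h * k)%g + len_tau h k)%R.
Proof. by rewrite /len_tau mulgA; lra. Qed.

Lemma len_tau_bounded h : exists m : nat, forall g, (- m%:Z <= len_tau g h)%R.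
Proof.
exists (2 * len h)%N => g; have := lenM gen (g * h) h^-1.
by rewrite mulgK (lenV gen sym) /len_tau; lia.
Qed.

Lemma hits_len_tau N g h p : L p -> wv p = g * h -> hits N g p ->
  exists2 u, (len u <= N)%N & len_tau (g * u) (u^-1 * h) = 0%R.
Proof.
move=> Lp pE [k kp d]; exists (g^-1 * wv (take k p)) => //.
have e : wv p = wv (take k p) * wv (drop k p) by rewrite -wv_cat cat_take_drop.
rewrite mulVKg invgM invgK -mulgA -pE e mulKg.
have [L1 L2] : L (take k p) /\ L (drop k p).
  by apply: (geodesic_cat gen); rewrite cat_take_drop.
rewrite /len_tau -e -!(iffLR (geodesicP gen _)) // size_takel // size_drop.
by lia.
Qed.

Lemma len_tau_hit : exists N, forall w v b, L (w ++ v) -> (size b <= 1)%N ->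
  exists2 u, (len u <= N)%N & len_tau (wv w * u) (u^-1 * (wv v * wv b)) = 0%R.
Proof.
have [N HN] := quasi_geodesic_hits 1; exists N => w v b Lwv sb.
have H : hits N (wv w) (geo ev (wv w * (wv v * wv b))).
  apply: (HN w v b) => //; first by rewrite (wv_geo gen) mulgA.
  exact/geodesic_quasi_geodesic/geo_geodesic.
exact: (hits_len_tau (@geo_geodesic _) (wv_geo gen _) H).
Qed.

Lemma geodesic_len_tau w v : L w -> L v -> L (w ++ v) <-> len_tau (wv w) (wv v) = 0%R.
Proof.
move=> Lw Lv; rewrite (geodesicP gen) size_cat wv_cat /len_tau.
rewrite -(iffLR (geodesicP gen w) Lw) -(iffLR (geodesicP gen v) Lv).
by split; lia.
Qed.

Definition same_len_type N g1 g2 :=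
  forall u, (len u <= N)%N -> len_tau g1 u = len_tau g2 u.

(* Cannon's theorem that there are finitely many cone types. *)
Lemma cone_type : exists N, forall w1 w2, L w1 -> L w2 ->
  same_len_type N (wv w1) (wv w2) -> forall v, L (w1 ++ v) -> L (w2 ++ v).
Proof.
have [N HN] := len_tau_hit; exists N => w1 w2 L1 L2 e.
elim/last_ind => [|v x IH]; first by rewrite !cats0.
rewrite -!rcons_cat => Lv; have [Lv' _] : L (w1 ++ v) /\ L [:: x].
  by apply: (geodesic_cat gen); rewrite cats1.
have L2v := IH Lv'.
have Lvx : L (rcons v x) by move: Lv; rewrite rcons_cat => /(geodesic_cat gen)[].
rewrite rcons_cat; apply/(geodesic_len_tau L2 Lvx).
move: Lv; rewrite rcons_cat => /(geodesic_len_tau L1 Lvx) t1.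
apply/eqP; rewrite eq_le len_tau_le0 /= -{1}t1 -cats1 wv_cat.
(* The hit is needed along [w2], where so far only [w2 ++ v] is known to be geodesic; this is why
   the target may lie one letter further. *)
apply: (@tau_type_le unit (fun i _ => i) (fun=> len_tau) _ _ N tt).
- by move=> _; exact: len_tau_le0.
- by move=> _; exact: len_tauM.
- by move=> _ u uN; rewrite e.
- exact: HN.
Qed.

Lemma cone_code : exists (Q : finType) (c : seq X -> Q), forall w1 w2, c w1 = c w2 ->
  forall v, L (w1 ++ v) -> L (w2 ++ v).
Proof.
have [N HN] := cone_type.
have [||Q [c cP]] := @tau_code unit (fun=> len_tau) _ _ N.
- by move=> _; exact: len_tau_le0.
- by move=> h; have [m mP] := len_tau_bounded h; exists m.
exists (bool * Q)%type, (fun w => (`[< L w >], c w)) => w1 w2 [eL ec] v Lv.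
have [L1 _] := geodesic_cat gen Lv.
have L2 : L w2 by apply/asboolP; rewrite -eL; apply/asboolP.
by apply: (HN w1) => // u uN; exact: (cP _ _ ec tt).
Qed.

Lemma finite_state_tt : finite_state ev (fun=> tt).
Proof.
by have [Q [c cP]] := cone_code; exists Q, c => w1 w2 e v Lv; split=> //; exact: cP Lv.
Qed.

(** The cocycle identity expresses the value at [(wv w * wv v, ev x)] through values at [wv w] with
    second argument [wv v] and [wv v * ev x]. Both are covered by [tau_type_eq], the remaining term
    does not involve [w]. *)
Lemma finite_state_tau (I : finType) (dot : I -> G -> I) (tau : I -> G -> G -> int) N :
  (forall i g h, (tau i g h <= 0)%R) ->
  (forall i g h k, (tau (dot i k) g h + tau i (g * h)%g k =
     tau i g (h * k)%g + tau i h k)%R) ->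
  (forall h, exists m : nat, forall i g, (- m%:Z <= tau i g h)%R) ->
  (forall w v b i, L (w ++ v) -> (size b <= 1)%N ->
    exists2 u, (len u <= N)%N & tau i (wv w * u) (u^-1 * (wv v * wv b)) = 0%R) ->
  forall i x, finite_state ev (fun g => tau i g (ev x)).
Proof.
move=> t1 t2 t3 t4 i x.
have [Q0 [c0 c0P]] := cone_code.
have [Q [c cP]] := tau_code t1 t3 N.
exists (Q0 * Q)%type, (fun w => (c0 w, c w)) => w1 w2 [e0 e] v L1.
have L2 := c0P _ _ e0 v L1; split=> //; rewrite !wv_cat.
have := t2 i (wv w1) (wv v) (ev x); have := t2 i (wv w2) (wv v) (ev x).
have e1 : tau (dot i (ev x)) (wv w1) (wv v) = tau (dot i (ev x)) (wv w2) (wv v).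
  have := tau_type_eq t1 t2 t4 (dot i (ev x)) (cP _ _ e) L1 L2 (isT : (size [::] <= 1)%N).
  by rewrite wv_nil mulg1.
have e2 : tau i (wv w1) (wv v * ev x) = tau i (wv w2) (wv v * ev x).
  have := tau_type_eq t1 t2 t4 i (cP _ _ e) L1 L2 (isT : (size [:: x] <= 1)%N).
  by rewrite wv_cons wv_nil mulg1.
by rewrite e1 e2; move: (tau _ _ _) (tau _ _ _) (tau _ _ _) (tau _ _ _) => *; lia.
Qed.

End Types.

(** * Identities in abelian groups by reflection *)

Section ZmodReflection.
Variable A : zmodType.
Local Open Scope ring_scope.

Inductive zterm := ZVar of nat | ZAdd of zterm & zterm | ZOpp of zterm | ZZero.

Fixpoint zeval (e : seq A) (t : zterm) : A :=
  match t with
  | ZVar n => nth 0 e n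
  | ZAdd s t => zeval e s + zeval e t
  | ZOpp t => - zeval e t
  | ZZero => 0
  end.

Fixpoint zcoef (t : zterm) (i : nat) : int :=
  match t with
  | ZVar n => if n == i then 1 else 0
  | ZAdd s t => zcoef s i + zcoef t i
  | ZOpp t => - zcoef t i
  | ZZero => 0
  end.

Lemma zeval_coef e t : zeval e t = \sum_(i < size e) e`_i *~ zcoef t i.
Proof.
elim: t => [n|s IHs t IHt|t IHt|] /=; rewrite ?IHs ?IHt.
- have [ne|ne] := ltnP n (size e).
    rewrite (bigD1 (Ordinal ne)) //= eqxx mulr1z big1 ?addr0 // => i.
    by rewrite -val_eqE /= eq_sym => /negPf ->; rewrite mulr0z.
  rewrite nth_default // big1 // => i _.
  by case: eqP => [e'|_]; [move: ne; rewrite e' leqNgt ltn_ord | rewrite mulr0z].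
- by rewrite -big_split /=; apply: eq_bigr => i _; rewrite mulrzDr.
- by rewrite -sumrN; apply: eq_bigr => i _; rewrite mulrNz.
- by rewrite big1 // => i _; rewrite mulr0z.
Qed.

Lemma zmod_correct e s t :
  all (fun i => zcoef s i == zcoef t i) (iota 0 (size e)) -> zeval e s = zeval e t.
Proof.
move=> /allP H; rewrite !zeval_coef; apply: eq_bigr => i _.
have /eqP -> // : zcoef s i == zcoef t i.
by apply: H; rewrite mem_iota /= add0n ltn_ord.
Qed.

End ZmodReflection.

Ltac zmod_index t l :=
  lazymatch l with
  | cons ?a ?l' =>
    match constr:(tt) with
    | _ => let _ := match constr:(tt) with _ => unify t a end in constr:(0%N)
    | _ => let n := zmod_index t l' in constr:(S n)
    end
  end.

Ltac zmod_atoms t acc :=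
  lazymatch t with
  | (?a + ?b)%R => let acc := zmod_atoms a acc in zmod_atoms b acc
  | (- ?a)%R => zmod_atoms a acc
  | 0%R => acc
  | _ => match constr:(tt) with
         | _ => let _ := zmod_index t acc in acc
         | _ => constr:(cons t acc)
         end
  end.

Ltac zmod_reify t l :=
  lazymatch t with
  | (?a + ?b)%R => let s := zmod_reify a l in let t' := zmod_reify b l in constr:(ZAdd s t')
  | (- ?a)%R => let s := zmod_reify a l in constr:(ZOpp s)
  | 0%R => constr:(ZZero)
  | _ => let n := zmod_index t l in constr:(ZVar n)
  end.

Ltac zmod :=
  lazymatch goal with
  | |- @eq ?T ?a ?b =>
    let l := zmod_atoms a (@nil T) in
    let l := zmod_atoms b l in
    let s := zmod_reify a l in
    let t := zmod_reify b l in
    exact: (@zmod_correct _ l s t isT)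
  end.

(** * Optimal cochains *)

Section Extension.
Variables (G : groupType) (X : finType) (ev : X -> G).
Hypotheses (gen : generates_as_monoid ev) (sym : symmetric_image ev).
Hypothesis LI : linear_isoperimetric ev.
Variables (A : zmodType) (act : A -> G -> A).
Hypothesis actP : right_action act.
Local Open Scope ring_scope.
Local Notation wv := (word_value ev).
Local Notation L := (geodesic_language ev).
Local Notation "g ** h" := (g * h)%g (at level 40, left associativity).

Lemma act1 a : act a 1%g = a. Proof. by case: actP. Qed.
Lemma actM a g h : act a (g ** h) = act (act a g) h. Proof. by case: actP. Qed.
Lemma actD a b g : act (a + b) g = act a g + act b g. Proof. by case: actP. Qed.

Lemma act0 g : act 0 g = 0.
Proof. by apply: (addIr (act 0 g)); rewrite -actD !add0r. Qed.

Lemma actN a g : act (- a) g = - act a g.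
Proof. by apply: (addIr (act a g)); rewrite -actD !addNr act0. Qed.

Lemma actMn a g n : act (a *+ n) g = act a g *+ n.
Proof. by elim: n => [|n IH]; rewrite ?mulr0n ?act0 // !mulrS actD IH. Qed.

Lemma actMz a g (n : int) : act (a *~ n) g = act a g *~ n.
Proof. by case: n => n; rewrite ?NegzE ?mulrNz ?actN -!pmulrn actMn. Qed.

Lemma act_sum (I : Type) (r : seq I) (F : I -> A) g :
  act (\sum_(i <- r) F i) g = \sum_(i <- r) act (F i) g.
Proof. by elim: r => [|i r IH]; rewrite ?big_nil ?act0 // !big_cons actD IH. Qed.

Lemma actK a g : act (act a g) g^-1%g = a.
Proof. by rewrite -actM mulgV act1. Qed.

Lemma actVK a g : act (act a g^-1%g) g = a.
Proof. by rewrite -actM mulVg act1. Qed.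

Variable sigma : G -> G -> A.
Hypothesis sigmaP : cocycle2 act sigma.
Hypothesis sigma1 : forall g, sigma 1%g g = 0.

Lemma sigmaC g h k : act (sigma g h) k + sigma (g ** h) k = sigma g (h ** k) + sigma h k.
Proof. exact: sigmaP. Qed.

Lemma sigma_1 g : sigma g 1%g = 0.
Proof.
have := sigmaC g 1%g 1%g; rewrite act1 !mulg1 sigma1 => e.
exact: addrI e.
Qed.

(* The product of the canonical lifts of the letters of [w] to the extension
   defined by [sigma] is [(wv w, wsum w)]. *)
Fixpoint wsum (w : seq X) : A :=
  if w is x :: w' then wsum w' + sigma (ev x) (wv w') else 0.

Lemma wsum_cat u v : wsum (u ++ v) = act (wsum u) (wv v) + wsum v + sigma (wv u) (wv v).
Proof.
elim: u => [|x u IH] /=; first by rewrite wv_nil sigma1 act0 add0r addr0.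
rewrite IH wv_cat wv_cons actD.
have := sigmaC (ev x) (wv u) (wv v) => e.
have -> : sigma (ev x ** wv u) (wv v) = sigma (ev x) (wv u ** wv v) +
   sigma (wv u) (wv v) - act (sigma (ev x) (wv u)) (wv v) by rewrite -e; zmod.
zmod.
Qed.

Section Functionals.
Variables (I : finType) (Xi : I -> A -> int) (dot : I -> G -> I).
Hypothesis XiD : forall i a b, Xi i (a + b) = Xi i a + Xi i b.
Hypothesis Xi_dot : forall i h a, Xi (dot i h) a = Xi i (act a h).
Hypothesis dot1 : forall i, dot i 1%g = i.
Hypothesis dotM : forall i h k, dot (dot i k) h = dot i (h ** k).

Lemma Xi0 i : Xi i 0 = 0.
Proof. by apply: (addIr (Xi i 0)); rewrite -XiD !add0r. Qed.

(** Acting by the inverse of the endpoint brings all values to a common frame, where the fixed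
    functional [Xi i] applies. *)
Definition Xi_form i g x : int := Xi i (act (sigma g (ev x)) (g ** ev x)^-1%g).

Lemma pint_Xi_form i g w : pint ev (Xi_form i) g w =
  Xi i (act (wsum w + sigma g (wv w)) (g ** wv w)^-1%g).
Proof.
elim: w g => [|x w IH] g /=; first by rewrite wv_nil sigma_1 addr0 act0 Xi0.
rewrite IH /Xi_form -XiD wv_cons mulgA; congr (Xi i _).
have -> : act (sigma g (ev x)) (g ** ev x)^-1%g =
    act (act (sigma g (ev x)) (wv w)) (g ** ev x ** wv w)^-1%g.
  by rewrite -actM (invgM (g ** ev x)) mulVKg.
rewrite -actD; congr (act _ _).
have -> : act (sigma g (ev x)) (wv w) = sigma g (ev x ** wv w) +
    sigma (ev x) (wv w) - sigma (g ** ev x) (wv w) by rewrite -sigmaC; zmod.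
zmod.
Qed.

(** Translating a short loop by [g] only replaces [i] by [dot i g^-1]. As the index set is finite,
    short loops give finitely many values, and the isoperimetric inequality applies to [Xi_form]. *)
Lemma loop_bound : exists C : nat, forall i w, wv w = 1%g ->
  `|Xi i (wsum w)| <= C%:Z * (size w)%:Z.
Proof.
have [r [C0 HC]] := LI.
pose B := (\max_(j : I * {bseq r of X}) absz (Xi j.1 (wsum j.2)))%N.
exists (C0 * B)%N => i w w1.
have small g u : (size u <= r)%N -> wv u = 1%g -> `|pint ev (Xi_form i) g u| <= B%:Z.
  move=> ur u1; rewrite pint_Xi_form u1 mulg1 sigma_1 addr0 -Xi_dot.
  have := leq_bigmax (F := fun j : I * {bseq r of X} => absz (Xi j.1 (wsum j.2)))
    (dot i g^-1%g, Bseq ur).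
  by rewrite /= -/B; move: (Xi _ _) B => x B'; lia.
have := HC _ _ small 1%g w w1; rewrite pint_Xi_form w1 sigma_1 addr0 mul1g invg1 act1.
by rewrite PoszM.
Qed.

Let C := projT1 (cid loop_bound).
Let CP : forall i w, wv w = 1%g -> `|Xi i (wsum w)| <= C%:Z * (size w)%:Z :=
  projT2 (cid loop_bound).

Definition score i w : int := Xi i (wsum w) - (C + 1)%N%:Z * (size w)%:Z.

Lemma score_cat i u v : score i (u ++ v) =
  score (dot i (wv v)) u + score i v + Xi i (sigma (wv u) (wv v)).
Proof. by rewrite /score wsum_cat !XiD Xi_dot size_cat PoszD; lra. Qed.

Lemma score_bounded i g : exists m : int, forall w, wv w = g -> score i w <= m.
Proof.
pose u := geo ev g^-1%g; have ug : wv u = g^-1%g by exact: wv_geo.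
exists (C%:Z * (size u)%:Z - Xi (dot i g) (wsum u + sigma g g^-1%g)) => w wg.
have wu1 : wv (w ++ u) = 1%g by rewrite wv_cat wg ug mulgV.
have := CP (dot i g) wu1.
have -> : Xi (dot i g) (wsum (w ++ u)) =
    Xi i (wsum w) + Xi (dot i g) (wsum u + sigma g g^-1%g).
  by rewrite wsum_cat wg ug -addrA [LHS]XiD (Xi_dot i g (act _ _)) actVK.
rewrite /score size_cat !PoszD mulrDr mulrDl mul1r.
have : 0 <= (size w)%:Z by [].
move: (C%:Z * (size w)%:Z) (C%:Z * (size u)%:Z) (Xi _ _) (Xi _ _) => *; lia.
Qed.

Lemma best_word i g : exists w, wv w = g /\ forall v, wv v = g -> score i v <= score i w.
Proof.
have [m mP] := score_bounded i g.
pose P n := `[< exists2 w, wv w = g & absz (m - score i w) = n >].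
have exP : exists n, P n.
  by exists (absz (m - score i (geo ev g))); apply/asboolP; exists (geo ev g) => //; exact: wv_geo.
have [n /asboolP[w wg wn] nmin] := ex_minnP exP.
exists w; split=> // v vg; have := mP v vg; have := mP w wg.
have /nmin : P (absz (m - score i v)) by apply/asboolP; exists v.
by rewrite -wn; lia.
Qed.

Let ow i g : seq X := projT1 (cid (best_word i g)).
Let owP i g : wv (ow i g) = g. Proof. by case: (projT2 (cid (best_word i g))). Qed.
Let ow_max i g v : wv v = g -> score i v <= score i (ow i g).
Proof. by case: (projT2 (cid (best_word i g))) => _; apply. Qed.

(** Both words are closed up by the inverse of [q']. The two loops have lengths [size q + size q']
    and [2 * size q'], whence the coefficients 1 and 3. *)
Lemma wsum_same_value i q q' : wv q = wv q' ->
  Xi i (wsum q) - Xi i (wsum q') <= C%:Z * (size q)%:Z + 3 * (C%:Z * (size q')%:Z).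
Proof.
move=> e; pose v := invw ev q'; pose j := dot i (wv v)^-1%g.
have vE : wv v = (wv q')^-1%g by exact: wv_invw.
have jE a : Xi j (act a (wv v)) = Xi i a by rewrite Xi_dot actK.
have h1 := CP j (_ : wv (q ++ v) = 1%g); have h2 := CP j (_ : wv (q' ++ v) = 1%g).
rewrite wv_cat vE e mulgV in h1; rewrite wv_cat vE mulgV in h2.
have {}h1 := h1 erefl; have {}h2 := h2 erefl.
rewrite wsum_cat e -addrA XiD jE size_cat size_invw PoszD mulrDr in h1.
rewrite wsum_cat -addrA XiD jE size_cat size_invw PoszD mulrDr in h2.
by move: h1 h2; move: (Xi j _) (C%:Z * _) (C%:Z * _) => *; lia.
Qed.

(** Replacing a subword by a geodesic cannot raise the score. The penalty [C + 1] on the length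
    saved therefore stays below the gain allowed by [wsum_same_value], which leaves
    [size q <= (4 * C + 1) * size q']. *)
Lemma best_word_quasi_geodesic i g : quasi_geodesic ev (4 * C + 1) 0 (ow i g).
Proof.
move=> i0 j0 /andP[ij jp]; set p := ow i g in jp *.
pose a := take i0 p; pose q := drop i0 (take j0 p); pose b := drop j0 p.
have tE : take j0 p = a ++ q by rewrite /a -(take_takel p ij) cat_take_drop.
have pE : p = a ++ (q ++ b) by rewrite catA -tE cat_take_drop.
rewrite -/a tE /wdist wv_cat mulKg; pose q' := geo ev (wv q).
have q'E : wv q' = wv q by exact: wv_geo.
have := ow_max i (_ : wv (a ++ (q' ++ b)) = g).
rewrite -/p pE !score_cat !wv_cat q'E -!wv_cat -pE owP => /(_ erefl).
have sq : size q = (j0 - i0)%N by rewrite size_drop size_takel.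
rewrite -sq -[len ev (wv q)]/(size q') addn0.
have := wsum_same_value (dot i (wv b)) (esym q'E).
rewrite /score PoszD => h1 h2.
have h3 : (size q)%:Z <= 4 * (C%:Z * (size q')%:Z) + (size q')%:Z.
  by lra.
by rewrite mulnDl mul1n -mulnA; lia.
Qed.

Definition opt i g : int := score i (ow i g).

Definition opt_tau i g h : int :=
  Xi i (sigma g h) + opt (dot i h) g + opt i h - opt i (g ** h).

Lemma opt_tau_le0 i g h : opt_tau i g h <= 0.
Proof.
have := ow_max i (_ : wv (ow (dot i h) g ++ ow i h) = g ** h).
by rewrite wv_cat !owP => /(_ erefl); rewrite score_cat !owP /opt_tau /opt; lia.
Qed.

Lemma opt_tauM i g h k :
  opt_tau (dot i k) g h + opt_tau i (g ** h) k = opt_tau i g (h ** k) + opt_tau i h k.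
Proof.
have := congr1 (Xi i) (sigmaC g h k).
by rewrite !XiD -Xi_dot /opt_tau dotM mulgA; lra.
Qed.

Lemma opt1 i : opt i 1%g = 0.
Proof.
apply/eqP; rewrite eq_le; apply/andP; split.
  by have := opt_tau_le0 i 1%g 1%g; rewrite /opt_tau sigma1 Xi0 dot1 mulg1; lia.
by have := ow_max i (wv_nil ev); rewrite /score /= Xi0 mulr0 subr0.
Qed.

Lemma opt_tau_1 i g : opt_tau i g 1%g = 0.
Proof. by rewrite /opt_tau sigma_1 Xi0 dot1 opt1 mulg1; lia. Qed.

Lemma opt_tau1_ i g : opt_tau i 1%g g = 0.
Proof. by rewrite /opt_tau sigma1 Xi0 opt1 mul1g; lia. Qed.

(** Cutting a maximiser splits its score into those of the two pieces and a value of [sigma]. The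
    optimal values of the pieces are at least these scores, so the defect at the cut is nonnegative,
    hence 0. *)
Lemma opt_tau_hit : exists N, forall w v b i, L (w ++ v) -> (size b <= 1)%N ->
  exists2 u, (len ev u <= N)%N &
    opt_tau i (wv w ** u) (u^-1%g ** (wv v ** wv b)) = 0.
Proof.
have [N HN] := quasi_geodesic_hits gen sym LI (4 * C + 1).
exists N => w v b i Lwv sb; pose h := wv w ** (wv v ** wv b).
have [||k kp d] := HN w v b (ow i h) Lwv sb.
- by rewrite owP /h mulgA.
- exact: best_word_quasi_geodesic.
exists ((wv w)^-1%g ** wv (take k (ow i h))) => //.
pose a := take k (ow i h); pose b' := drop k (ow i h).
have hE : h = wv a ** wv b' by rewrite -wv_cat cat_take_drop owP.
rewrite mulVKg invgM invgK -mulgA -/h -/a [X in _ ** X]hE mulKg.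
apply/eqP; rewrite eq_le opt_tau_le0 /= /opt_tau -hE.
have -> : opt i h = score i (a ++ b') by rewrite cat_take_drop.
rewrite score_cat; have := ow_max (dot i (wv b')) (erefl (wv a)).
by have := ow_max i (erefl (wv b')); rewrite /opt; lia.
Qed.

(** Multiplying by [h] and then by its inverse gives two nonpositive values whose sum takes finitely
    many values, so neither can be very negative. *)
Lemma opt_tau_bounded h : exists m : nat, forall i g,
  `|opt_tau i g h| <= m%:Z /\ `|opt_tau i h g| <= m%:Z.
Proof.
pose F h' := (\max_(i : I) absz (opt_tau i h' h'^-1%g))%N.
exists (F h + F h^-1%g)%N => i g.
have FP i' h' : `|opt_tau i' h' h'^-1%g| <= (F h')%:Z.
  have := leq_bigmax (F := fun i => absz (opt_tau i h' h'^-1%g)) i'.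
  by rewrite -/(F h'); move: (opt_tau _ _ _) => t; lia.
split.
  have := opt_tauM (dot i h) g h h^-1%g.
  rewrite dotM mulVg dot1 mulgV opt_tau_1.
  have := opt_tau_le0 (dot i h) (g ** h) h^-1%g; have := opt_tau_le0 i g h.
  by have := FP (dot i h) h; rewrite PoszD; lia.
have := opt_tauM i h^-1%g h g; rewrite mulVg opt_tau1_.
have := opt_tau_le0 i h^-1%g (h ** g); have := opt_tau_le0 i h g.
by have := FP (dot i g) h^-1%g; rewrite invgK PoszD; lia.
Qed.

Theorem optimal_cocycle : exists c : I -> G -> int,
  let tau i g h := Xi i (sigma g h) + c (dot i h) g + c i h - c i (g ** h) in
  (forall i x, finite_state ev (fun g => tau i g (ev x))) /\
  (forall h, exists m : nat, forall i g, `|tau i g h| <= m%:Z /\ `|tau i h g| <= m%:Z).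
Proof.
exists opt; split; last exact: opt_tau_bounded.
have [N HN] := opt_tau_hit.
apply: (finite_state_tau gen sym LI opt_tau_le0 opt_tauM _ HN) => h.
have [m mP] := opt_tau_bounded h; exists m => i g.
by have [] := mP i g; lia.
Qed.

End Functionals.

End Extension.

Section CocycleShift.
Variables (G : groupType) (A : zmodType) (act : A -> G -> A).
Hypothesis actP : right_action act.
Local Open Scope ring_scope.

Lemma cocycle_add_coboundary (sigma : G -> G -> A) (c : G -> A) : cocycle2 act sigma ->
  cocycle2 act (fun g h => sigma g h + act (c g) h + c h - c (g * h)%g).
Proof.
move=> sigmaP g h k; rewrite !(actD actP) (actN actP) (actM actP) mulgA.
have -> : sigma g (h * k)%g = act (sigma g h) k + sigma (g * h)%g k - sigma h k.
  by rewrite (sigmaC sigmaP); zmod.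
zmod.
Qed.

End CocycleShift.

(** * Canonical geodesics *)

Section Tree.
Variables (G : groupType) (X : finType) (ev : X -> G).
Hypotheses (gen : generates_as_monoid ev) (sym : symmetric_image ev).
Hypothesis LI : linear_isoperimetric ev.
Local Open Scope group_scope.
Local Notation wv := (word_value ev).
Local Notation L := (geodesic_language ev).
Local Notation len := (len ev).

(* Equal group elements may reach [lia] through different structure paths; [set]
   identifies them. *)
Ltac len_lia :=
  repeat match goal with
  | H : is_true (leq _ _) |- _ => move: H
  | H : @eq nat _ _ |- _ => move: H
  end;
  repeat match goal with
  | |- context [len ?g] => let n := fresh in set n := (len g); clearbody n
  end; lia.

Definition last_letter (g : G) : option X := [pick x | (len (g * (ev x)^-1) < len g)%N].

Fixpoint canonical_rec n (g : G) : seq X :=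
  if n is n'.+1 then
    if last_letter g is Some x then rcons (canonical_rec n' (g * (ev x)^-1)) x else [::]
  else [::].

(** The last letter depends only on the element, so canonical words are closed under prefixes and
    form a spanning tree of the Cayley graph. *)
Definition canonical g := canonical_rec (len g) g.

Lemma len_mul_ev g x : (len g <= (len (g * (ev x)^-1)).+1)%N.
Proof.
have := lenM gen (g * (ev x)^-1) (ev x); have := len_ev gen x.
by rewrite mulgVK; lia.
Qed.

Lemma canonicalE g : canonical g =
  if last_letter g is Some x then rcons (canonical (g * (ev x)^-1)) x else [::].
Proof.
rewrite /canonical; case E: (len g) => [|n] /=.
  by rewrite /last_letter; case: pickP => // x; rewrite E.
move: E; rewrite /last_letter; case: pickP => // x + E.
by have := len_mul_ev g x; rewrite E !ltnS => h1 h2; have -> : len (g * (ev x)^-1) = n by lia.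
Qed.

Lemma last_letter_some g : g != 1 -> exists2 x, last_letter g = Some x &
  (len (g * (ev x)^-1) < len g)%N.
Proof.
move=> g1; rewrite /last_letter; case: pickP => [x ?|none]; first by exists x.
case/lastP E: (geo ev g) => [|w x].
  by have := wv_geo gen g; rewrite E wv_nil => e; rewrite -e eqxx in g1.
have lg : len g = (size w).+1 by rewrite -(size_rcons w x) -E.
have gE : g * (ev x)^-1 = wv w by rewrite -{1}(wv_geo gen g) E wv_rcons mulgK.
by have := none x; rewrite gE lg ltnS (len_wv gen w).
Qed.

Lemma canonical_wv g : wv (canonical g) = g.
Proof.
move En : (len g) => n; elim: n g En => [|n IH] g En.
  by have := len_eq0 gen En => ->; rewrite canonicalE /last_letter len1 //;
    case: pickP => //; rewrite wv_nil.
have [|x lx xlt] := @last_letter_some g.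
  by apply: contra_eq_neq En => ->; rewrite (len1 gen).
have := len_mul_ev g x; rewrite canonicalE lx wv_rcons => h.
by rewrite IH ?mulgVK //; len_lia.
Qed.

Definition all_hit N (g t : G) : Prop :=
  forall p, L p -> wv p = g * t -> hits ev N g p.

Section Pair.
Variables (N : nat) (g1 g2 : G).
Hypothesis same : same_len_type ev N g1 g2.

Lemma all_hit_step g t x : all_hit N g t -> (N < len t)%N ->
  (len (g * t * (ev x)^-1) < len (g * t))%N -> all_hit N g (t * (ev x)^-1).
Proof.
move=> H tN lx p Lp pE.
have Lpx : L (rcons p x).
  apply/(geodesicP gen); rewrite size_rcons wv_rcons pE mulgA mulgVK.
  have := len_mul_ev (g * t) x; move: Lp => /(geodesicP gen) ->.
  by rewrite pE mulgA; len_lia.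
have [|k] := H _ Lpx; first by rewrite wv_rcons pE mulgA mulgVK.
rewrite size_rcons leq_eqVlt => /predU1P[->|].
  rewrite -(size_rcons p x) take_size wv_rcons pE -mulgA mulgVK mulKg => h.
  by move: tN; rewrite ltnNge h.
rewrite ltnS => kp; rewrite -cats1 takel_cat // => d; by exists k.
Qed.

(** A geodesic to [ga * t] is cut near [ga]; its tail, started near [gb], shows that the length
    gained by [t] after [gb] is no larger than after [ga]. By symmetry equal types give equal gains,
    and the shortening letters agree. *)
Lemma all_hit_len ga gb t : same_len_type ev N ga gb -> all_hit N ga t ->
  (len (gb * t) + len ga <= len (ga * t) + len gb)%N.
Proof.
move=> e H; have [u uN t0] := hits_len_tau gen (@geo_geodesic _ _ _ gen _)
  (wv_geo gen _) (H _ (@geo_geodesic _ _ _ gen _) (wv_geo gen _)).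
have := e u uN; have := lenM gen (gb * u) (u^-1 * t).
move: t0; rewrite /len_tau -!mulgA !mulVKg; len_lia.
Qed.

Lemma last_letter_same t : all_hit N g1 t -> all_hit N g2 t -> (N < len t)%N ->
  last_letter (g1 * t) = last_letter (g2 * t).
Proof.
move=> H1 H2 tN; apply: eq_pick => x.
have same' : same_len_type ev N g2 g1 by move=> u /same.
have e1 := all_hit_len same H1; have e2 := all_hit_len same' H2.
apply/idP/idP => lx.
  have := all_hit_len same (all_hit_step H1 tN lx); rewrite !mulgA; len_lia.
have := all_hit_len same' (all_hit_step H2 tN lx); rewrite !mulgA; len_lia.
Qed.

Lemma canonical_common_suffix t : all_hit N g1 t -> all_hit N g2 t ->
  exists u y, [/\ (len u <= N)%N, t = u * wv y,
    canonical (g1 * t) = canonical (g1 * u) ++ y &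
    canonical (g2 * t) = canonical (g2 * u) ++ y].
Proof.
move En : (len (g1 * t)) => n; elim: n t En => [|n IH] t En H1 H2.
  (* At the root the only geodesic is empty, so the hit says that [g1] itself, hence [t], has length
     at most [N]. *)
  have t1 : t = g1^-1 by apply: (mulgI g1); rewrite mulgV; exact: len_eq0 En.
  have [||k _] := H1 [::]; first by apply/(geodesicP gen); rewrite wv_nil len1.
    by rewrite t1 mulgV wv_nil.
  rewrite take_oversize // wv_nil mulg1 -t1 => tN.
  by exists t, [::]; rewrite wv_nil mulg1 !cats0.
have [tN|tN] := leqP (len t) N.
  by exists t, [::]; rewrite wv_nil mulg1 !cats0.
have [|x lx xlt] := @last_letter_some (g1 * t).
  by apply: contra_eq_neq En => ->; rewrite (len1 gen).
have lx2 := last_letter_same H1 H2 tN; rewrite lx in lx2.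
have xlt2 : (len (g2 * t * (ev x)^-1) < len (g2 * t))%N.
  by move: lx2; rewrite /last_letter; case: pickP => // y hy [->].
have [|u [y [uN tE c1 c2]]] := IH (t * (ev x)^-1) _ (all_hit_step H1 tN xlt) (all_hit_step H2 tN xlt2).
  by have := len_mul_ev (g1 * t) x; rewrite mulgA; len_lia.
exists u, (rcons y x); split=> //.
- by rewrite wv_rcons mulgA -tE mulgVK.
- by rewrite canonicalE lx -mulgA c1 rcons_cat.
- by rewrite canonicalE -lx2 -mulgA c2 rcons_cat.
Qed.

End Pair.

Lemma canonical_determined : exists N, forall w1 w2 v b,
  same_len_type ev N (wv w1) (wv w2) -> L (w1 ++ v) -> L (w2 ++ v) -> (size b <= 1)%N ->
  exists u y, [/\ (len u <= N)%N, wv v * wv b = u * wv y,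
    canonical (wv w1 * (wv v * wv b)) = canonical (wv w1 * u) ++ y &
    canonical (wv w2 * (wv v * wv b)) = canonical (wv w2 * u) ++ y].
Proof.
have [N HN] := quasi_geodesic_hits gen sym LI 1; exists N => w1 w2 v b same L1 L2 sb.
have hit w : L (w ++ v) -> all_hit N (wv w) (wv v * wv b).
  move=> Lw p Lp pE; apply: (HN w v b) => //; first by rewrite -mulgA.
  exact: geodesic_quasi_geodesic.
exact: canonical_common_suffix same _ (hit _ L1) (hit _ L2).
Qed.

Variables (A : zmodType) (act : A -> G -> A).
Hypothesis actP : right_action act.
Variable sigma : G -> G -> A.
Hypothesis sigmaP : cocycle2 act sigma.
Hypothesis sigma1 : forall g, sigma 1 g = 0%R.

(** The second coordinate, in the extension, of the lift of [g] along its canonical word;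
    subtracting it amounts to a change of section. *)
Definition tree_cochain g : A := wsum ev sigma (canonical g).

Definition tree_cocycle g h : A :=
  (sigma g h + act (tree_cochain g) h + tree_cochain h - tree_cochain (g * h))%R.

Lemma tree_cochain1 : tree_cochain 1 = 0%R.
Proof.
rewrite /tree_cochain canonicalE /last_letter; case: pickP => //= x.
by rewrite len1.
Qed.

Lemma tree_cocycleM g h k :
  (act (tree_cocycle g h) k + tree_cocycle (g * h) k =
   tree_cocycle g (h * k) + tree_cocycle h k)%R.
Proof. exact: (cocycle_add_coboundary actP tree_cochain sigmaP). Qed.

Lemma tree_cocycle_suffix g h y : wv y = h -> canonical (g * h) = canonical g ++ y ->
  tree_cocycle g h = (tree_cochain h - wsum ev sigma y)%R.
Proof.
move=> yh e; rewrite /tree_cocycle /tree_cochain e (wsum_cat _ actP sigmaP sigma1).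
by rewrite canonical_wv yh; zmod.
Qed.

Variables (V : eqType) (red : A -> V) (reds : seq V).
Hypothesis red_in : forall a, red a \in reds.
Hypothesis redD : forall a a' b b', red a = red a' -> red b = red b' ->
  red (a + b)%R = red (a' + b')%R.
Hypothesis redN : forall a a', red a = red a' -> red (- a)%R = red (- a')%R.
Hypothesis red_act : forall a a' g, red a = red a' -> red (act a g) = red (act a' g).

(** Up to terms independent of the prefix, the value is a translate of one on the ball, by the
    common suffix. Reduction is needed for the values on the ball to form a finite table, since [A]
    may be infinite. *)
Theorem finite_state_tree_cocycle x :
  finite_state ev (fun g => red (tree_cocycle g (ev x))).
Proof.
have [N HN] := canonical_determined.
have [Q0 [c0 c0P]] := cone_code gen sym LI.
have [||Q1 [c1 c1P]] := @tau_code G X ev gen unit (fun=> len_tau ev) _ _ N.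
- by move=> _; exact: len_tau_le0.
- by move=> h; have [m mP] := len_tau_bounded gen sym h; exists m.
have [|Q2 [c2 c2P]] := @table_code (seq X) {bseq N of X} V
  (fun w u => red (tree_cocycle (wv w) (wv u))) reds.
  by move=> w u; exact: red_in.
exists (Q0 * Q1 * Q2)%type, (fun w => (c0 w, c1 w, c2 w)) => w1 w2 [e0 e1 e2] v L1.
have L2 := c0P _ _ e0 v L1; split=> //.
have same : same_len_type ev N (wv w1) (wv w2) by move=> u uN; exact: (c1P _ _ e1 tt).
have red2 u : (len u <= N)%N -> red (tree_cocycle (wv w1) u) = red (tree_cocycle (wv w2) u).
  move=> uN; have := c2P _ _ e2 (Bseq (uN : (size (geo ev u) <= N)%N)).
  by rewrite /= (wv_geo gen).
have main b : (size b <= 1)%N ->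
    red (tree_cocycle (wv w1) (wv v * wv b)) = red (tree_cocycle (wv w2) (wv v * wv b)).
  move=> sb; have [u [y [uN hE k1 k2]]] := HN w1 w2 v b same L1 L2 sb.
  have expand g : canonical (g * (wv v * wv b)) = canonical (g * u) ++ y ->
      tree_cocycle g (wv v * wv b) = (act (tree_cocycle g u) (wv y) +
        (tree_cochain (wv y) - wsum ev sigma y - tree_cocycle u (wv y)))%R.
    rewrite hE mulgA => /(tree_cocycle_suffix (erefl _)) <-.
    rewrite -[LHS](addrK (tree_cocycle u (wv y))) -tree_cocycleM; zmod.
  by rewrite (expand _ k1) (expand _ k2); apply: redD => //; apply: red_act; exact: red2.
have step g : tree_cocycle (g * wv v) (ev x) =
    (tree_cocycle g (wv v * ev x) + tree_cocycle (wv v) (ev x)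
      + act (- tree_cocycle g (wv v)) (ev x))%R.
  by rewrite (actN actP) -tree_cocycleM; zmod.
have m1 := main [::] isT; have m2 := main [:: x] isT.
rewrite wv_cons wv_nil mulg1 in m2; rewrite wv_nil mulg1 in m1.
rewrite !wv_cat !step; apply: redD; first exact: redD.
by apply: red_act; exact: redN.
Qed.

End Tree.

(** * Finitely generated coefficients *)

Section FinitelyGenerated.
Variable A : zmodType.
Hypothesis fgA : finitely_generated_abelian A.
Local Open Scope ring_scope.

(* [A] is virtually free: up to the factor [m], the [xi j] are coordinates with
   respect to a maximal independent family of generators. *)
Lemma virtual_coordinates : exists (m n : nat) (e : 'I_n -> A) (xi : 'I_n -> A -> int),
  [/\ (0 < m)%N, forall j a b, xi j (a + b) = xi j a + xi j b &
    forall a, a *+ m = \sum_j e j *~ xi j a].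
Proof.
have [n [s sP]] := fgA; pose e (j : 'I_n) := s`_j.
pose comb (c : 'I_n -> int) := \sum_j e j *~ c j.
pose supported (D : {set 'I_n}) (c : 'I_n -> int) := forall j, j \notin D -> c j = 0.
pose indep D := `[< forall c, supported D c -> comb c = 0 -> forall j, c j = 0 >].
have combD c d : comb (fun j => c j + d j) = comb c + comb d.
  by rewrite /comb -big_split; apply: eq_bigr => j _; rewrite mulrzDr.
have combZ c k : comb (fun j => c j * k) = comb c *~ k.
  by rewrite /comb mulrz_suml; apply: eq_bigr => j _; rewrite mulrzA.
have indep0 : indep (finset.set0 : {set 'I_n}).
  by apply/asboolP => c c0 _ j; rewrite c0 ?inE.
pose D := [arg max_(D > (finset.set0 : {set 'I_n}) | indep D) #|D|].
have [indD Dmax] : indep D /\ forall D', indep D' -> (#|D'| <= #|D|)%N.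
  by rewrite /D; case: arg_maxnP.
pose span a := exists2 c, supported D c & a = comb c.
have spanZ a k : span a -> span (a *~ k).
  move=> [c cD ->]; exists (fun j => c j * k); last by rewrite combZ.
  by move=> j /cD ->; rewrite mul0r.
have spanD a b : span a -> span b -> span (a + b).
  move=> [c cD ->] [d dD ->]; exists (fun j => c j + d j); last by rewrite combD.
  by move=> j jD; rewrite cD ?dD.
have span_e i : exists2 k : nat, (0 < k)%N & span (e i *+ k).
  have [iD|iD] := boolP (i \in D).
    exists 1%N => //; exists (fun j => (j == i)%:Z).
      by move=> j jD; case: eqP => // ji; move: jD; rewrite ji iD.
    rewrite /comb (bigD1 i) //= eqxx mulr1z mulr1n big1 ?addr0 // => j /negPf ->.
    by rewrite mulr0z.
  have : ~~ indep (i |: D).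
    by apply/negP => /Dmax; rewrite cardsU1 iD ltnn.
  move=> /asboolPn /existsNP[c /not_implyP[cD /not_implyP[c0 /existsNP[l cl]]]].
  have ci : c i != 0.
    apply/eqP => ci0; apply: cl; have /asboolP := indD; apply => // j jD.
    have [->|ji] := eqVneq j i; first exact: ci0.
    by apply: cD; rewrite !inE negb_or ji.
  have spi : span (e i *~ c i).
    exists (fun j => if j == i then 0 else - c j).
      move=> j jD; case: ifP => // /negbT ji.
      by rewrite cD ?oppr0 // !inE negb_or ji.
    move: c0; rewrite /comb (bigD1 i) //= => /eqP; rewrite addr_eq0 => /eqP ->.
    rewrite [RHS](bigD1 i) //= eqxx mulr0z add0r -sumrN.
    by apply: eq_bigr => j /negPf ->; rewrite mulrNz.
  exists (absz (c i)); first by rewrite absz_gt0.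
  have := spanZ _ (sgz (c i)) spi; rewrite -mulrzA mulrC -abszEsg.
  by rewrite pmulrn.
have /boolp.choice[k kP] : forall i, exists k : nat, (0 < k)%N /\ span (e i *+ k).
  by move=> i; have [k ? ?] := span_e i; exists k.
pose m := (\prod_i k i)%N.
have m_gt0 : (0 < m)%N by rewrite prodn_gt0 // => i; case: (kP i).
have span_m a : span (a *+ m).
  have [c ->] := sP a; rewrite -sumrMnl.
  apply: (big_ind span) => //; first by exists (fun=> 0); rewrite // /comb big1 // => j _; rewrite mulr0z.
  move=> i _; rewrite pmulrn -mulrzA mulrC mulrzA -pmulrn; apply: (spanZ _ _).
  rewrite /m (bigD1 i) //= mulnC mulrnA; set q := (\prod_(_ | _) _)%N.
  have [_ sp] := kP i; rewrite -mulrnA mulnC mulrnA pmulrn.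
  exact: spanZ.
have /boolp.choice[xi xiP] : forall a, exists c, supported D c /\ a *+ m = comb c.
  by move=> a; have [c ? ?] := span_m a; exists c.
exists m, n, e, (fun j a => xi a j); split=> // [j a b|a]; last by case: (xiP a).
have [ca ea] := xiP a; have [cb eb] := xiP b; have [cab eab] := xiP (a + b).
have /asboolP/(_ (fun l => xi (a + b) l + (xi a l + xi b l) * -1)) := indD.
rewrite combD combZ combD -ea -eb -eab mulrnDl mulrN1z subrr => /(_ _ (erefl _) j) h.
apply/eqP; rewrite -subr_eq0 -mulrN1; apply/eqP/h => l lD.
by rewrite ca // cb // cab // addr0 mul0r.
Qed.

(** Choosing representatives of [A / M A] in a finite list turns congruence into equality of [red],
    the form that finite tables require. *)
Lemma residues (M : nat) : (0 < M)%N -> exists (D : seq A) (red : A -> A),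
  [/\ forall a, red a \in D, forall a, exists c, a - red a = c *+ M &
    forall a b, red a = red b <-> exists c, a - b = c *+ M].
Proof.
move=> M_gt0; have [n [s sP]] := fgA.
pose D := [seq \sum_(i < n) s`_i *~ (c i)%:Z | c : {ffun 'I_n -> 'I_M}].
pose eqm (a b : A) := `[< exists c, a - b = c *+ M >].
have eqm_trans a b c : eqm a b -> eqm b c -> eqm a c.
  move=> /asboolP[x ex] /asboolP[y ey]; apply/asboolP; exists (x + y).
  by rewrite mulrnDl -ex -ey; zmod.
have eqm_sym a b : eqm a b -> eqm b a.
  by move=> /asboolP[x ex]; apply/asboolP; exists (- x); rewrite mulNrn -ex; zmod.
have hasD a : has (eqm a) D.
  apply/hasP; have [c ->] := sP a.
  pose d : {ffun 'I_n -> 'I_M} := [ffun i => Ordinal (ltn_pmod (absz ((c i) %% M%:Z)%Z) M_gt0)].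
  exists (\sum_(i < n) s`_i *~ (d i)%:Z).
    by apply/mapP; exists d; rewrite ?mem_enum.
  apply/asboolP; exists (\sum_(i < n) s`_i *~ ((c i) %/ M%:Z)%Z).
  rewrite -sumrMnl -sumrB; apply: eq_bigr => i _; rewrite ffunE /=.
  rewrite pmulrn -mulrzA -mulrzBr; congr (_ *~ _).
  have h : 0 <= ((c i) %% M%:Z)%Z < M%:Z.
    by rewrite modz_ge0 ?ltz_pmod // -?lt0n; lia.
  have := divz_eq (c i) M%:Z; rewrite modn_small; lia.
exists D, (fun a => nth 0 D (find (eqm a) D)); split.
- by move=> a; rewrite mem_nth // -has_find.
- by move=> a; have := nth_find 0 (hasD a) => /asboolP.
- move=> a b; split=> [e|h].
    have h1 := nth_find 0 (hasD a); have h2 := nth_find 0 (hasD b).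
    by apply/asboolP/(eqm_trans _ _ _ h1); rewrite e; exact: eqm_sym.
  have ab : eqm a b by exact/asboolP.
  rewrite (@eq_find _ (eqm a) (eqm b)) // => d.
  by apply/idP/idP; apply: eqm_trans => //; exact: eqm_sym.
Qed.

End FinitelyGenerated.

Section FiniteAction.
Variables (G : groupType) (A : zmodType) (act : A -> G -> A).
Hypotheses (actP : right_action act) (finP : finite_action act).
Local Open Scope group_scope.

Lemma action_representatives : exists (k : nat) (r : 'I_k -> G) (rep : G -> 'I_k),
  [/\ forall g a, act a (r (rep g)) = act a g,
    forall i, rep (r i) = i &
    forall g h, (forall a, act a g = act a h) -> rep g = rep h].
Proof.
have [s sE] := iffLR (finite_seqP _) finP.
pose s' := undup s; pose F g : A -> A := fun a => act a g.
have Fs g : F g \in s'.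
  rewrite mem_undup; have : [set` s]%classic (F g) by rewrite -sE; exists g.
  by [].
have sF f : f \in s' -> exists g, F g = f.
  rewrite mem_undup => fs; have : [set` s]%classic f by [].
  by rewrite -sE => -[g _ <-]; exists g.
have /boolp.choice[r rP] : forall i : 'I_(size s'), exists g, F g = nth id s' i.
  by move=> i; apply: sF; exact: mem_nth.
have ix g : (index (F g) s' < size s')%N by rewrite index_mem.
exists (size s'), r, (fun g => Ordinal (ix g)); split.
- by move=> g a; rewrite -[LHS]/(F _ a) rP /= nth_index.
- by move=> i; apply: val_inj; rewrite /= rP index_uniq // undup_uniq.
- by move=> g h e; apply: val_inj; rewrite /=; congr index; exact/funext.
Qed.

End FiniteAction.

Section FiniteValues.
Variables (G : groupType) (X : finType) (ev : X -> G).
Hypothesis gen : generates_as_monoid ev.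
Local Open Scope group_scope.
Local Notation wv := (word_value ev).

Lemma finite_state_determined (V W : Type) (h : G -> V) (f : G -> W) :
  (forall g g', h g = h g' -> f g = f g') -> finite_state ev h -> finite_state ev f.
Proof.
move=> hf [Q [ty H]]; exists Q, ty => w1 w2 e v L1.
by have [L2 /hf] := H _ _ e v L1.
Qed.

(** The current value is itself made part of the state: it takes finitely many values, and its
    update depends only on itself and on finite-state data. *)
Lemma finite_state_recursive (V : eqType) (W : Type) (s : seq V) (h : X -> G -> W) (f : G -> V) :
  finite_state ev (fun=> tt) -> (forall x, finite_state ev (h x)) -> (forall g, f g \in s) ->
  (forall x g g', f g = f g' -> h x g = h x g' -> f (g * ev x) = f (g' * ev x)) ->
  finite_state ev f.
Proof.
move=> fs0 fsh fs_f step; have [Q [ty H]] := finite_state_family fs0 fsh.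
have [Q' [code codeP]] := @table_code G unit V (fun g _ => f g) s (fun g _ => fs_f g).
exists (Q * Q')%type, (fun w => (ty w, code (wv w))) => w1 w2 [e e'] v L1.
have [L2 _] := H _ _ e v L1; split=> //.
elim/last_ind: v L1 {L2} => [|v x IH] L1; first by rewrite !cats0; exact: (codeP _ _ e' tt).
rewrite -!rcons_cat !wv_rcons; move: L1; rewrite -rcons_cat -cats1 => /(geodesic_cat gen)[L1 _].
have [_ eh] := H _ _ e v L1; apply: step; first exact: IH.
exact: (congr1 (fun F => F x) eh).
Qed.

Definition finitely_valued (V : Type) (f : G -> V) : Prop :=
  exists (Q : finType) (code : G -> Q), forall g g', code g = code g' -> f g = f g'.

Lemma finitely_valued_determined (V W : Type) (h : G -> V) (f : G -> W) :
  (forall g g', h g = h g' -> f g = f g') -> finitely_valued h -> finitely_valued f.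
Proof. by move=> hf [Q [code codeP]]; exists Q, code => g g' /codeP /hf. Qed.

Lemma finitely_valued_pair (V W : Type) (f : G -> V) (f' : G -> W) :
  finitely_valued f -> finitely_valued f' -> finitely_valued (fun g => (f g, f' g)).
Proof.
move=> [Q [code codeP]] [Q' [code' codeP']].
exists (Q * Q')%type, (fun g => (code g, code' g)) => g g' [e e'].
by rewrite (codeP _ _ e) (codeP' _ _ e').
Qed.

Lemma finitely_valued_in (V : eqType) (f : G -> V) (s : seq V) :
  (forall g, f g \in s) -> finitely_valued f.
Proof.
move=> fs; have [Q [code codeP]] := @table_code G unit V (fun g _ => f g) s (fun g _ => fs g).
by exists Q, code => g g' e; exact: (codeP _ _ e tt).
Qed.

Lemma finite_state_finitely_valued (V : Type) (f : G -> V) :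
  finite_state ev f -> finitely_valued f.
Proof.
move=> [Q [ty H]]; exists Q, (fun g => ty (geo ev g)) => g g' e.
have := H _ _ e [::]; rewrite !cats0 !wv_geo //.
by case=> //; exact: (@geo_geodesic _ _ _ gen _).
Qed.

Lemma finite_set_finitely_valued (V : Type) (f : G -> X -> V) :
  (forall x, finitely_valued (f^~ x)) -> finite_set [set v | exists g x, v = f g x].
Proof.
move=> fin; have /boolp.choice[Q HQ] : forall x, exists Q : finType, exists code : G -> Q,
    forall g g', code g = code g' -> f g x = f g' x by move=> x; exact: fin.
have cP x := projT2 (cid (HQ x)); set c := (fun x => projT1 (cid (HQ x))) in cP.
pose F (p : {x : X & Q x}) := f (xget 1 [set g | c (tag p) g = tagged p]) (tag p).
apply: (@sub_finite_set _ _ (range F)); last by apply: finite_image; exact: finite_finset.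
move=> _ [g [x ->]]; exists (Tagged Q (c x g)) => //; rewrite /F /=.
by apply: cP; case: xgetP => [h _ //|/(_ g)]; case.
Qed.

End FiniteValues.

Section Coordinates.
Variables (G : groupType) (A : zmodType) (act : A -> G -> A).
Hypotheses (actP : right_action act) (finP : finite_action act).
Hypothesis fgA : finitely_generated_abelian A.
Local Open Scope ring_scope.

Record equivariant_coordinates (m : nat) (I : finType) (e : I -> A) (Xi : I -> A -> int)
    (dot : I -> G -> I) : Prop := EquivariantCoordinates {
  ecD : forall i a b, Xi i (a + b) = Xi i a + Xi i b;
  ec_act : forall i h a, Xi (dot i h) a = Xi i (act a h);
  ec1 : forall i, dot i 1%g = i;
  ecM : forall i h k, dot (dot i k) h = dot i (h * k)%g;
  ec_dot : forall i h, e (dot i h) = act (e i) h^-1%g;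
  ec_sum : forall a, a *+ m = \sum_i e i *~ Xi i a }.

(* Averaging non-equivariant coordinates over the finite image of [G]. *)
Lemma equivariant_coordinates_exist : exists (m : nat) (I : finType) (e : I -> A)
  (Xi : I -> A -> int) (dot : I -> G -> I), (0 < m)%N /\ equivariant_coordinates m e Xi dot.
Proof.
have [m [n [e [xi [m0 xiD xiE]]]]] := virtual_coordinates fgA.
have [k [r [rep [act_rep repK repE]]]] := action_representatives finP.
have act_repV a g : act a (r (rep g))^-1%g = act a g^-1%g.
  by rewrite -[RHS](actK actP _ (r (rep g))) act_rep (actVK actP).
have k_gt0 : (0 < k)%N by case: (k) (rep 1%g) => [[]|].
exists (m * k)%N, ('I_k * 'I_n)%type, (fun i => act (e i.2) (r i.1)^-1%g).
exists (fun i a => xi i.2 (act a (r i.1))), (fun i h => (rep (h * r i.1)%g, i.2)).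
split; first by rewrite muln_gt0 m0.
split=> /= [i a b|i h a|[f j]|[f j] h l|i h|a] /=.
- by rewrite (actD actP) xiD.
- by rewrite act_rep (actM actP).
- by rewrite mul1g repK.
- congr pair; apply: repE => a.
  by rewrite (actM actP) act_rep !(actM actP).
- by rewrite act_repV invgM (actM actP).
rewrite -(pair_bigA _ (fun f j => act (e j) (r f)^-1%g *~ xi j (act a (r f)))) /=.
rewrite (eq_bigr (fun=> a *+ m)) ?sumr_const ?card_ord ?mulrnA // => f _.
rewrite -[in RHS](actK actP a (r f)) -(actMn actP) xiE (act_sum actP).
by apply: eq_bigr => j _; rewrite (actMz actP).
Qed.

End Coordinates.

(** * Regular representatives *)

Section Congruence.
Variables (A : zmodType) (M : nat) (red : A -> A).
Hypothesis redP : forall a b, red a = red b <-> exists c, (a - b = c *+ M)%R.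
Local Open Scope ring_scope.

Lemma red_add a a' b b' : red a = red a' -> red b = red b' -> red (a + b) = red (a' + b').
Proof.
move=> /redP[x ex] /redP[y ey]; apply/redP; exists (x + y).
by rewrite mulrnDl -ex -ey; zmod.
Qed.

Lemma red_opp a a' : red a = red a' -> red (- a) = red (- a').
Proof. by move=> /redP[x ex]; apply/redP; exists (- x); rewrite mulNrn -ex; zmod. Qed.

Lemma red_act (G : groupType) (act : A -> G -> A) a a' g : right_action act ->
  red a = red a' -> red (act a g) = red (act a' g).
Proof.
move=> actP /redP[x ex]; apply/redP; exists (act x g).
by rewrite -(actMn actP) -ex (actD actP) (actN actP).
Qed.

End Congruence.

Section Regular.
Variables (G : groupType) (X : finType) (ev : X -> G).
Hypotheses (gen : generates_as_monoid ev) (sym : symmetric_image ev).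
Hypothesis LI : linear_isoperimetric ev.
Variables (A : zmodType) (act : A -> G -> A).
Hypotheses (actP : right_action act) (finP : finite_action act).
Hypothesis fgA : finitely_generated_abelian A.
Local Open Scope ring_scope.
Local Notation L := (geodesic_language ev).
Local Notation fs := (finite_state ev).

Section Refined.
Variables (m : nat) (I : finType) (e : I -> A) (Xi : I -> A -> int) (dot : I -> G -> I).
Hypotheses (m_gt0 : (0 < m)%N) (ec : equivariant_coordinates act m e Xi dot).

Lemma Xi_mulrn i a n : Xi i (a *+ n) = Xi i a *+ n.
Proof.
elim: n => [|n IH]; last by rewrite !mulrS (ecD ec) IH.
by rewrite !mulr0n; exact: (Xi0 (ecD ec)).
Qed.

Variables (D1 : seq A) (red1 : A -> A).
Hypotheses (red1_in : forall a, red1 a \in D1)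
  (red1P : forall a b, red1 a = red1 b <-> exists c, a - b = c *+ m).

(* The torsion of [A] is killed by [m], so it meets [m A] trivially. *)
Lemma mulrn_red1_inj a b : a *+ m = b *+ m -> red1 a = red1 b -> a = b.
Proof.
move=> abm /red1P[x ex]; apply/eqP; rewrite -subr_eq0 ex (ec_sum ec).
rewrite big1 // => i _; suff -> : Xi i x = 0 by rewrite mulr0z.
have : Xi i (x *+ m *+ m) = 0.
  by rewrite -ex mulrnBl abm subrr; exact: (Xi0 (ecD ec)).
rewrite !Xi_mulrn => /eqP; rewrite !mulrn_eq0; by case: m m_gt0 => //= ? _ /eqP.
Qed.

Variable sigma : G -> G -> A.
Hypotheses (sigmaP : cocycle2 act sigma)
  (sigma_fs : forall x, fs (fun g => red1 (sigma g (ev x)))).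
Variable c : I -> G -> int.
Let tau i g h := Xi i (sigma g h) + c (dot i h) g + c i h - c i (g * h)%g.
Hypotheses (tau_fs : forall i x, fs (fun g => tau i g (ev x)))
  (tau_bounded : forall h, exists n : nat, forall i g, `|tau i h g| <= n%:Z).
Variables (D2 : seq A) (red2 : A -> A).
Hypotheses (red2_in : forall a, red2 a \in D2)
  (red2_sub : forall a, exists b, a - red2 a = b *+ (m * m))
  (red2P : forall a b, red2 a = red2 b <-> exists c, a - b = c *+ (m * m)).

Let C g := \sum_i e i *~ c i g.
Let scaled g h := \sum_i e i *~ tau i g h.
Let c0 g := red2 (C g).

Lemma scaledE g h : scaled g h = sigma g h *+ m + act (C g) h + C h - C (g * h)%g.
Proof.
have CE : act (C g) h = \sum_i e i *~ c (dot i h) g.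
  rewrite /C (act_sum actP) (reindex (dot^~ h)) /=; last first.
    by exists (dot^~ h^-1%g) => i _; rewrite (ecM ec) ?mulgV ?mulVg (ec1 ec).
  by apply: eq_bigr => i _; rewrite (ec_dot ec) (actMz actP) (actVK actP).
rewrite CE (ec_sum ec) /C -sumrN -!big_split /=; apply: eq_bigr => i _.
by rewrite /tau mulrzBr !mulrzDr.
Qed.

Lemma scaled_fs x : fs (fun g => scaled g (ev x)).
Proof.
pose F (t : I -> int) := \sum_i e i *~ t i.
apply: (@finite_state_comp _ _ _ _ _ F (fun g i => tau i g (ev x))).
by apply: finite_state_family => //; exact: finite_state_tt.
Qed.

(** In [scaledE] the value of [sigma] is multiplied by [m], so its residue mod [m] suffices to find
    the residue of [C (g * h)] mod [m * m]. *)
Lemma c0_step g g' h : c0 g = c0 g' -> scaled g h = scaled g' h ->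
  red1 (sigma g h) = red1 (sigma g' h) -> c0 (g * h)%g = c0 (g' * h)%g.
Proof.
move=> /red2P[z ez] es /red1P[y ey]; apply/red2P; exists (y + act z h).
have CM k : C (k * h)%g = sigma k h *+ m + act (C k) h + C h - scaled k h.
  by rewrite scaledE; zmod.
have {}ey : sigma g h *+ m = sigma g' h *+ m + y *+ (m * m).
  by rewrite mulrnA -ey mulrnBl addrC subrK.
have {}ez : act (C g) h = act (C g') h + act z h *+ (m * m).
  by rewrite -(actMn actP) -ez (actD actP) (actN actP); zmod.
by rewrite !CM es ey ez mulrnDl; zmod.
Qed.

Lemma c0_fs : fs c0.
Proof.
apply: (@finite_state_recursive _ _ _ gen _ _ D2
  (fun x g => (scaled g (ev x), red1 (sigma g (ev x))))).
- exact: finite_state_tt.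
- by move=> x; apply: finite_state_pair; [exact: scaled_fs|exact: sigma_fs].
- by move=> g; exact: red2_in.
- by move=> x g g' e0 [es er]; exact: c0_step.
Qed.

Lemma scaled_values k : finitely_valued (scaled k).
Proof.
have [n nP] := tau_bounded k.
have [Q [code codeP]] := @table_code_int G I (fun g i => tau i k g) n (fun g i => nP i g).
exists Q, code => g g' /codeP es; rewrite /scaled.
by apply: eq_bigr => i _; rewrite es.
Qed.

Theorem regular_refinement : exists b : G -> A,
  regular_cocycle act ev L (fun g h => sigma g h + act (b g) h + b h - b (g * h)%g).
Proof.
have /boolp.choice[d dP] : forall g, exists d, C g - c0 g = d *+ (m * m).
  by move=> g; exact: red2_sub.
pose b g := d g *+ m; pose s g h := sigma g h + act (b g) h + b h - b (g * h)%g.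
have bm g : b g *+ m = C g - c0 g by rewrite dP mulrnA.
have sm g h : s g h *+ m = scaled g h - act (c0 g) h - c0 h + c0 (g * h)%g.
  rewrite scaledE !mulrnDl mulNrn -(actMn actP) !bm (actD actP) (actN actP); zmod.
have red1s g h : red1 (s g h) = red1 (sigma g h).
  apply/red1P; exists (act (d g) h + d h - d (g * h)%g).
  by rewrite mulrnBl mulrnDl -(actMn actP) -/(b _) -/(b h) /s; zmod.
have s_fs x : fs (fun g => s g (ev x)).
  have : fs (fun g => ((scaled g (ev x), red1 (sigma g (ev x))), c0 g)).
    apply: finite_state_pair; last exact: c0_fs.
    by apply: finite_state_pair; [exact: scaled_fs|exact: sigma_fs].
  apply: finite_state_determined => g g' [es er ec0].
  apply: mulrn_red1_inj; last by rewrite !red1s.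
  by rewrite !sm es ec0 (c0_step ec0 es er).
(* With [k] on the left the formula [sm] contains [act (c0 k) g]; finiteness of the action makes
   this finitely valued in [g], through [rep]. *)
have s_values k : finitely_valued (s k).
  have [n [r [rep [act_rep _ _]]]] := action_representatives finP.
  have rep_values : finitely_valued rep by exists 'I_n, rep.
  have : finitely_valued (fun g => (((scaled k g, red1 (sigma k g)), (c0 g, c0 (k * g)%g)), rep g)).
    apply: finitely_valued_pair => //; apply: finitely_valued_pair.
      apply: finitely_valued_pair; first exact: scaled_values.
      by apply: (finitely_valued_in (s := D1)) => g; exact: red1_in.
    by apply: finitely_valued_pair; apply: (finitely_valued_in (s := D2)) => g; exact: red2_in.
  apply: finitely_valued_determined => g g' [es er e0 e0k erep].
  apply: mulrn_red1_inj; last by rewrite !red1s.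
  by rewrite !sm es e0 e0k -(act_rep g) -(act_rep g') erep.
exists b; split.
- exact: cocycle_add_coboundary.
- apply: sub_finite_set (finite_set_finitely_valued (fun x => s_values (ev x))).
  by move=> _ [_ [x _ <-] [g _ <-]]; exists g, x.
- apply: sub_finite_set (finite_set_finitely_valued
    (fun x => finite_state_finitely_valued gen (s_fs x))).
  by move=> _ [g _ [_ [x _ <-] <-]]; exists g, x.
- by move=> x a; exact: finite_state_rational (s_fs x).
Qed.

End Refined.

Theorem regular_representative (sigma : G -> G -> A) : cocycle2 act sigma ->
  exists b : G -> A,
    regular_cocycle act ev L (fun g h => sigma g h + act (b g) h + b h - b (g * h)%g).
Proof.
move=> sigmaP; pose s0 g h := sigma g h - act (sigma 1 1)%g h.
have s0E : s0 = fun g h => sigma g h + act (- sigma 1 1)%g h + - sigma 1%g 1%g - - sigma 1%g 1%g.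
  by apply/funext => g; apply/funext => h; rewrite (actN actP) /s0; zmod.
have s0P : cocycle2 act s0.
  by rewrite s0E; exact: (cocycle_add_coboundary actP (fun=> - sigma 1%g 1%g) sigmaP).
(* The cocycle identity at [(1, 1, g)] gives [sigma 1 g = act (sigma 1 1) g], which the constant
   cochain in [s0E] removes. *)
have s01 g : s0 1%g g = 0.
  have := sigmaC sigmaP 1%g 1%g g; rewrite !mul1g => /addIr e.
  by rewrite /s0 e subrr.
have [m [I [e [Xi [dot [m0 ec]]]]]] := equivariant_coordinates_exist actP finP fgA.
have [D1 [red1 [red1_in _ red1P]]] := residues fgA m0.
have mm0 : (0 < m * m)%N by rewrite muln_gt0 m0.
have [D2 [red2 [red2_in red2_sub red2P]]] := residues fgA mm0.
pose s1 := tree_cocycle ev act s0.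
have s1P : cocycle2 act s1 by move=> g h k; exact: tree_cocycleM.
have s11 g : s1 1%g g = 0.
  by rewrite /s1 /tree_cocycle s01 (tree_cochain1 gen) (act0 actP) mul1g add0r add0r subrr.
have s1_fs x : fs (fun g => red1 (s1 g (ev x))).
  apply: (finite_state_tree_cocycle gen sym LI actP s0P s01 red1_in) => [a a' b b'|a a'|a a' g].
  - exact: (red_add red1P).
  - exact: (red_opp red1P).
  - exact: (red_act red1P).
have [c [tau_fs tau_b]] :=
  optimal_cocycle gen sym LI actP s1P s11 (ecD ec) (ec_act ec) (ec1 ec) (ecM ec).
have [|b bP] := regular_refinement m0 ec red1_in red1P s1P s1_fs tau_fs _ red2_in red2_sub red2P.
  by move=> h; have [n nP] := tau_b h; exists n => i g; case: (nP i g).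
exists (fun g => b g + tree_cochain ev s0 g - sigma 1%g 1%g).
congr (regular_cocycle _ _ _ _): bP; apply/funext => g; apply/funext => h.
by rewrite /s1 /tree_cocycle /s0 !(actD actP) (actN actP); zmod.
Qed.

End Regular.

Theorem mainTheorem3 (R : realType) (G : groupType) (A : zmodType)
    (act : A -> G -> A) (X : finType) (ev : X -> G)
    (fuchsian_G : fuchsian R G)
    (fg_A : finitely_generated_abelian A)
    (action_act : right_action act)
    (finite_act : finite_action act)
    (gen_X : generates_as_monoid ev)
    (sym_X : symmetric_image ev) :
  forall c : set (G -> G -> A), H2 act c ->
    exists sigma : G -> G -> A,
      c sigma /\ regular_cocycle act ev (geodesic_language ev) sigma.
Proof.
move=> _ [sigma sigmaP <-].
have [_ [rho [rho_inj rho_isolated]]] := fuchsian_G.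
have LI := fuchsian_linear_isoperimetric rho_inj rho_isolated gen_X sym_X.
have [b bP] := regular_representative gen_X sym_X LI action_act finite_act fg_A sigmaP.
eexists; split; last exact: bP; split; first exact: cocycle_add_coboundary.
exists b => //; apply/funext => g; apply/funext => h; zmod.
Qed.
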